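(* Let $0\le s<\frac12$. Then $E_s=H_0^s(\mathbb R_+^2)$, and there is a constant $c_s>0$ such that the zero extension $\tilde u$ of each $u\in E_s=H_0^s(\mathbb R_+^2)$ satisfies $$\|\tilde u\|_{H^s(\mathbb R^2)}\le c_s\,\|u\|_{H^s(\mathbb R_+^2)}.$$
   Context: $\mathbb R_+^2=(0,\infty)\times(0,\infty)$. For $s\ge0$, $H^s(\mathbb R^2)$ is the set of $\varphi\in L^2(\mathbb R^2)$ with $\|\varphi\|_{H^s(\mathbb R^2)}:=\|(1+|k|^2)^{s/2}\mathcal F\{\varphi\}(k)\|_{L^2(\mathbb R^2)}<\infty$, where $\mathcal F$ is the Fourier transform on $\mathbb R^2$. $H^s(\mathbb R_+^2)$ is the space of restrictions to $\mathbb R_+^2$ of elements of $H^s(\mathbb R^2)$, with norm $\|\phi\|_{H^s(\mathbb R_+^2)}=\inf\{\|\varphi\|_{H^s(\mathbb R^2)}:\varphi|_{\mathbb R_+^2}=\phi\}$. $\mathcal D(\mathbb R_+^2)$ is the space of test functions ($C^\infty$ functions with compact support contained in the open quadrant $\mathbb R_+^2$). $H_0^s(\mathbb R_+^2)$ is the closure of $\mathcal D(\mathbb R_+^2)$ in $H^s(\mathbb R_+^2)$. For a function $u$ on $\mathbb R_+^2$, $\tilde u$ denotes its extension by zero to $\mathbb R^2$. For $s\ge0$, $E_s:=\{u\in L^2(\mathbb R_+^2):\tilde u\in H^s(\mathbb R^2)\}$. *)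

(* Defs.v *)
From HB Require Import structures.
From mathcomp Require Import all_boot all_order all_algebra.
From mathcomp Require Import complex.
From mathcomp Require Import all_classical all_reals all_analysis.

Set Implicit Arguments.
Unset Strict Implicit.
Unset Printing Implicit Defensive.

Import Order.TTheory GRing.Theory Num.Theory.
Import numFieldNormedType.Exports.

Local Open Scope classical_set_scope.
Local Open Scope ring_scope.
Local Open Scope complex_scope.

(* Elements of L^2 and of the Sobolev spaces are represented by Borel
   measurable functions rather than by classes modulo a.e. equality; every
   class has such a representative, and on Borel measurable functions the
   notions below are invariant under modification on a null set.
   A function on the quadrant is represented by a function on the whole plane
   whose values off the quadrant are irrelevant. *)

Section Sobolev.
Context {R : realType}.
Local Notation plane := (R * R)%type.
Local Notation lebesgue2 := (@lebesgue_measure R \x @lebesgue_measure R)%E.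
Local Notation normc := (@Normc.normc R).
Local Notation Re := (@complex.Re R).
Local Notation Im := (@complex.Im R).
Implicit Types (D : set plane) (s : R) (f g phi psi u : plane -> R[i]).

Definition quadrant : set plane := [set x | 0 < x.1 /\ 0 < x.2].

Definition cmeasurable D f : Prop :=
  measurable_fun D (Re \o f) /\ measurable_fun D (Im \o f).

(* meaningful when f is integrable *)
Definition cintegral f : R[i] :=
  Rintegral lebesgue2 setT (Re \o f)
  +i* Rintegral lebesgue2 setT (Im \o f).

Definition in_L1 f : Prop :=
  cmeasurable setT f /\ (\int[lebesgue2]_x (normc (f x))%:E < +oo)%E.

Definition in_L2 D f : Prop :=
  cmeasurable D f /\
  (\int[lebesgue2]_(x in D) (normc (f x) ^+ 2)%:E < +oo)%E.

Definition L2norm f : \bar R := 'N[lebesgue2]_2%:E[EFin \o normc \o f]%E.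

Definition cis (t : R) : R[i] := cos t +i* sin t.

Definition fourier_integral phi : plane -> R[i] := fun k =>
  ((2 * pi)^-1)%:C *
  cintegral (fun x => cis (- (k.1 * x.1 + k.2 * x.2)) * phi x).

(* The graph of the Fourier transform on L^2: the closure in L^2 x L^2 of the
   graph of the Fourier integral on the intersection of L^1 and L^2. By
   Plancherel's theorem it is the graph of a unitary map of L^2. *)
Definition is_fourier phi g : Prop :=
  in_L2 setT phi /\ in_L2 setT g /\
  exists phi_ : nat -> plane -> R[i],
    [/\ forall n, in_L1 (phi_ n) /\ in_L2 setT (phi_ n),
        L2norm (fun x => phi_ n x - phi x) @[n --> \oo] --> 0%E
      & L2norm (fun k => fourier_integral (phi_ n) k - g k) @[n --> \oo]
          --> 0%E].

(* a representative of the Fourier transform of phi when phi is in L^2 *)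
Definition fourier phi : plane -> R[i] :=
  xget (fun=> 0) [set g | is_fourier phi g].

(* meaningful when phi is in L^2 *)
Definition Hnorm s phi : \bar R :=
  L2norm (fun k => ((1 + (k.1 ^+ 2 + k.2 ^+ 2)) `^ (s / 2))%:C * fourier phi k).

Definition Hspace s : set (plane -> R[i]) :=
  [set phi | in_L2 setT phi /\ (Hnorm s phi < +oo)%E].

(* The norm of H^s of the quadrant: the infimum over all extensions, which is
   +oo when there are none. *)
Definition HnormQ s u : \bar R :=
  ereal_inf [set Hnorm s phi | phi in
    [set phi | Hspace s phi /\ (phi = u %[ae lebesgue2 in quadrant])]].

Definition HspaceQ s : set (plane -> R[i]) :=
  [set u | in_L2 quadrant u /\
    exists2 phi, Hspace s phi & (phi = u %[ae lebesgue2 in quadrant])].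

Fixpoint Ck (n : nat) (h : plane -> R) : Prop :=
  if n is m.+1 then
    [/\ continuous h,
        (forall x, derivable h x (1, 0)) /\ Ck m (fun x => 'D_(1, 0) h x)
      & (forall x, derivable h x (0, 1)) /\ Ck m (fun x => 'D_(0, 1) h x)]
  else continuous h.

Definition smooth f : Prop :=
  forall n, Ck n (Re \o f) /\ Ck n (Im \o f).

(* test functions on the quadrant, extended by zero to the plane *)
Definition test_functionQ : set (plane -> R[i]) :=
  [set psi | [/\ smooth psi,
    compact (closure [set x | psi x != 0]) &
    closure [set x | psi x != 0] `<=` quadrant]].

(* closure of the test functions in H^s of the quadrant *)
Definition H0spaceQ s : set (plane -> R[i]) :=
  [set u | HspaceQ s u /\
    forall e : R, 0 < e ->
      exists2 psi, test_functionQ psi &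
        (HnormQ s (fun x => u x - psi x)%R < e%:E)%E].

Definition zero_ext u : plane -> R[i] := patch (fun=> 0) quadrant u.

Definition Espace s : set (plane -> R[i]) :=
  [set u | in_L2 quadrant u /\ Hspace s (zero_ext u)].

End Sobolev.

(* Main.v *)
Require Import Defs.
From HB Require Import structures.
From mathcomp Require Import all_boot all_order all_algebra.
From mathcomp Require Import complex.
From mathcomp Require Import all_classical all_reals all_analysis.
From mathcomp Require Import ring lra measurable_realfun.
Set Implicit Arguments.
Unset Strict Implicit.
Unset Printing Implicit Defensive.
Import Order.TTheory GRing.Theory Num.Theory.
Import numFieldNormedType.Exports.
Local Open Scope classical_set_scope.
Local Open Scope ring_scope.
Local Open Scope complex_scope.

(** For [0 < s < 1/2] the [H^s] norm is compared with the Gagliardo seminorms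
    along the two axes: by Plancherel the difference of step [h] in the
    direction [e] has squared [L^2] norm [\int (2 - 2 cos (h k.e)) |g k|^2], and
    integrating against [h^(-1-2s)] gives [|k.e|^(2s)] up to constants.
    For these seminorms, multiplication by the indicator of a half-plane
    [x_i > a] is bounded: the new terms add up to [\int f^2 (x_i - a)^(-2s)],
    which the fractional Hardy inequality controls because [2s < 1]. The zero
    extension of [u] is the indicator of the quadrant times any extension of
    [u], whence the norm bound and [H_0^s <= E_s]. Conversely, a zero extension
    is cut off at infinity (by the same multiplier bound and dominated
    convergence), then averaged over small translations into the quadrant, which
    yields test functions. For [s = 0] the seminorms are replaced by zero. *)

(** * Measurability and nonnegative integrals *)

(** The [H^s] norm refers to an [L^2] Fourier transform that is a closure of graphs, with a
    representative picked by [xget]. Before the norm can be compared with differences of [phi]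
    itself, Plancherel's identity, the completeness of [L^2] and the rule for translations have to
    be established. The resulting quantity [cnrm] no longer mentions a transform, so the choice of
    representative cannot matter, and all estimates near the boundary are made on it. Norms appear
    squared, and for real and imaginary parts separately. Outside Plancherel's identity, which must
    be sharp, the triangle inequality is replaced by [(a + b)^2 <= 2 (a^2 + b^2)]: the factors 2 are
    harmless where only finiteness, smallness or some constant matters. Seminorms along the axes fit
    the quadrant: cutting by [x_1 > a] creates no new differences parallel to the boundary, so
    Hardy's inequality is needed in the normal direction only. Ordinary mollification would spill
    over the boundary. The bump is therefore supported where both coordinates are negative and
    bounded away from 0, and [w (x + z)] is averaged over such [z]. *)

Section measurability.
Context {d} {T : measurableType d} {R : realType}.
Implicit Types f g : T -> R.
Local Notation meas := (measurable_fun (@setT T)).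

Lemma mfD f g : meas f -> meas g -> meas (fun x => f x + g x).
Proof. exact: measurable_funD. Qed.
Lemma mfB f g : meas f -> meas g -> meas (fun x => f x - g x).
Proof. exact: measurable_funB. Qed.
Lemma mfM f g : meas f -> meas g -> meas (fun x => f x * g x).
Proof. exact: measurable_funM. Qed.
Lemma mfN f : meas f -> meas (fun x => - f x).
Proof. exact: measurable_funN. Qed.
Lemma mfX n f : meas f -> meas (fun x => f x ^+ n).
Proof. exact: measurable_funX. Qed.
Lemma mfE f : meas f -> meas (fun x => (f x)%:E).
Proof. by move=> mf; apply/measurable_EFinP. Qed.
Lemma mf_norm f : meas f -> meas (fun x => `|f x|).
Proof. by move=> mf; apply: measurableT_comp. Qed.
Lemma mf_exp f : meas f -> meas (fun x => expR (f x)).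
Proof. by move=> mf; apply: (measurableT_comp (@measurable_expR _)). Qed.
Lemma mf_powR p f : meas f -> meas (fun x => f x `^ p).
Proof. by move=> mf; apply: (measurableT_comp (@measurable_powR _ p)). Qed.
Lemma mf_cos f : meas f -> meas (fun x => cos (f x)).
Proof.
move=> mf; apply: (measurableT_comp _ mf); apply: continuous_measurable_fun.
exact: continuous_cos.
Qed.
Lemma mf_sin f : meas f -> meas (fun x => sin (f x)).
Proof.
move=> mf; apply: (measurableT_comp _ mf); apply: continuous_measurable_fun.
exact: continuous_sin.
Qed.
Lemma mf_fst {d1 d2} {T1 : measurableType d1} {T2 : measurableType d2}
  (f : T -> T1 * T2) : meas f -> meas (fun x => (f x).1).
Proof. by move=> mf; apply: (measurableT_comp measurable_fst). Qed.
Lemma mf_snd {d1 d2} {T1 : measurableType d1} {T2 : measurableType d2}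
  (f : T -> T1 * T2) : meas f -> meas (fun x => (f x).2).
Proof. by move=> mf; apply: (measurableT_comp measurable_snd). Qed.
Lemma mf_comp {d1 d2} {T1 : measurableType d1} {T2 : measurableType d2}
  (g : T1 -> T2) (f : T -> T1) : measurable_fun setT g -> meas f -> meas (fun x => g (f x)).
Proof. by move=> mg mf; apply: (measurableT_comp mg). Qed.
Lemma mf_max f g : meas f -> meas g -> meas (fun x => Num.max (f x) (g x)).
Proof. exact: measurable_maxr. Qed.
Lemma mf_min f g : meas f -> meas g -> meas (fun x => Num.min (f x) (g x)).
Proof. exact: measurable_minr. Qed.
End measurability.

Ltac meas1 := first
 [ assumption
 | match goal with
   | H : measurable_fun setT ?a |- measurable_fun setT (fun x => ?a (@?e x)) =>
       apply: (mf_comp H)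
   | |- measurable_fun _ (fun x => (_, _)) => apply: measurable_fun_pair
   | |- measurable_fun _ (fun x => _ < _) => apply: measurable_fun_ltr
   | |- measurable_fun _ (fun x => _ <= _) => apply: measurable_fun_ler
   | |- measurable_fun _ (fun x => andb _ _) => apply: measurable_and
   | |- measurable_fun _ (fun x => EFin _) => apply: mfE
   | |- measurable_fun _ (fun x => (_ - _)%R) => apply: mfB
   | |- measurable_fun _ (fun x => (_ + _)%R) => apply: mfD
   | |- measurable_fun _ (fun x => (_ * _)%R) => apply: mfM
   | |- measurable_fun _ (fun x => (- _)%R) => apply: mfN
   | |- measurable_fun _ (fun x => (_ ^+ _)%R) => apply: mfX
   | |- measurable_fun _ (fun x => (_ `^ _)%R) => apply: mf_powR
   | |- measurable_fun _ (fun x => (Num.norm _)%R) => apply: mf_norm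
   | |- measurable_fun _ (fun x => expR _) => apply: mf_exp
   | |- measurable_fun _ (fun x => cos _) => apply: mf_cos
   | |- measurable_fun _ (fun x => sin _) => apply: mf_sin
   | |- measurable_fun _ (fun x => Num.max _ _) => apply: mf_max
   | |- measurable_fun _ (fun x => Num.min _ _) => apply: mf_min
   | |- measurable_fun _ (fun x => (_ + _)%E) => apply: emeasurable_funD
   | |- measurable_fun _ (fun x => (_ * _)%E) => apply: emeasurable_funM
   | |- measurable_fun _ (fun x => (@?e x).1) => apply: mf_fst
   | |- measurable_fun _ (fun x => (@?e x).2) => apply: mf_snd
   end
 | exact: measurable_cst
 | exact: measurable_id
 | exact: measurable_fst
 | exact: measurable_snd ].
Ltac meas := repeat first [meas1 | apply: measurable_fun_ifT | apply: measurable_and | apply: measurable_fun_ltr | apply: measurable_fun_ler].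

Section nonneg_integral.
Context {d} {T : measurableType d} {R : realType}.
Variable m : {measure set T -> \bar R}.
Local Open Scope ereal_scope.

(** Both sides are suprema over nonnegative simple functions, and a simple function below [f] is
    below [g]. The comparison thus applies to arbitrary nonnegative functions. *)
Lemma le_int (f g : T -> \bar R) : (forall x, 0 <= f x) -> (forall x, f x <= g x) ->
  \int[m]_x f x <= \int[m]_x g x.
Proof.
move=> f0 fg; have g0 x : 0 <= g x by exact: le_trans (fg x).
rewrite !ge0_integralTE//; apply: le_ereal_sup => _ [h hf <-].
by exists h => // x; exact: le_trans (fg x).
Qed.

Lemma le_intR (f g : T -> R) : (forall x, 0 <= f x)%R -> (forall x, f x <= g x)%R ->
  \int[m]_x (f x)%:E <= \int[m]_x (g x)%:E.
Proof. by move=> f0 fg; apply: le_int => x; rewrite lee_fin. Qed.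

Lemma intR_ge0 (f : T -> R) : (forall x, 0 <= f x)%R -> 0 <= \int[m]_x (f x)%:E.
Proof. by move=> f0; apply: integral_ge0 => x _; rewrite lee_fin. Qed.

Lemma intRD (f g : T -> R) : measurable_fun setT f -> measurable_fun setT g ->
  (forall x, 0 <= f x)%R -> (forall x, 0 <= g x)%R ->
  \int[m]_x (f x + g x)%:E = \int[m]_x (f x)%:E + \int[m]_x (g x)%:E.
Proof.
move=> mf mg f0 g0; under eq_integral do rewrite EFinD.
rewrite ge0_integralD//; try by move=> x _; rewrite lee_fin.
all: by apply/measurable_EFinP.
Qed.

Lemma intRZ (k : R) (f : T -> R) : measurable_fun setT f -> (0 <= k)%R ->
  (forall x, 0 <= f x)%R ->
  \int[m]_x (k * f x)%:E = k%:E * \int[m]_x (f x)%:E.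
Proof.
move=> mf k0 f0; under eq_integral do rewrite EFinM.
rewrite ge0_integralZl_EFin//; first by move=> x _; rewrite lee_fin.
by apply/measurable_EFinP.
Qed.

(** The push-forward of [m] by [phi] agrees with [m] on measurable sets, so this is the push-forward
    formula. *)
Lemma int_preserving (phi : T -> T) (f : T -> \bar R) : measurable_fun setT phi ->
  (forall A, measurable A -> m (phi @^-1` A) = m A) ->
  measurable_fun setT f -> (forall x, 0 <= f x) ->
  \int[m]_x f (phi x) = \int[m]_x f x.
Proof.
move=> mphi pres mf f0.
rewrite -[LHS](@ge0_integral_pushforward _ _ _ _ _ phi mphi m setT f)//.
by apply: eq_measure_integral => // A mA _; exact: pres.
Qed.
End nonneg_integral.

Section measurable_integral.
Context {d1 d2} {T1 : measurableType d1} {T2 : measurableType d2} {R : realType}.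
Variables (m2 : {sigma_finite_measure set T2 -> \bar R}) (f : T1 * T2 -> \bar R).
Local Open Scope ereal_scope.

(** Tonelli's theorem gives the nonnegative case, to which the positive and negative parts reduce.
    Measurability of parametrised integrals such as [cosT] and [sinT] comes from here. *)
Lemma measurable_int2 : measurable_fun setT f ->
  measurable_fun setT (fun x => \int[m2]_y f (x, y)).
Proof.
move=> mf.
have -> : (fun x => \int[m2]_y f (x, y)) = (fun x => \int[m2]_y (f^\+ (x, y)) - \int[m2]_y (f^\- (x, y))).
  apply/funext => x; rewrite [LHS]integralE. by congr (_ - _); apply: eq_integral => y _; rewrite ?funeposE ?funenegE.
apply: emeasurable_funB.
  by apply: (measurable_fun_fubini_tonelli_F (m2 := m2) (f^\+)) => //; exact: measurable_funepos.
by apply: (measurable_fun_fubini_tonelli_F (m2 := m2) (f^\-)) => //; exact: measurable_funeneg.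
Qed.
End measurable_integral.

(** * Sigma-finite products of Lebesgue measure *)

Section products.
Context {R : realType}.
Lemma sigma_finite_product d1 d2 (T1 : measurableType d1) (T2 : measurableType d2)
  (m1 : {sigma_finite_measure set T1 -> \bar R}) (m2 : {sigma_finite_measure set T2 -> \bar R}) :
  sigma_finite setT (m1 \x m2)%E.
Proof.
have /sigma_finiteP[F [TF ndF Foo]] := sigma_finiteT m1.
have /sigma_finiteP[G [TG ndG Goo]] := sigma_finiteT m2.
exists (fun n => F n `*` G n).
  rewrite -setXTT TF TG predeqE => -[x y]; split.
    (* A point may enter [F] and [G] at different indices; monotonicity places it in both at the
       larger one. *)
    move=> [/= [n _ Fnx] [k _ Gky]]; exists (maxn n k) => //; split.
    - by move: x Fnx; exact/subsetPset/ndF/leq_maxl.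
    - by move: y Gky; exact/subsetPset/ndG/leq_maxr.
  by move=> [n _ []/= ? ?]; split; exists n.
move=> k; have [? ?] := Foo k; have [? ?] := Goo k.
split; first exact: measurableX.
by rewrite product_measure1E// lte_mul_pinfty// ge0_fin_numE.
Qed.
Local Notation mu := (@lebesgue_measure R).
Local Notation RR := (measurableTypeR R).
(* Named copies of the product measures, so that their s-finite structure is
   found by unification when products are iterated. *)
Definition leb2 : set (RR * RR)%type -> \bar R := (mu \x mu)%E.
HB.instance Definition _ := Measure.copy leb2 (mu \x mu)%E.
HB.instance Definition _ := Measure_isSigmaFinite.Build _ _ _ leb2 (sigma_finite_product mu mu).
Definition leb3 : set (RR * (RR * RR))%type -> \bar R := (mu \x leb2)%E.
HB.instance Definition _ := Measure.copy leb3 (mu \x leb2)%E.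
HB.instance Definition _ := Measure_isSigmaFinite.Build _ _ _ leb3 (sigma_finite_product mu leb2).
Definition leb4 : set ((RR * RR) * (RR * RR))%type -> \bar R := (leb2 \x leb2)%E.
HB.instance Definition _ := Measure.copy leb4 (leb2 \x leb2)%E.
HB.instance Definition _ := Measure_isSigmaFinite.Build _ _ _ leb4 (sigma_finite_product leb2 leb2).
End products.

(** * Tonelli's theorem, translations and reflections *)

Section plane.
Context {R : realType}.
Local Notation mu := (@lebesgue_measure R).
Local Notation leb2 := (@leb2 R).
Local Notation leb3 := (@leb3 R).
Local Notation leb4 := (@leb4 R).
Local Open Scope ereal_scope.

Lemma tonelli2F (f : R * R -> \bar R) : measurable_fun setT f -> (forall x, 0 <= f x) ->
  \int[leb2]_x f x = \int[mu]_x \int[mu]_y f (x, y).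
Proof. by move=> mf f0; exact: (@fubini_tonelli1 _ _ _ _ R mu mu f mf f0). Qed.
Lemma tonelli2G (f : R * R -> \bar R) : measurable_fun setT f -> (forall x, 0 <= f x) ->
  \int[leb2]_x f x = \int[mu]_y \int[mu]_x f (x, y).
Proof. by move=> mf f0; exact: (@fubini_tonelli2 _ _ _ _ R mu mu f mf f0). Qed.
Lemma tonelli3F (f : R * (R * R) -> \bar R) : measurable_fun setT f -> (forall x, 0 <= f x) ->
  \int[leb3]_x f x = \int[mu]_x \int[leb2]_y f (x, y).
Proof. by move=> mf f0; exact: (@fubini_tonelli1 _ _ _ _ R mu leb2 f mf f0). Qed.
Lemma tonelli3G (f : R * (R * R) -> \bar R) : measurable_fun setT f -> (forall x, 0 <= f x) ->
  \int[leb3]_x f x = \int[leb2]_y \int[mu]_x f (x, y).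
Proof. by move=> mf f0; exact: (@fubini_tonelli2 _ _ _ _ R mu leb2 f mf f0). Qed.
Lemma tonelli4F (f : (R * R) * (R * R) -> \bar R) : measurable_fun setT f -> (forall x, 0 <= f x) ->
  \int[leb4]_x f x = \int[leb2]_x \int[leb2]_y f (x, y).
Proof. by move=> mf f0; exact: (@fubini_tonelli1 _ _ _ _ R leb2 leb2 f mf f0). Qed.
Lemma tonelli4G (f : (R * R) * (R * R) -> \bar R) : measurable_fun setT f -> (forall x, 0 <= f x) ->
  \int[leb4]_x f x = \int[leb2]_y \int[leb2]_x f (x, y).
Proof. by move=> mf f0; exact: (@fubini_tonelli2 _ _ _ _ R leb2 leb2 f mf f0). Qed.
Lemma measurable_int_mu d (T : measurableType d) (f : T * R -> \bar R) : measurable_fun setT f ->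
  measurable_fun setT (fun x => \int[mu]_y f (x, y)).
Proof. by move=> mf; exact: (@measurable_int2 _ _ T (measurableTypeR R) R mu f mf). Qed.
Lemma measurable_int_leb2 d (T : measurableType d) (f : T * (R * R) -> \bar R) : measurable_fun setT f ->
  measurable_fun setT (fun x => \int[leb2]_y f (x, y)).
Proof. by move=> mf; exact: (@measurable_int2 _ _ T (measurableTypeR R * measurableTypeR R)%type R leb2 f mf). Qed.

(** Lebesgue measure is determined by its values on half-open intervals, and a translation maps such
    an interval to one of the same length. *)
Lemma int_shift (c : R) (f : R -> \bar R) : measurable_fun setT f -> (forall x, 0 <= f x) ->
  \int[mu]_x f (x + c)%R = \int[mu]_x f x.
Proof.
move=> mf f0; apply: (@int_preserving _ _ _ mu (fun x : measurableTypeR R => (x + c)%R : measurableTypeR R)) => //; first by meas.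
move=> A mA.
have mphi : measurable_fun setT ((fun x : R => x + c)%R : R -> measurableTypeR R) by meas.
apply/esym. apply: (@lebesgue_measure_unique _ (pushforward mu (fun x : measurableTypeR R => (x + c)%R : measurableTypeR R))) => //= _ [[a b]] _ <-.
rewrite /pushforward.
rewrite (_ : _ @^-1` _ = `](a - c)%R, (b - c)%R]%classic); last first.
  by apply/seteqP; split => x /=; rewrite !in_itv/= ltrBlDr lerBrDr.
rewrite !lebesgue_measure_itv/= !lte_fin ltrD2r; case: ifPn => // _.
by rewrite -!EFinD; congr (_%:E); lra.
Qed.

Lemma int_opp (f : R -> \bar R) : measurable_fun setT f -> (forall x, 0 <= f x) ->
  \int[mu]_x f (- x)%R = \int[mu]_x f x.
Proof.
move=> mf f0; apply: (@int_preserving _ _ _ mu (fun x : measurableTypeR R => (- x)%R : measurableTypeR R)) => //; first by meas.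
exact: lebesgue_measureN.
Qed.

Lemma int_shift2 (c : R * R) (f : R * R -> \bar R) : measurable_fun setT f -> (forall x, 0 <= f x) ->
  \int[leb2]_x f (x.1 + c.1, x.2 + c.2)%R = \int[leb2]_x f x.
Proof.
move=> mf f0; rewrite tonelli2F//; last by meas.
rewrite (tonelli2F mf f0).
rewrite -[RHS](int_shift c.1); last 2 first.
- exact: measurable_int_mu.
- by move=> x; exact: integral_ge0.
apply: eq_integral => x _ /=.
rewrite -[RHS](int_shift c.2)//.
by apply: (mf_comp mf); meas.
Qed.

Lemma int_opp2 (f : R * R -> \bar R) : measurable_fun setT f -> (forall x, 0 <= f x) ->
  \int[leb2]_x f (- x.1, - x.2)%R = \int[leb2]_x f x.
Proof.
move=> mf f0; rewrite tonelli2F//; last by meas.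
rewrite (tonelli2F mf f0).
rewrite -[RHS]int_opp; last 2 first.
- exact: measurable_int_mu.
- by move=> x; exact: integral_ge0.
apply: eq_integral => x _ /=.
rewrite -[RHS]int_opp//.
by apply: (mf_comp mf); meas.
Qed.

End plane.

(** * Continuity of translations in L^2 *)

Section vanishing.
Context {R : realType}.
Implicit Types u v : nat -> \bar R.
Local Open Scope ereal_scope.

(** Convergence to 0 for nonnegative extended-real sequences, whose early terms may be infinite. The
    one-sided form is inherited by smaller sequences. *)
Definition vanishing u : Prop := forall e : R, (0 < e)%R -> exists N, forall n, (N <= n)%N -> u n <= e%:E.

Lemma vanishing_le u v : (forall n, u n <= v n) -> vanishing v -> vanishing u.
Proof.
move=> uv hv e e0; have [N hN] := hv e e0; exists N => n Nn.
exact: le_trans (uv n) (hN n Nn).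
Qed.

Lemma vanishingD u v : vanishing u -> vanishing v -> vanishing (fun n => u n + v n).
Proof.
move=> hu hv e e0; have e2 : (0 < e / 2)%R by rewrite divr_gt0.
have [N hN] := hu _ e2; have [M hM] := hv _ e2; exists (maxn N M) => n.
rewrite geq_max => /andP[Nn Mn].
by rewrite (splitr e) EFinD; apply: leeD; [exact: hN|exact: hM].
Qed.

Lemma vanishingZ (c : R) u : (0 <= c)%R -> vanishing u -> vanishing (fun n => c%:E * u n).
Proof.
(* Dividing by [c + 1] rather than [c] covers [c = 0]. *)
move=> c0 hu e e0; have c1 : (0 < c + 1)%R by rewrite ltr_wpDl.
have e2 : (0 < e / (c + 1))%R by rewrite divr_gt0.
have [N hN] := hu _ e2; exists N => n Nn.
apply: (@le_trans _ _ (c%:E * (e / (c + 1))%:E)); first by rewrite lee_wpmul2l ?lee_fin ?hN.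
rewrite -EFinM lee_fin mulrCA ger_pMr// ler_pdivrMr// mul1r; lra.
Qed.

Lemma cvg0_vanishing u : u n @[n --> \oo] --> 0 -> vanishing u.
Proof.
move=> /fine_cvgP[[N1 _ h1] /cvgrPdist_le h2] e e0.
have [N2 _ h3] := h2 e e0; exists (maxn N1 N2) => n.
rewrite geq_max => /andP[Nn Mn].
have := h3 n Mn; have /= fn := h1 n Nn; rewrite sub0r normrN => /= h.
by rewrite -(fineK fn) lee_fin; apply: le_trans h; exact: ler_norm.
Qed.

Lemma vanishing_cvg0 u : (forall n, 0 <= u n) -> vanishing u -> u n @[n --> \oo] --> 0.
Proof.
move=> u0 hu; have fin : \forall n \near \oo, u n \is a fin_num.
  have [N hN] := hu 1%R ltr01; exists N => // n /= Nn.
  by rewrite ge0_fin_numE//; apply: le_lt_trans (hN n Nn) _; exact: ltry.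
apply/fine_cvgP; split => //.
apply/cvgrPdist_le => e e0; have [N hN] := hu e e0; near=> n.
have fn : u n \is a fin_num by near: n.
rewrite sub0r normrN /= ger0_norm ?fine_ge0//.
rewrite -lee_fin fineK//; apply: hN; near: n; by exists N.
Unshelve. all: by end_near. Qed.

Lemma vanishingN (u : nat -> R) : (forall n, 0 <= u n)%R -> u n @[n --> \oo] --> (0 : R)%R -> vanishing (EFin \o u).
Proof.
move=> u0 /cvgrPdist_le h e e0; have [N _ hN] := h e e0; exists N => n Nn.
by rewrite /= lee_fin; have := hN n Nn; rewrite sub0r normrN ger0_norm.
Qed.

(** An integrable majorant is finite almost everywhere, so pointwise convergence is asked only where
    [g] is finite. When [g] is itself an integral over slices, this is the set of square-integrable
    slices. *)
Lemma dominated_vanishing d (T : measurableType d) (m : {measure set T -> \bar R})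
    (f : nat -> T -> \bar R) (g : T -> \bar R) :
  (forall n, measurable_fun setT (f n)) -> measurable_fun setT g ->
  (forall n x, 0 <= f n x <= g x) -> \int[m]_x g x < +oo ->
  (forall x, g x < +oo -> vanishing (f ^~ x)) -> vanishing (fun n => \int[m]_x f n x).
Proof.
move=> mf mg fg ig fv.
have g0 x : 0 <= g x by have /andP[h1 h2] := fg 0%N x; exact: le_trans h1 h2.
have intg : m.-integrable setT g.
  apply/integrableP; split => //; under eq_integral do rewrite gee0_abs//.
  exact: ig.
have ae0 : {ae m, forall x, setT x -> f n x @[n --> \oo] --> cst 0 x}.
  have := integrable_ae measurableT intg; apply: filterS => x /(_ I) gx _.
  apply: vanishing_cvg0; first by move=> n; have /andP[] := fg n x.
  by apply: fv; rewrite -ge0_fin_numE.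
have aeg : {ae m, forall x n, setT x -> `|f n x| <= g x}.
  by apply/aeW => x n _; have /andP[h1 h2] := fg n x; rewrite gee0_abs.
have [_ _] := dominated_convergence measurableT mf (measurable_cst _) ae0 intg aeg.
by rewrite integral0 => h; exact: cvg0_vanishing.
Qed.

End vanishing.

(** * Translations in [L^2] of the line *)

Section translation1.
Context {R : realType}.
Local Notation mu := (@lebesgue_measure R).
Implicit Types v g : R -> R.

Lemma sqr3 (a b c : R) : ((a + b + c) ^+ 2 <= 3 * (a ^+ 2 + b ^+ 2 + c ^+ 2))%R.
Proof.
rewrite -subr_ge0 (_ : _ - _ = (a - b) ^+ 2 + (a - c) ^+ 2 + (b - c) ^+ 2)%R; last by ring.
by rewrite !addr_ge0 ?sqr_ge0.
Qed.

Lemma sqr2 (a b : R) : ((a + b) ^+ 2 <= 2 * (a ^+ 2 + b ^+ 2))%R.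
Proof.
rewrite -subr_ge0 (_ : _ - _ = (a - b) ^+ 2)%R; last by ring.
by rewrite sqr_ge0.
Qed.

(** Clipping to [[-K, K]] is 1-Lipschitz and fixes [a]. *)
Lemma clip_dist (K a b : R) : - K <= a <= K -> `|a - Num.max (- K) (Num.min K b)| <= `|a - b|.
Proof.
move=> /andP[a1 a2]; have := ler_norm (a - b); have := ler_norm (b - a); rewrite distrC.
rewrite /Num.min; case: (ltP K b) => h1; rewrite /Num.max;
 [case: (ltP (- K) K) => h2|case: (ltP (- K) b) => h2]; rewrite ler_norml => *; apply/andP; split; lra.
Qed.

Lemma cvg_shift (v : R -> R) (t : nat -> R) (x : R) : continuous v -> t n @[n --> \oo] --> (0 : R) ->
  v (x + t n) @[n --> \oo] --> v x.
Proof.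
move=> cv t0; apply: continuous_cvg; first exact: cv.
by rewrite -[X in _ --> X]addr0; apply: cvgD => //; exact: cvg_cst.
Qed.

(** Continuity is stated along sequences, the form in which dominated convergence delivers it. *)
Definition L2continuous v := forall t : nat -> R, t n @[n --> \oo] --> (0 : R)%R ->
  vanishing (fun n => \int[mu]_x ((v (x + t n) - v x) ^+ 2)%:E)%E.

Lemma L2continuous_approx v : measurable_fun setT v ->
  (forall e : R, (0 < e)%R -> exists v', [/\ measurable_fun setT v', L2continuous v' &
     (\int[mu]_x ((v x - v' x) ^+ 2)%:E <= e%:E)%E]) -> L2continuous v.
Proof.
move=> mv happ t t0 e e0.
(* Three errors of size [e / 9], multiplied by the constant 3 of [sqr3], add up to [e]. The two
   errors [v - v'] are equal because translation preserves the integral. *)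
have e9 : (0 < e / 9)%R by rewrite divr_gt0.
have [v' [mv' cv' vv']] := happ _ e9.
have [N hN] := cv' t t0 _ e9; exists N => n Nn.
pose F1 x := ((v x - v' x) ^+ 2)%R.
have mF1 : measurable_fun setT F1 by rewrite /F1; meas.
have F10 x : (0 <= F1 x)%R by exact: sqr_ge0.
apply: (@le_trans _ _ (\int[mu]_x (3 * (F1 (x + t n) + (v' (x + t n) - v' x) ^+ 2 + F1 x))%:E)%E).
  apply: le_intR => x; first exact: sqr_ge0.
  rewrite (_ : v (x + t n) - v x = (v (x + t n) - v' (x + t n)) + (v' (x + t n) - v' x) + (v' x - v x))%R; last by ring.
  apply: le_trans (sqr3 _ _ _) _.
  by rewrite /F1 (_ : (v' x - v x) ^+ 2 = (v x - v' x) ^+ 2)%R//; ring.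
have m1 : measurable_fun setT (fun x : R => F1 (x + t n)%R) by meas.
rewrite intRZ//; last 2 first.
- by meas.
- by move=> x; rewrite !addr_ge0// sqr_ge0.
rewrite intRD//; last 2 first.
- by meas.
- by move=> x; rewrite !addr_ge0// sqr_ge0.
rewrite intRD//; last 2 first.
- by meas.
- by move=> x; rewrite sqr_ge0.
rewrite (int_shift (t n) (f := fun x => (F1 x)%:E)); last 2 first.
- by meas.
- by move=> x; rewrite lee_fin.
apply: (@le_trans _ _ (3%:E * ((e / 9)%:E + (e / 9)%:E + (e / 9)%:E))%E).
  by rewrite lee_wpmul2l// !leeD// hN.
by rewrite -!EFinD -EFinM lee_fin; lra.
Qed.

(** A convergent sequence of shifts is bounded by some [B], so all integrands live on
    [[-(K + B), K + B]] and are at most [(2 M)^2]: dominated convergence applies. *)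
Lemma L2continuous_cont (K M : R) v : continuous v -> (forall x, `|v x| <= M)%R ->
  (forall x, (K < `|x|)%R -> v x = 0%R) -> L2continuous v.
Proof.
move=> cv vM vK t t0.
have mv : measurable_fun setT v by exact: continuous_measurable_fun.
have M0 : (0 <= M)%R by apply: le_trans (vM 0%R).
have [B [B0 hB]] : exists B : R, (0 < B)%R /\ forall n, (`|t n| <= B)%R.
  have [] := @cvg_seq_bounded _ _ t (cvgP _ t0) => B [_ hB].
  exists (`|B| + 1)%R; split; first by rewrite ltr_wpDl.
  by move=> n; apply: hB => //; rewrite (le_lt_trans (ler_norm B))// ltrDl.
pose g (x : R) : R := if (`|x| <= K + B)%R then ((2 * M) ^+ 2)%R else 0%R.
apply: (@dominated_vanishing _ _ _ mu _ (fun x => (g x)%:E)).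
- by move=> n; meas.
- by rewrite /g; meas.
- move=> n x; rewrite !lee_fin sqr_ge0/= /g; case: ifPn => [_|].
    rewrite -[leLHS]real_normK ?num_real// lerXn2r ?nnegrE ?mulr_ge0// (le_trans (ler_normB _ _))//.
    by rewrite mulrDl !mul1r lerD.
  rewrite -ltNge => xK.
  have x1 : (K < `|x|)%R by apply: le_lt_trans xK; rewrite lerDl ltW.
  have x2 : (K < `|x + t n|)%R.
    have := hB n; have : (`|x| <= `|x + t n| + `|t n|)%R by have := ler_normB (x + t n) (t n); rewrite addrK.
    lra.
  by rewrite (vK _ x1) (vK _ x2) subr0 expr0n.
- have -> : (\int[mu]_x (g x)%:E = \int[mu]_x (((2 * M) ^+ 2)%:E * (\1_(`[- (K + B), K + B]%classic%R : set R) x)%:E))%E.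
    apply: eq_integral => x _; rewrite /g indicE ler_norml; case: ifPn => h.
      by rewrite mem_set/= ?in_itv//= mule1.
    by rewrite memNset/= ?mule0// in_itv/=; exact/negP.
  rewrite ge0_integralZl_EFin//; last 2 first.
  - by apply/measurable_EFinP; exact: measurable_indic.
  - exact: sqr_ge0.
  have -> : (\int[mu]_x (\1_(`[- (K + B), K + B]%classic%R : set R) x)%:E = mu `[- (K + B), K + B]%classic%R)%E.
    by rewrite integral_indic ?setIT//; exact: measurable_itv.
  rewrite lebesgue_measure_itv/=; case: ifPn => _.
    by rewrite -EFinB -EFinM ltry.
  by rewrite mule0 ltry.
- move=> x _; apply: vanishingN; first by move=> n; exact: sqr_ge0.
  have -> : (0 = (v x - v x) ^+ 2 :> R)%R by rewrite subrr expr0n.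
  apply: (cvg_comp _ (fun y : R => y ^+ 2) _ (@exprn_continuous _ 2 _)).
  apply: cvgB; last exact: cvg_cst.
  exact: cvg_shift.
Qed.

(** Density of continuous functions is available in [L^1] of a bounded interval. Once the
    approximant [g N] is clipped and cut off, [v] and [w] are both bounded by [K], so
    [(v - w)^2 <= 2 K |v - w|] and smallness in [L^1] gives smallness in [L^2]. *)
Lemma L2continuous_L2_bounded (k : nat) v : measurable_fun setT v -> (forall x, `|v x| <= k%:R)%R ->
  (forall x, (k%:R < `|x|)%R -> v x = 0%R) -> L2continuous v.
Proof.
move=> mv vM vK; apply: L2continuous_approx => // e e0.
pose K : R := (k%:R + 1)%R; pose E := (`[- K, K]%classic%R : set R).
have K0 : (0 < K)%R by rewrite /K ltr_wpDl.
have mE : measurable E by exact: measurable_itv.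
have muE : (mu E < +oo)%E.
  by rewrite lebesgue_measure_itv/=; case: ifPn => // _; rewrite -EFinB ltry.
have iv : mu.-integrable E (EFin \o v).
  apply: measurable_bounded_integrable => //; first exact: measurable_funTS.
  by exists k%:R; split => // M kM x _; apply: le_trans (vM x) (ltW kM).
have [g [cg ig gv]] := approximation_continuous_integrable mE muE iv.
pose c : R := (2 * K)%R; have c0 : (0 < c)%R by rewrite /c mulr_gt0.
have ec : (0 < e / c)%R by rewrite divr_gt0.
have [N hN] := cvg0_vanishing gv ec.
(* A cutoff equal to 1 on [[-k, k]], where [v] may be nonzero, and to 0 outside [[-K, K]], where
   [K = k + 1]. *)
pose chi (x : R) : R := Num.max 0%R (Num.min 1%R (K - `|x|)).
pose w (x : R) : R := (chi x * Num.max (- K) (Num.min K (g N x)))%R.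
have chi01 x : (0 <= chi x <= 1)%R.
  by rewrite /chi le_max lexx/= ge_max ler01/= ge_min lexx.
have clipK y : (`|Num.max (- K) (Num.min K y)| <= K)%R.
  rewrite ler_norml le_max lexx/= ge_max ge_min lexx/= andbT; lra.
have cchi : continuous chi.
  move=> x; apply: (@continuous_max _ _ (fun=> 0) (fun x : R => Num.min 1 (K - `|x|)) x); first exact: cst_continuous.
  apply: (@continuous_min _ _ (fun=> 1) (fun x : R => K - `|x|) x); first exact: cst_continuous.
  by apply: continuousB; [exact: cst_continuous|exact: norm_continuous].
have cw : continuous w.
  move=> x; apply: continuousM; first exact: cchi.
  apply: (@continuous_max _ _ (fun=> - K) (fun x : R => Num.min K (g N x)) x); first exact: cst_continuous.
  by apply: (@continuous_min _ _ (fun=> K) (g N) x); [exact: cst_continuous|exact: cg].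
have mg : measurable_fun setT (g N) by exact: continuous_measurable_fun.
have mw : measurable_fun setT w by exact: continuous_measurable_fun.
have wout x : (K < `|x|)%R -> w x = 0%R.
  move=> xK; rewrite /w /chi (_ : Num.max _ _ = 0)%R ?mul0r//.
  by apply/max_idPl; rewrite ge_min; apply/orP; right; lra.
have wM x : (`|w x| <= K)%R.
  have /andP[h1 h2] := chi01 x.
  rewrite normrM -[leRHS]mul1r ler_pM//; first by rewrite ger0_norm.
exists w; split => //; first exact: (L2continuous_cont cw wM wout).
pose h x : R := if (`|x| <= K)%R then `|v x - g N x|%R else 0%R.
have mh : measurable_fun setT h by rewrite /h; meas.
apply: (@le_trans _ _ (\int[mu]_x (c * h x)%:E)%E).
  apply: le_intR => x; first exact: sqr_ge0.
  rewrite /h; case: ifPn => [xK|]; last first.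
    rewrite -ltNge => xK; rewrite wout// vK ?subrr ?expr0n ?mulr0//.
    by apply: le_lt_trans xK; rewrite /K lerDl.
  rewrite -real_normK ?num_real// expr2; apply: ler_pM => //.
    rewrite (le_trans (ler_normB _ _))// /c mulrDl mul1r lerD//.
    by apply: le_trans (vM x) _; rewrite /K lerDl.
  have [xk|xk] := leP `|x|%R k%:R.
    rewrite /w (_ : chi x = 1%R) ?mul1r; last first.
      by rewrite /chi; apply/eqP; rewrite eq_le ge_max ler01 ge_min lexx/= le_max le_min lexx/= /K; apply/orP; right; lra.
    have := vM x; rewrite ler_norml => /andP[v1 v2].
    have v3 : (- K <= v x <= K)%R by rewrite /K; apply/andP; split; lra.
    exact: clip_dist.
  rewrite vK// !sub0r !normrN /w normrM; have /andP[h1 h2] := chi01 x.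
  rewrite ger0_norm//; apply: (@le_trans _ _ `|Num.max (- K) (Num.min K (g N x))|%R); first by rewrite ler_piMl.
  have /(clip_dist (g N x)) : - K <= 0 <= K by apply/andP; split; lra.
  by rewrite !sub0r !normrN.
rewrite intRZ//; last 2 first.
- exact: ltW.
- by move=> x; rewrite /h; case: ifP.
have -> : (\int[mu]_x (h x)%:E = \int[mu]_(z in E) `|(v z - g N z)%:E|)%E.
  rewrite [RHS]integral_mkcond; apply: eq_integral => x _.
  rewrite /h patchE; case: ifPn => xK.
    by rewrite mem_set// /E/= in_itv/= -ler_norml.
  by rewrite memNset// /E/= in_itv/= -ler_norml; exact/negP.
apply: (@le_trans _ _ (c%:E * (e / c)%:E)%E); first by rewrite lee_wpmul2l ?lee_fin ?hN// ltW.
by rewrite -EFinM mulrCA divff ?mulr1 ?gt_eqF.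
Qed.

(** Truncating both the argument and the value at [k] gives functions covered by
    [L2continuous_L2_bounded], which converge to [v] by dominated convergence. *)
Lemma L2continuous_L2 v : measurable_fun setT v -> (\int[mu]_x ((v x) ^+ 2)%:E < +oo)%E -> L2continuous v.
Proof.
move=> mv iv; apply: L2continuous_approx => // e e0.
pose v_ (k : nat) (x : R) : R := if (`|x| <= k%:R)%R && (`|v x| <= k%:R)%R then v x else 0%R.
have mv_ k : measurable_fun setT (v_ k) by rewrite /v_; meas.
have : vanishing (fun k => \int[mu]_x ((v x - v_ k x) ^+ 2)%:E)%E.
  apply: (@dominated_vanishing _ _ _ mu _ (fun x => (v x ^+ 2)%:E)) => //.
  - by move=> k; have mk := mv_ k; meas.
  - by meas.
  - move=> k x; rewrite !lee_fin sqr_ge0/= /v_; case: ifPn => _; last by rewrite subr0.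
    by rewrite subrr expr0n sqr_ge0.
  move=> x _ d d0.
  exists (Num.truncn (Num.max `|x| `|v x|)).+1 => k kx.
  have hk : (Num.max `|x| `|v x| <= k%:R)%R.
    by apply: le_trans (ltW (truncnS_gt _)) _; rewrite ler_nat.
  move: hk; rewrite ge_max => hk.
  by rewrite /v_ hk subrr expr0n/= lee_fin ltW.
move=> /(_ e e0)[N hN]; exists (v_ N); split => //; last exact: hN.
apply: (@L2continuous_L2_bounded N) => // x.
  by rewrite /v_; case: ifPn => [/andP[]//|]; rewrite normr0.
by rewrite /v_ ltNge => /negbTE ->.
Qed.

End translation1.

(** * Translations in [L^2] of the plane *)

Section translation2.
Context {R : realType}.
Local Notation mu := (@lebesgue_measure R).
Local Notation leb2 := (@leb2 R).
Implicit Types f g h a : R * R -> R.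

Definition sqn f : \bar R := (\int[leb2]_x ((f x) ^+ 2)%:E)%E.

Definition tr (c : R * R) f : R * R -> R := fun x => f (x.1 + c.1, x.2 + c.2).

Lemma measurable_tr c f : measurable_fun setT f -> measurable_fun setT (tr c f).
Proof. by move=> mf; rewrite /tr; meas. Qed.

Lemma sqn_ge0 f : (0 <= sqn f)%E.
Proof. by apply: intR_ge0 => x; exact: sqr_ge0. Qed.

Lemma sqn_tr c f : measurable_fun setT f -> sqn (tr c f) = sqn f.
Proof.
move=> mf; rewrite /sqn /tr (int_shift2 c (f := fun x => ((f x) ^+ 2)%:E))//.
  by meas.
by move=> x; rewrite lee_fin sqr_ge0.
Qed.

Lemma sqn_le2 f g h : measurable_fun setT f -> measurable_fun setT g ->
  (forall x, (h x) ^+ 2 <= 2 * ((f x) ^+ 2 + (g x) ^+ 2)) ->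
  (sqn h <= 2%:E * (sqn f + sqn g))%E.
Proof.
move=> mf mg hfg; rewrite /sqn.
apply: (@le_trans _ _ (\int[leb2]_x (2 * ((f x) ^+ 2 + (g x) ^+ 2))%:E)%E).
  by apply: le_intR => // x; exact: sqr_ge0.
rewrite intRZ//; first last.
- by move=> x; rewrite addr_ge0 ?sqr_ge0.
- by meas.
rewrite intRD//; [by meas|by meas|by move=> x; exact: sqr_ge0|by move=> x; exact: sqr_ge0].
Qed.

Lemma sqnB_le f g : measurable_fun setT f -> measurable_fun setT g ->
  (sqn (fun x => (f x - g x)%R) <= 2%:E * (sqn f + sqn g))%E.
Proof.
move=> mf mg; apply: sqn_le2 => // x /=.
by apply: le_trans (sqr2 _ _) _; rewrite sqrrN.
Qed.

(** By Tonelli almost every slice [a (., y)] is in [L^2] of the line, where translation is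
    continuous; the outer integral is handled by domination. The difference enters through an
    equation for [F], so that both coordinate directions can be fed in. *)
Lemma vanishing_slices (u : nat -> R) (a : R * R -> R) (F : nat -> R * R -> R) :
  (forall n, measurable_fun setT (F n)) -> measurable_fun setT a ->
  (forall n y x, F n (x, y) = a (x + u n, y) - a (x, y)) ->
  (sqn a < +oo)%E -> u n @[n --> \oo] --> (0 : R) ->
  vanishing (fun n => sqn (F n)).
Proof.
move=> mF ma hF ia u0.
rewrite (_ : (fun n => sqn (F n)) = (fun n => \int[mu]_y \int[mu]_x ((F n (x, y)) ^+ 2)%:E)%E); last first.
  apply/funext => n; rewrite /sqn tonelli2G//.
    by have mFn := mF n; meas.
  by move=> x; rewrite lee_fin sqr_ge0.
pose g (y : R) : \bar R := (4%:E * \int[mu]_x ((a (x, y)) ^+ 2)%:E)%E.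
have m1 (b' : R * R -> R) : measurable_fun setT b' ->
    measurable_fun setT (fun y : R => \int[mu]_x ((b' (x, y)) ^+ 2)%:E)%E.
  move=> mb; apply: (measurable_int_mu (f := fun p : R * R => ((b' (p.2, p.1)) ^+ 2)%:E)).
  by meas.
have ms (y : R) : measurable_fun setT (fun x : R => a (x, y)) by meas.
apply: (@dominated_vanishing _ _ _ mu _ g).
- by move=> n; exact: m1.
- by apply: emeasurable_funM; [exact: measurable_cst|exact: m1].
- move=> n y; apply/andP; split; first by apply: intR_ge0 => x; exact: sqr_ge0.
  apply: (@le_trans _ _ (\int[mu]_x (2 * ((a (x + u n, y)) ^+ 2 + (a (x, y)) ^+ 2))%:E)%E).
    apply: le_intR => x; first exact: sqr_ge0.
    by rewrite hF; apply: le_trans (sqr2 _ _) _; rewrite sqrrN.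
  have my := ms y.
  rewrite intRZ//; first last.
  + by move=> x; rewrite addr_ge0 ?sqr_ge0.
  + by apply: mfD; apply: mfX => //; apply: (mf_comp my); meas.
  rewrite intRD//; first last.
  + by move=> x; exact: sqr_ge0.
  + by move=> x; exact: sqr_ge0.
  + by apply: mfX.
  + by apply: mfX; apply: (mf_comp my); meas.
  rewrite (int_shift (u n) (f := fun x => ((a (x, y)) ^+ 2)%:E)); last 2 first.
  + by apply: mfE; apply: mfX.
  + by move=> x; rewrite lee_fin sqr_ge0.
  rewrite /g; set I := (\int[mu]_x _)%E.
  have I0 : (0 <= I)%E by apply: intR_ge0 => x; exact: sqr_ge0.
  rewrite -[X in (X + _)%E]mul1e -[X in (_ + X)%E]mul1e -ge0_muleDl// muleA.
  by rewrite -EFinD -EFinM le_eqVlt (_ : 2 * (1 + 1) = 4 :> R) ?eqxx//; ring.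
- rewrite /g ge0_integralZl_EFin//; last 2 first.
  + by move=> y _; apply: intR_ge0 => x; exact: sqr_ge0.
  + exact: m1.
  rewrite -(tonelli2G (f := fun p => ((a p) ^+ 2)%:E)); last 2 first.
  + by meas.
  + by move=> x; rewrite lee_fin sqr_ge0.
  by rewrite lte_mul_pinfty.
move=> y gy; have : (\int[mu]_x ((a (x, y)) ^+ 2)%:E < +oo)%E.
  rewrite ltNge leye_eq; apply/negP => /eqP h.
  by move: gy; rewrite /g h gt0_muley.
move=> /(L2continuous_L2 (ms y))/(_ u u0); apply: vanishing_le => n.
by apply: le_intR => x; [exact: sqr_ge0|rewrite hF].
Qed.

Lemma sqn_swap f : measurable_fun setT f -> sqn (fun x => f (x.2, x.1)) = sqn f.
Proof.
move=> mf; rewrite /sqn tonelli2F//; last 2 first.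
- by meas.
- by move=> x; rewrite lee_fin sqr_ge0.
rewrite [RHS]tonelli2G//; [by meas|by move=> x; rewrite lee_fin sqr_ge0].
Qed.

(** The shift is split into its two coordinates. The first difference appears translated in the
    second coordinate, which leaves its norm unchanged. *)
Lemma tr_continuous (c : nat -> R * R) a : measurable_fun setT a -> (sqn a < +oo)%E ->
  (c n).1 @[n --> \oo] --> (0 : R) -> (c n).2 @[n --> \oo] --> (0 : R) ->
  vanishing (fun n => sqn (fun x => tr (c n) a x - a x)).
Proof.
move=> ma ia c1 c2.
have h1 : vanishing (fun n => sqn (fun x => tr ((c n).1, 0) a x - a x)).
  apply: (@vanishing_slices (fun n => (c n).1) a) => //.
    by move=> n; rewrite /tr; meas.
  by move=> n y x; rewrite /tr/= addr0.
have h2 : vanishing (fun n => sqn (fun x => tr (0, (c n).2) a x - a x)).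
  have : vanishing (fun n => sqn (fun x => tr (0, (c n).2) a (x.2, x.1) - a (x.2, x.1))).
    apply: (@vanishing_slices (fun n => (c n).2) (fun x => a (x.2, x.1))) => //.
    - by move=> n; rewrite /tr; meas.
    - by meas.
    - by move=> n y x; rewrite /tr/= addr0.
    - by rewrite sqn_swap.
  apply: vanishing_le => n; rewrite -[leLHS]sqn_swap// /tr; by meas.
have := vanishingZ (@ler0n R 2) (vanishingD h1 h2); apply: vanishing_le => n.
set F1 := (fun x => tr ((c n).1, 0) a x - a x).
have mF1 : measurable_fun setT F1 by rewrite /F1 /tr; meas.
rewrite -(sqn_tr (0, (c n).2) mF1); apply: sqn_le2.
- exact: measurable_tr.
- by rewrite /tr; meas.
move=> x; rewrite /F1 /tr/= !addr0.
rewrite (_ : a (x.1 + (c n).1, x.2 + (c n).2) - a x = (a (x.1 + (c n).1, x.2 + (c n).2) - a (x.1, x.2 + (c n).2)) + (a (x.1, x.2 + (c n).2) - a x)); last by ring.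
exact: sqr2.
Qed.

End translation2.

(** * Plancherel's theorem *)

Section halfline.
Context {R : realType}.
Local Notation mu := (@lebesgue_measure R).

Lemma derivable1_continuous (f : R -> R) : (forall x, derivable f x 1) -> continuous f.
Proof. by move=> df x; apply/differentiable_continuous/derivable1_diffP. Qed.

(** The exponential bound makes [F] vanish at infinity, so the fundamental theorem of calculus on
    the half-line leaves only the value at 0. *)
Lemma int_halfline (f F : R -> R) (C eps : R) : 0 < eps -> (forall x, 0 <= f x) ->
  (forall x : R, is_derive x 1 F (f x)) -> continuous f ->
  (forall x, `|F x| <= C * expR (- eps * x)) ->
  (\int[mu]_(x in `[0%R, +oo[) (f x)%:E = (- F 0)%:E)%E.
Proof.
move=> e0 f0 dF cf FC.
have C0 : 0 <= C by have := FC 0; rewrite mulr0 expR0 mulr1; apply: le_trans.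
have dF' x : derivable F x 1 by exact: ex_derive.
have cF : continuous F by exact: derivable1_continuous.
rewrite (@ge0_continuous_FTC2y R f F 0 0) ?sub0e//.
- exact: continuous_subspaceT.
- apply/cvgrPdist_le => d d0; near=> x.
  have x0 : 0 < x by near: x; apply: nbhs_pinfty_gt; rewrite num_real.
  (* From [exp y >= y] the bound becomes [C / (eps x)], which is at most [d] past this threshold. *)
  have x1 : C / (eps * d) < x by near: x; apply: nbhs_pinfty_gt; rewrite num_real.
  rewrite sub0r normrN; apply: le_trans (FC x) _.
  have ex : eps * x <= expR (eps * x) by apply: le_trans (expR_ge1Dx _); rewrite lerDr.
  rewrite mulNr expRN ler_pdivrMr ?expR_gt0//.
  apply: (@le_trans _ _ (d * (eps * x))); last by rewrite ler_wpM2l// ltW.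
  by move: x1; rewrite ltr_pdivrMr ?mulr_gt0// => /ltW; rewrite mulrC [d * _]mulrC mulrAC.
- by apply: cvg_at_right_filter; exact: cF.
- by move=> x _; rewrite derive1E derive_val.
Unshelve. all: by end_near. Qed.

Lemma int_split0 (f : R -> \bar R) : measurable_fun setT f -> (forall x, 0 <= f x)%E ->
  (\int[mu]_x f x = \int[mu]_(x in `[0%R, +oo[) f x + \int[mu]_(x in `[0%R, +oo[) f (- x)%R)%E.
Proof.
move=> mf f0.
rewrite (ge0_integration_by_substitution0 (f := fun x => f (- x)%R))//; last first.
  by apply: (mf_comp mf); meas.
rewrite -[X in (X + _)%E]integral_itv_obnd_cbnd; last by exact: measurable_funTS.
under [X in (_ + X)%E]eq_integral do rewrite opprK.
rewrite -ge0_integral_setU//=.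
- congr (integral _ _ _); apply/seteqP; split => x //= _; rewrite !in_itv/= andbT.
  by case: (ltP 0 x) => _; [left|right].
- exact: measurable_funTS.
- apply/disj_setPS => x [] /=; rewrite !in_itv/= andbT => h1 h2; move: (lt_le_trans h1 h2); by rewrite ltxx.
Qed.

(** The summand 1 makes the integrand nonnegative, as [int_halfline] requires. The phase [al] will
    carry the other coordinate in the planar integral of [int_wt_cos]. *)
Lemma int_weight_halfline (eps al t : R) : 0 < eps ->
  (\int[mu]_(k in `[0%R, +oo[) (expR (- eps * k) * (1 + cos (al + k * t)))%:E =
   (eps^-1 + (eps * cos al - t * sin al) / (eps ^+ 2 + t ^+ 2))%:E)%E.
Proof.
move=> e0; set q := eps ^+ 2 + t ^+ 2.
have q0 : 0 < q by rewrite ltr_pwDl ?exprn_gt0 ?sqr_ge0.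
pose F (k : R) := expR (- eps * k) * ((t * sin (al + k * t) - eps * cos (al + k * t)) * q^-1 - eps^-1).
have -> : eps^-1 + (eps * cos al - t * sin al) / q = - F 0.
  by rewrite /F mulr0 expR0 mul1r mul0r addr0; ring.
pose f (x : R) := expR (- eps * x) * (1 + cos (al + x * t)).
have cf : continuous f.
  apply: derivable1_continuous => x.
  have df : is_derive (x : R) 1 f (expR (- eps * x) * (- eps * (1 + cos (al + x * t)) - t * sin (al + x * t))).
    by rewrite /f; apply: is_derive_eq; rewrite -![_ *: _]/(_ * _); ring.
  exact: ex_derive.
apply: (@int_halfline f F ((`|t| + eps) * q^-1 + eps^-1) eps) => //.
- by move=> x; rewrite /f mulr_ge0 ?expR_ge0//; have := cos_geN1 (al + x * t); lra.
- move=> x; rewrite /F; apply: is_derive_eq.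
  rewrite -![_ *: _]/(_ * _) /f /q; field.
  by rewrite (gt_eqF e0) /= -/q gt_eqF.
- move=> x; rewrite /F normrM ger0_norm ?expR_ge0// mulrC ler_wpM2r ?expR_ge0//.
  rewrite (le_trans (ler_normB _ _))// lerD//; last by rewrite ger0_norm// invr_ge0 ltW.
  have qi : 0 <= q^-1 by rewrite invr_ge0 ltW.
  rewrite normrM (ger0_norm qi) ler_wpM2r//.
  rewrite (le_trans (ler_normB _ _))// !normrM (gtr0_norm e0) lerD//.
    by rewrite ler_piMr// ler_norml sin_geN1 sin_le1.
  by rewrite ler_piMr ?ler_norml ?cos_geN1 ?cos_le1// ltW.
Qed.

(** The Poisson kernel, normalised to total mass [2 pi]: it is the integral of
    [exp (- eps |k|) cos (k t)] over the line. *)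
Definition pk (eps t : R) : R := 2 * eps / (eps ^+ 2 + t ^+ 2).

Lemma pk_ge0 (eps t : R) : 0 < eps -> 0 <= pk eps t.
Proof. by move=> e0; rewrite /pk divr_ge0 ?mulr_ge0 ?addr_ge0 ?sqr_ge0// ltW. Qed.

Lemma pkN (eps t : R) : pk eps (- t) = pk eps t.
Proof. by rewrite /pk sqrrN. Qed.

Lemma continuous_pk (eps : R) : 0 < eps -> continuous (pk eps).
Proof.
move=> e0 x; have -> : pk eps = (fun t : R => 2 * eps / (eps ^+ 2 + t ^+ 2)) by [].
apply: cvgM; first exact: cvg_cst.
apply: cvgV; first by rewrite gt_eqF// ltr_pwDl ?exprn_gt0 ?sqr_ge0.
apply: cvgD; first exact: cvg_cst.
exact: exprn_continuous.
Qed.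

Lemma measurable_pk (eps : R) : 0 < eps -> measurable_fun setT (pk eps).
Proof. by move=> e0; apply: continuous_measurable_fun; exact: continuous_pk. Qed.

(** The terms in [sin al] from the two half-lines cancel. *)
Lemma int_weight1D (eps al t : R) : 0 < eps ->
  (\int[mu]_k (expR (- eps * `|k|) * (1 + cos (al + k * t)))%:E =
   (2 / eps + cos al * pk eps t)%:E)%E.
Proof.
move=> e0; rewrite int_split0; last 2 first.
- by meas.
- move=> x; rewrite lee_fin mulr_ge0 ?expR_ge0//; have := cos_geN1 (al + x * t); lra.
have -> : (\int[mu]_(x in `[0%R, +oo[) (expR (- eps * `|x|) * (1 + cos (al + x * t)))%:E =
   (eps^-1 + (eps * cos al - t * sin al) / (eps ^+ 2 + t ^+ 2))%:E)%E.
  rewrite -int_weight_halfline//; apply: eq_integral => x; rewrite inE/= in_itv/= andbT => x0.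
  by rewrite ger0_norm.
have -> : (\int[mu]_(x in `[0%R, +oo[) (expR (- eps * `|(- x)%R|) * (1 + cos (al + (- x) * t)))%:E =
   (eps^-1 + (eps * cos al - (- t) * sin al) / (eps ^+ 2 + (- t) ^+ 2))%:E)%E.
  rewrite -int_weight_halfline//; apply: eq_integral => x; rewrite inE/= in_itv/= andbT => x0.
  by rewrite normrN ger0_norm// [in cos _]mulNr [in X in _ = X]mulrN.
rewrite -EFinD /pk sqrrN; congr (_%:E); field.
by rewrite (gt_eqF e0)/= gt_eqF// ltr_pwDl ?exprn_gt0 ?sqr_ge0.
Qed.

(** The case [al = t = 0] of [int_weight1D] computes twice this integral. *)
Lemma int_weight1D1 (eps : R) : 0 < eps ->
  (\int[mu]_k (expR (- eps * `|k|))%:E = (2 / eps)%:E)%E.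
Proof.
move=> e0; have := int_weight1D 0 0 e0.
under eq_integral do rewrite mulr0 addr0 cos0 mulrC.
rewrite intRZ//; last by meas.
set I := (\int[mu]_k _)%E.
have I0 : (0 <= I)%E by apply: intR_ge0 => x; exact: expR_ge0.
have -> : 2 / eps + cos 0 * pk eps 0 = (1 + 1) * (2 / eps).
  by rewrite cos0 /pk expr0n/= addr0; field; rewrite gt_eqF.
case: I I0 => [r| |] //= _; last by rewrite gt0_muley// lte_fin; lra.
by rewrite -EFinM => -[] h; congr (_%:E); lra.
Qed.

(** An antiderivative is [2 atan (t / eps)], and the kernel is even. *)
Lemma int_pk (eps : R) : 0 < eps -> (\int[mu]_t (pk eps t)%:E = (2 * pi)%:E)%E.
Proof.
move=> e0; rewrite int_split0; last 2 first.
- by apply: mfE; exact: measurable_pk.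
- by move=> t; rewrite lee_fin pk_ge0.
under [X in (_ + X)%E]eq_integral do rewrite pkN.
have -> : (\int[mu]_(x in `[0%R, +oo[) (pk eps x)%:E = pi%:E)%E.
  pose F (x : R) := 2 * atan (x * eps^-1).
  have dF (x : R) : is_derive x 1 F (pk eps x).
    rewrite /F; apply: is_derive_eq; rewrite -![_ *: _]/(_ * _) /pk; field.
    by rewrite (gt_eqF e0)/= !gt_eqF// ltr_pwDl ?exprn_gt0 ?sqr_ge0.
  have dF' x : derivable F x 1 by exact: ex_derive.
  have cF : continuous F by exact: derivable1_continuous.
  rewrite (@ge0_continuous_FTC2y R (pk eps) F 0 pi)//.
  - by rewrite /F mul0r atan0 mulr0 sube0.
  - by move=> x _; exact: pk_ge0.
  - exact/continuous_subspaceT/continuous_pk.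
  - rewrite /F (_ : pi = 2 * (pi / 2)); last by field.
    apply: cvgM; first exact: cvg_cst.
    apply: (cvg_comp _ _ _ (@cvgy_atan R)).
    apply/cvgryPge => A; exists (A * eps); split; first by rewrite num_real.
    by move=> x Ax; rewrite ler_pdivlMr// ltW.
  - by apply: cvg_at_right_filter; exact: cF.
  - by move=> x _; rewrite derive1E derive_val.
by rewrite -EFinD; congr (_%:E); ring.
Qed.

(** Since [1 <= t^2 / d^2], one has [1 + t^2 <= (1 + d^-2) (eps^2 + t^2)]. Away from the origin the
    kernel is thus [eps] times a fixed integrable function, so its mass there tends to 0. *)
Lemma pk_tail (eps d t : R) : 0 < eps -> 0 < d -> d <= `|t| ->
  pk eps t <= eps * (1 + d ^- 2) * pk 1 t.
Proof.
move=> e0 d0 dt.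
have t2 : d ^+ 2 <= t ^+ 2 by rewrite -[leRHS]real_normK ?num_real// lerXn2r ?nnegrE// ltW.
have d2 : 0 < d ^+ 2 by rewrite exprn_gt0.
have t0 : 0 < t ^+ 2 by exact: lt_le_trans t2.
have e2 : 0 < eps ^+ 2 by rewrite exprn_gt0.
rewrite /pk expr1n mulr1 (_ : eps * _ * _ = (2 * eps * (1 + d ^- 2)) / (1 + t ^+ 2)); last by ring.
rewrite ler_pdivrMr ?addr_gt0// mulrAC ler_pdivlMr ?addr_gt0// -!mulrA ler_pM2l// ler_pM2l//.
have h : 1 <= t ^+ 2 * d ^- 2 by rewrite ler_pdivlMr// mul1r.
have : 0 <= eps ^+ 2 * d ^- 2 by rewrite mulr_ge0 ?invr_ge0 ?ltW.
nra.
Qed.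

End halfline.

(* Plancherel for [a] in [L^1] and [L^2]: weighting the transform with
   [exp (- eps (|k.1| + |k.2|))], whose own transform is the product of Poisson
   kernels [pk2], gives [2 \int wt |a^|^2 + defect = 2 (2 pi)^2 \int a^2], where
   [defect] is an average of [sqn (tr z a - a)] concentrating at [z = 0]. *)
Section plancherel_real.
Context {R : realType}.
Local Notation mu := (@lebesgue_measure R).
Local Notation leb2 := (@leb2 R).
Local Notation leb4 := (@leb4 R).
Implicit Types a b : R * R -> R.

Definition pdot (k x : R * R) : R := k.1 * x.1 + k.2 * x.2.
(** For real [a] the Fourier integral is [(2 pi)^-1 (cosT a - i sinT a)]; the unnormalised real
    transforms keep the computation in real integrals. *)
Definition cosT a (k : R * R) : R := Rintegral leb2 setT (fun x => cos (pdot k x) * a x).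
Definition sinT a (k : R * R) : R := Rintegral leb2 setT (fun x => sin (pdot k x) * a x).

Definition L1 a : Prop := measurable_fun setT a /\ (\int[leb2]_x (`|a x|)%:E < +oo)%E.

Lemma L1_integrable a : L1 a -> leb2.-integrable setT (EFin \o a).
Proof. by move=> [ma ia]; apply/integrableP; split; [exact/measurable_EFinP|exact: ia]. Qed.

Lemma L1_bounded a (g : R * R -> R) : measurable_fun setT g -> (forall x, `|g x| <= 1) -> L1 a ->
  L1 (fun x => g x * a x).
Proof.
move=> mg g1 [ma ia]; split; first by meas.
apply: le_lt_trans ia; apply: le_intR => x //.
by rewrite normrM ler_piMl.
Qed.

Lemma measurable_Rint2 (f : (R * R) * (R * R) -> R) : measurable_fun setT f ->
  measurable_fun setT (fun k => Rintegral leb2 setT (fun x => f (k, x))).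
Proof.
move=> mf; apply: (measurableT_comp (fine_measurable _)) => //.
by apply: (measurable_int_leb2 (f := fun p => (f p)%:E)); meas.
Qed.

Lemma measurable_cosT a : measurable_fun setT a -> measurable_fun setT (cosT a).
Proof.
move=> ma; apply: (measurable_Rint2 (f := fun p => cos (pdot p.1 p.2) * a p.2)).
by rewrite /pdot; meas.
Qed.

Lemma measurable_sinT a : measurable_fun setT a -> measurable_fun setT (sinT a).
Proof.
move=> ma; apply: (measurable_Rint2 (f := fun p => sin (pdot p.1 p.2) * a p.2)).
by rewrite /pdot; meas.
Qed.

Lemma norm_cos1 (x : R) : `|cos x| <= 1.
Proof. by rewrite ler_norml cos_geN1 cos_le1. Qed.
Lemma norm_sin1 (x : R) : `|sin x| <= 1.
Proof. by rewrite ler_norml sin_geN1 sin_le1. Qed.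

Lemma L1_cos a k : L1 a -> L1 (fun x => cos (pdot k x) * a x).
Proof. by apply: L1_bounded => [|x]; [rewrite /pdot; meas|exact: norm_cos1]. Qed.
Lemma L1_sin a k : L1 a -> L1 (fun x => sin (pdot k x) * a x).
Proof. by apply: L1_bounded => [|x]; [rewrite /pdot; meas|exact: norm_sin1]. Qed.

Lemma Rint_EFin a : L1 a -> (\int[leb2]_x (a x)%:E = (Rintegral leb2 setT a)%:E)%E.
Proof. by move=> /L1_integrable ia; rewrite fineK//; exact: integrable_fin_num. Qed.

(** The addition formula for [cos (A - B)] separates the variables; the double integral is the
    squared modulus of the transform. *)
Lemma int_double_cos a k : L1 a ->
  (\int[leb2]_x \int[leb2]_y (a x * a y * cos (pdot k x - pdot k y))%:E =
   ((cosT a k) ^+ 2 + (sinT a k) ^+ 2)%:E)%E.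
Proof.
move=> La; have LC := L1_cos k La; have LS := L1_sin k La.
pose C := cosT a k; pose S := sinT a k.
transitivity (\int[leb2]_x (C * (cos (pdot k x) * a x) + S * (sin (pdot k x) * a x))%:E)%E.
  apply: eq_integral => x _.
  transitivity (\int[leb2]_y ((a x * cos (pdot k x))%:E * (cos (pdot k y) * a y)%:E + (a x * sin (pdot k x))%:E * (sin (pdot k y) * a y)%:E))%E.
    apply: eq_integral => y _; rewrite -!EFinM -EFinD cosB; congr (_%:E); ring.
  rewrite integralD//; last 2 first.
  - by apply: integrableZl => //; exact: L1_integrable.
  - by apply: integrableZl => //; exact: L1_integrable.
  rewrite integralZl//; last exact: L1_integrable.
  rewrite integralZl//; last exact: L1_integrable.
  rewrite (Rint_EFin LC) (Rint_EFin LS) -!EFinM -EFinD -/(cosT a k) -/(sinT a k) -/C -/S.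
  by congr (_%:E); ring.
under eq_integral do rewrite EFinD EFinM [X in (_ + X)%E]EFinM.
rewrite integralD//; last 2 first.
- by apply: integrableZl => //; exact: L1_integrable.
- by apply: integrableZl => //; exact: L1_integrable.
rewrite integralZl//; last exact: L1_integrable.
rewrite integralZl//; last exact: L1_integrable.
by rewrite (Rint_EFin LC) (Rint_EFin LS) -!EFinM -EFinD.
Qed.

Definition wt (eps : R) (k : R * R) : R := expR (- eps * `|k.1|) * expR (- eps * `|k.2|).
Definition pk2 (eps : R) (z : R * R) : R := pk eps z.1 * pk eps z.2.

Lemma measurable_wt eps : measurable_fun setT (wt eps).
Proof. by rewrite /wt; meas. Qed.

Lemma wt_ge0 eps k : 0 <= wt eps k.
Proof. by rewrite mulr_ge0 ?expR_ge0. Qed.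

Lemma int_wt (eps : R) : 0 < eps -> (\int[leb2]_k (wt eps k)%:E = ((2 / eps) ^+ 2)%:E)%E.
Proof.
move=> e0; rewrite tonelli2F; last 2 first.
- by apply: mfE; exact: measurable_wt.
- by move=> k; rewrite lee_fin wt_ge0.
rewrite /wt/=; under eq_integral => x _.
  rewrite intRZ ?expR_ge0//; last by meas.
  rewrite int_weight1D1// muleC -EFinM.
  over.
rewrite intRZ ?divr_ge0 ?ltW//; last by meas.
by rewrite int_weight1D1// -EFinM expr2.
Qed.

Lemma weight1_integrable (eps : R) : 0 < eps -> mu.-integrable setT (fun k => (expR (- eps * `|k|))%:E).
Proof.
move=> e0; apply/integrableP; split; first by meas.
under eq_integral do rewrite gee0_abs ?lee_fin ?expR_ge0//.
by rewrite int_weight1D1// ltry.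
Qed.

(** Subtracting [int_weight1D1] removes the summand that was added for positivity. *)
Lemma int_weight1_cos (eps al t : R) : 0 < eps ->
  (\int[mu]_k (expR (- eps * `|k|) * cos (al + k * t))%:E = (cos al * pk eps t)%:E)%E.
Proof.
move=> e0.
transitivity (\int[mu]_k ((expR (- eps * `|k|) * (1 + cos (al + k * t)))%:E - (expR (- eps * `|k|))%:E))%E.
  apply: eq_integral => k _; rewrite -EFinB; congr (_%:E); ring.
rewrite integralB//; last 2 first.
- apply/integrableP; split; first by meas.
  under eq_integral.
    move=> k _; rewrite gee0_abs; last first.
      by rewrite lee_fin mulr_ge0 ?expR_ge0//; have := cos_geN1 (al + k * t); lra.
    over.
  by rewrite int_weight1D// ltry.
- exact: weight1_integrable.
by rewrite int_weight1D// int_weight1D1// -EFinB; congr (_%:E); ring.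
Qed.

Definition psub (x y : R * R) : R * R := (x.1 - y.1, x.2 - y.2).

Lemma pdotB k x y : pdot k (psub x y) = pdot k x - pdot k y.
Proof. by rewrite /pdot /psub/=; ring. Qed.

(** By Fubini, the inner integral sees the other coordinate as a phase, and returns its cosine times
    a one-dimensional kernel. *)
Lemma int_wt_cos (eps : R) t : 0 < eps ->
  (\int[leb2]_k (wt eps k * cos (pdot k t))%:E = (pk2 eps t)%:E)%E.
Proof.
move=> e0.
have it : leb2.-integrable setT (fun k => (wt eps k * cos (pdot k t))%:E).
  apply: (@le_integrable _ _ _ leb2 setT measurableT _ (fun k => (wt eps k)%:E)).
  - by have := @measurable_wt eps; rewrite /pdot => mw; meas.
  - move=> k _; rewrite lee_fin normrM ler_piMr// norm_cos1//.
  - apply/integrableP; split; first by apply: mfE; exact: measurable_wt.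
    under eq_integral do rewrite gee0_abs ?lee_fin ?wt_ge0//.
    by rewrite int_wt// ltry.
rewrite -(@integral12_prod_meas1 _ _ _ _ R mu mu _ it) /fubini_F.
transitivity (\int[mu]_x ((pk eps t.2)%:E * (expR (- eps * `|x|) * cos (0 + x * t.1))%:E))%E.
  apply: eq_integral => x _; rewrite /wt /pdot/=.
  under eq_integral do rewrite -mulrA EFinM.
  rewrite integralZl//; last first.
    apply: (@le_integrable _ _ _ mu setT measurableT _ (fun k => (expR (- eps * `|k|))%:E)).
    - by meas.
    - by move=> k _; rewrite lee_fin normrM ler_piMr// norm_cos1.
    - exact: weight1_integrable.
  by rewrite int_weight1_cos// -!EFinM add0r; congr (_%:E); ring.
rewrite integralZl//; last first.
  apply: (@le_integrable _ _ _ mu setT measurableT _ (fun k => (expR (- eps * `|k|))%:E)).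
  - by meas.
  - by move=> k _; rewrite lee_fin normrM ler_piMr// norm_cos1.
  - exact: weight1_integrable.
by rewrite int_weight1_cos// cos0 mul1r -EFinM mulrC.
Qed.

Lemma aa_integrable a : L1 a -> leb4.-integrable setT (fun p => (a p.1 * a p.2)%:E).
Proof.
move=> La; have [ma ia] := La; apply/integrableP; split; first by meas.
rewrite tonelli4F//; last by apply: measurableT_comp => //; meas.
under eq_integral => x _.
  rewrite (_ : \int[leb2]_y _ = (`|a x|)%:E * \int[leb2]_y (`|a y|)%:E)%E; last first.
    by rewrite -intRZ//; [apply: eq_integral => y _; rewrite /= normrM|meas].
  rewrite muleC; over.
have -> : (\int[leb2]_y (`|a y|)%:E = (fine (\int[leb2]_y (`|a y|)%:E))%:E)%E.
  by rewrite fineK// ge0_fin_numE// intR_ge0.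
under eq_integral do rewrite -EFinM.
rewrite intRZ ?fine_ge0 ?intR_ge0//; last by meas.
by rewrite lte_mul_pinfty ?lee_fin ?fine_ge0 ?intR_ge0.
Qed.

(** The squared transform is opened into a double integral and the frequency is integrated out.
    Fubini applies because [wt eps k |a x a y|] is an integrable majorant; the integrability of the
    weight in [k] is what makes the exchange legitimate. *)
Lemma int_wt_transform a (eps : R) : 0 < eps -> L1 a ->
  (\int[leb2]_k (wt eps k * ((cosT a k) ^+ 2 + (sinT a k) ^+ 2))%:E =
   \int[leb4]_p (a p.1 * a p.2 * pk2 eps (psub p.1 p.2))%:E)%E.
Proof.
move=> e0 La; have [ma ia] := La; have iaa := aa_integrable La.
have mw := @measurable_wt eps.
have mcos : measurable_fun setT (fun q : (R * R) * ((R * R) * (R * R)) => cos (pdot q.1 (psub q.2.1 q.2.2))).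
  by rewrite /pdot /psub/=; meas.
pose f (q : (R * R) * ((R * R) * (R * R))) := wt eps q.1 * (a q.2.1 * a q.2.2 * cos (pdot q.1 (psub q.2.1 q.2.2))).
have mf : measurable_fun setT f by rewrite /f; meas.
pose A := fine (\int[leb4]_p `|(a p.1 * a p.2)%:E|)%E.
have A0 : 0 <= A by rewrite fine_ge0// integral_ge0.
have AE : (\int[leb4]_p `|(a p.1 * a p.2)%:E| = A%:E)%E.
  rewrite fineK// ge0_fin_numE ?integral_ge0//.
  by have /integrableP[] := iaa.
have if_ : (leb2 \x leb4)%E.-integrable setT (EFin \o f).
  apply/(@integrable12ltyP _ _ _ _ R leb2 leb4); first exact/measurable_EFinP.
  apply: (@le_lt_trans _ _ (\int[leb2]_k (A * wt eps k)%:E)%E).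
    apply: le_int => k; first exact: integral_ge0.
    rewrite mulrC EFinM -AE.
    rewrite -ge0_integralZl_EFin ?wt_ge0//; last first.
      by apply: measurableT_comp => //; meas.
    apply: le_int => p; first by [].
    rewrite /f/= normrM ger0_norm ?wt_ge0// lee_fin ler_wpM2l ?wt_ge0//.
    by rewrite normrM ler_piMr// norm_cos1.
  rewrite intRZ//; last by move=> k; exact: wt_ge0.
  by rewrite int_wt// -EFinM ltry.
transitivity (\int[leb2]_k \int[leb4]_p (f (k, p))%:E)%E.
  apply: eq_integral => k _; rewrite /f/=.
  have ik : leb4.-integrable setT (fun p => (a p.1 * a p.2 * cos (pdot k (psub p.1 p.2)))%:E).
    apply: (@le_integrable _ _ _ leb4 setT measurableT _ (fun p => (a p.1 * a p.2)%:E)) => //.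
    - by rewrite /pdot /psub/=; meas.
    - by move=> p _; rewrite lee_fin normrM ler_piMr// norm_cos1.
  under [RHS]eq_integral do rewrite EFinM.
  rewrite integralZl// -(@integral12_prod_meas1 _ _ _ _ R leb2 leb2 _ ik) /fubini_F EFinM.
  rewrite -(int_double_cos k La); congr (_ * _)%E; apply: eq_integral => x _; apply: eq_integral => y _.
  by rewrite /= pdotB.
rewrite (@Fubini _ _ _ _ R leb2 leb4 _ if_); apply: eq_integral => p _.
rewrite /f/=.
under eq_integral do rewrite mulrCA EFinM.
rewrite integralZl//; last first.
  apply: (@le_integrable _ _ _ leb2 setT measurableT _ (fun k => (wt eps k)%:E)).
  - by rewrite /pdot; meas.
  - by move=> k _; rewrite lee_fin normrM ler_piMr// norm_cos1.
  - apply/integrableP; split; first by apply: mfE.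
    under eq_integral do rewrite gee0_abs ?lee_fin ?wt_ge0//.
    by rewrite int_wt// ltry.
by rewrite int_wt_cos// -EFinM.
Qed.

End plancherel_real.

(** * Removing the weight from Plancherel's identity *)

Section plancherel_limit.
Context {R : realType}.
Local Notation mu := (@lebesgue_measure R).
Local Notation leb2 := (@leb2 R).
Local Notation leb4 := (@leb4 R).
Implicit Types a b : R * R -> R.

Lemma pk2_ge0 (eps : R) z : 0 < eps -> 0 <= pk2 eps z.
Proof. by move=> e0; rewrite mulr_ge0 ?pk_ge0. Qed.

(** Two parameters are kept because the tail bounds in [defect_vanishing] mix [pk 1] and
    [pk eps]. *)
Lemma int_pkpk (e1 e2 : R) : 0 < e1 -> 0 < e2 ->
  (\int[leb2]_z (pk e1 z.1 * pk e2 z.2)%:E = ((2 * pi) ^+ 2)%:E)%E.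
Proof.
move=> h1 h2; have m1 := measurable_pk h1; have m2 := measurable_pk h2.
rewrite tonelli2F; last 2 first.
- by meas.
- by move=> k; rewrite lee_fin mulr_ge0 ?pk_ge0.
transitivity (\int[mu]_x (2 * pi * pk e1 x)%:E)%E.
  apply: eq_integral => x _ /=; rewrite intRZ ?pk_ge0//; last by move=> y; exact: pk_ge0.
  by rewrite int_pk// -EFinM mulrC.
rewrite intRZ ?mulr_ge0 ?pi_ge0//; last by move=> y; exact: pk_ge0.
by rewrite int_pk// -EFinM expr2.
Qed.

Lemma measurable_pk2 (eps : R) : 0 < eps -> measurable_fun setT (pk2 eps).
Proof. by move=> e0; have m1 := measurable_pk e0; rewrite /pk2; meas. Qed.

Lemma pk2N (eps : R) x y : pk2 eps (psub x y) = pk2 eps (psub y x).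
Proof. by rewrite /pk2 /psub/= -(pkN eps (y.1 - x.1)) -(pkN eps (y.2 - x.2)) !opprB. Qed.

Lemma int_pk2_shift (eps : R) y : 0 < eps ->
  (\int[leb2]_x (pk2 eps (psub x y))%:E = ((2 * pi) ^+ 2)%:E)%E.
Proof.
move=> e0; have mk := measurable_pk2 e0.
have := @int_shift2 R (- y.1, - y.2) (fun x => (pk2 eps x)%:E) _ _; rewrite /psub => ->.
- exact: int_pkpk.
- by meas.
- by move=> x; rewrite lee_fin pk2_ge0.
Qed.

Lemma int_pk2_sqr (eps : R) a : 0 < eps -> measurable_fun setT a ->
  (\int[leb4]_p (pk2 eps (psub p.1 p.2) * (a p.1) ^+ 2)%:E = ((2 * pi) ^+ 2)%:E * sqn a)%E /\
  (\int[leb4]_p (pk2 eps (psub p.1 p.2) * (a p.2) ^+ 2)%:E = ((2 * pi) ^+ 2)%:E * sqn a)%E.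
Proof.
move=> e0 ma; have mk := measurable_pk2 e0.
have mks : measurable_fun setT (fun p : (R * R) * (R * R) => pk2 eps (psub p.1 p.2)).
  by apply: (mf_comp mk); rewrite /psub; meas.
have k0 x y : 0 <= pk2 eps (psub x y) by exact: pk2_ge0.
have c0 : 0 <= (2 * pi) ^+ 2 :> R by exact: sqr_ge0.
split.
  rewrite tonelli4F; last 2 first.
  - by meas.
  - by move=> p; rewrite lee_fin mulr_ge0 ?sqr_ge0.
  rewrite /sqn -intRZ//; last 2 first.
  - by meas.
  - by move=> x; exact: sqr_ge0.
  apply: eq_integral => x _ /=.
  under eq_integral do rewrite mulrC pk2N.
  rewrite intRZ ?sqr_ge0//; last by apply: (mf_comp mk); rewrite /psub; meas.
  by rewrite int_pk2_shift// -EFinM mulrC.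
rewrite tonelli4G; last 2 first.
- by meas.
- by move=> p; rewrite lee_fin mulr_ge0 ?sqr_ge0.
rewrite /sqn -intRZ//; last 2 first.
- by meas.
- by move=> x; exact: sqr_ge0.
apply: eq_integral => x _ /=.
under eq_integral do rewrite mulrC.
rewrite intRZ ?sqr_ge0//; last by apply: (mf_comp mk); rewrite /psub; meas.
by rewrite int_pk2_shift// -EFinM mulrC.
Qed.

Definition defect a (eps : R) : \bar R :=
  (\int[leb4]_p (pk2 eps (psub p.1 p.2) * (a p.1 - a p.2) ^+ 2)%:E)%E.

(** The identity [2 a x a y + (a x - a y)^2 = a x^2 + a y^2] is integrated against the kernel, whose
    mass in either variable is [(2 pi)^2]. *)
Lemma plancherel_defect a (eps : R) : 0 < eps -> L1 a -> (sqn a < +oo)%E ->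
  (2%:E * (\int[leb2]_k (wt eps k * ((cosT a k) ^+ 2 + (sinT a k) ^+ 2))%:E) + defect a eps =
   2%:E * (((2 * pi) ^+ 2)%:E * sqn a))%E.
Proof.
move=> e0 La ia; rewrite int_wt_transform//; have [ma _] := La.
have mk := measurable_pk2 e0.
have mks : measurable_fun setT (fun p : (R * R) * (R * R) => pk2 eps (psub p.1 p.2)).
  by apply: (mf_comp mk); rewrite /psub; meas.
have k0 x y : 0 <= pk2 eps (psub x y) by exact: pk2_ge0.
have [I1 I2] := int_pk2_sqr e0 ma.
pose s (p : (R * R) * (R * R)) := pk2 eps (psub p.1 p.2) * (a p.1) ^+ 2 + pk2 eps (psub p.1 p.2) * (a p.2) ^+ 2.
have s0 p : 0 <= s p by apply: addr_ge0; apply: mulr_ge0; rewrite ?sqr_ge0.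
have ms : measurable_fun setT s by rewrite /s; meas.
have Is : (\int[leb4]_p (s p)%:E = 2%:E * (((2 * pi) ^+ 2)%:E * sqn a))%E.
  rewrite intRD; [|by meas|by meas|by move=> p; rewrite mulr_ge0 ?sqr_ge0|by move=> p; rewrite mulr_ge0 ?sqr_ge0].
  by rewrite I1 I2 -[X in (X + _)%E]mul1e -[X in (_ + X)%E]mul1e -ge0_muleDl// mule_ge0 ?sqn_ge0 ?lee_fin ?sqr_ge0.
have is_ (c : R) : leb4.-integrable setT (fun p => (c * s p)%:E).
  under eq_fun do rewrite EFinM.
  apply: integrableZl => //; apply/integrableP; split; first by meas.
  under eq_integral do rewrite gee0_abs ?lee_fin ?s0//.
  by rewrite Is !lte_mul_pinfty ?lee_fin ?sqr_ge0.
have it : leb4.-integrable setT (fun p => (a p.1 * a p.2 * pk2 eps (psub p.1 p.2))%:E).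
  apply: (@le_integrable _ _ _ leb4 setT measurableT _ (fun p => (1 * s p)%:E)) => //; first by meas.
  move=> p _; rewrite lee_fin mul1r (ger0_norm (s0 p)) normrM (ger0_norm (k0 _ _)) /s -mulrDr mulrC.
  rewrite ler_wpM2l// normrM -(real_normK (num_real (a p.1))) -(real_normK (num_real (a p.2))).
  have := sqr_ge0 (`|a p.1| - `|a p.2|); have := normr_ge0 (a p.1); have := normr_ge0 (a p.2); nra.
have id_ : leb4.-integrable setT (fun p => (pk2 eps (psub p.1 p.2) * (a p.1 - a p.2) ^+ 2)%:E).
  apply: (@le_integrable _ _ _ leb4 setT measurableT _ (fun p => (2 * s p)%:E)) => //; first by meas.
  move=> p _; have d1 : 0 <= 2 * s p by rewrite mulr_ge0.
  have d2 : 0 <= pk2 eps (psub p.1 p.2) * (a p.1 - a p.2) ^+ 2 by rewrite mulr_ge0 ?sqr_ge0.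
  rewrite lee_fin (ger0_norm d1) (ger0_norm d2) /s -mulrDr [leRHS]mulrCA ler_wpM2l//.
  by apply: le_trans (sqr2 _ _) _; rewrite sqrrN.
rewrite -integralZl// /defect -integralD//; last by apply: integrableZl.
rewrite -Is; apply: eq_integral => p _; rewrite -EFinM -EFinD /s; congr (_%:E); ring.
Qed.

Lemma sqn_tr_bound a z : measurable_fun setT a -> (sqn (fun x => tr z a x - a x)%R <= 4%:E * sqn a)%E.
Proof.
move=> ma; apply: le_trans (sqnB_le (measurable_tr z ma) ma) _; rewrite sqn_tr//.
rewrite -[X in (X + _)%E]mul1e -[X in (_ + X)%E]mul1e -ge0_muleDl// muleA.
by rewrite -EFinD -EFinM le_eqVlt (_ : 2 * (1 + 1) = 4 :> R) ?eqxx//; ring.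
Qed.

(** Substituting [x = y + z] and exchanging the integrals isolates the translation by [z], so that
    continuity of translations can be used. *)
Lemma defectE a (eps : R) : 0 < eps -> measurable_fun setT a ->
  (defect a eps = \int[leb2]_z ((pk2 eps z)%:E * sqn (fun x => tr z a x - a x)%R))%E.
Proof.
move=> e0 ma; have mk := measurable_pk2 e0.
have mks : measurable_fun setT (fun p : (R * R) * (R * R) => pk2 eps (psub p.1 p.2)).
  by apply: (mf_comp mk); rewrite /psub; meas.
rewrite /defect tonelli4G; last 2 first.
- by meas.
- by move=> p; rewrite lee_fin mulr_ge0 ?pk2_ge0 ?sqr_ge0.
transitivity (\int[leb2]_y \int[leb2]_z (pk2 eps z * (a (y.1 + z.1, y.2 + z.2) - a y) ^+ 2)%:E)%E.
  apply: eq_integral => y _ /=.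
  rewrite -(@int_shift2 R y (fun x => (pk2 eps (psub x y) * (a x - a y) ^+ 2)%:E)); last 2 first.
  - have mky : measurable_fun setT (fun x : R * R => pk2 eps (psub x y)).
      by apply: (mf_comp mk); rewrite /psub; meas.
    by meas.
  - by move=> x; rewrite lee_fin mulr_ge0 ?pk2_ge0 ?sqr_ge0.
  apply: eq_integral => z _; rewrite /psub/= !addrK -surjective_pairing.
  by rewrite [_ + y.1]addrC [_ + y.2]addrC.
pose g (q : (R * R) * (R * R)) := (pk2 eps q.2 * (a (q.1.1 + q.2.1, q.1.2 + q.2.2) - a q.1) ^+ 2)%:E.
have mg : measurable_fun setT g by rewrite /g; meas.
have g0 q : (0 <= g q)%E by rewrite lee_fin mulr_ge0 ?pk2_ge0 ?sqr_ge0.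
rewrite -(tonelli4F mg g0) (tonelli4G mg g0); apply: eq_integral => z _.
rewrite /g/= /sqn -intRZ ?pk2_ge0//; last 2 first.
- by rewrite /tr; meas.
- by move=> x; exact: sqr_ge0.
Qed.

(** If every [d = 1 / (n + 1)] failed, choosing a counterexample for each [n] would give a sequence
    tending to 0 along which [Phi] does not vanish. This turns dominated convergence along sequences
    into a uniform statement on a small square. *)
Lemma seq_delta (Phi : R * R -> \bar R) :
  (forall c : nat -> R * R, (c n).1 @[n --> \oo] --> (0 : R) -> (c n).2 @[n --> \oo] --> (0 : R) ->
    vanishing (fun n => Phi (c n))) ->
  forall e : R, 0 < e -> exists2 d : R, 0 < d & forall z : R * R, `|z.1| < d -> `|z.2| < d -> (Phi z <= e%:E)%E.
Proof.
move=> H e e0; apply: contrapT => hN.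
have hz (n : nat) : exists z : R * R, [/\ `|z.1| < n.+1%:R^-1, `|z.2| < n.+1%:R^-1 & ~ (Phi z <= e%:E)%E].
  apply: contrapT => hn; apply: hN; exists n.+1%:R^-1; first by rewrite invr_gt0 ltr0Sn.
  by move=> z z1 z2; apply: contrapT => hz; apply: hn; exists z.
have [c hc] := choice hz.
have cv (g : nat -> R) : (forall n, `|g n| < n.+1%:R^-1) -> g n @[n --> \oo] --> (0 : R).
  move=> hg; apply: norm_cvg0; apply: (@squeeze_cvgr _ _ _ _ (fun=> 0) (fun n => n.+1%:R^-1)).
  - by apply: nearW => n; rewrite normr_ge0 (ltW (hg n)).
  - exact: cvg_cst.
  - exact: cvg_harmonic.
have [N HN] := H c (cv _ (fun n => let: And3 h _ _ := hc n in h)) (cv _ (fun n => let: And3 _ h _ := hc n in h)) e e0.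
by have [_ _] := hc N; apply; exact: HN.
Qed.

Lemma tr_continuous_delta a : measurable_fun setT a -> (sqn a < +oo)%E ->
  forall e : R, 0 < e -> exists2 d : R, 0 < d & forall z : R * R, `|z.1| < d -> `|z.2| < d ->
    (sqn (fun x => tr z a x - a x)%R <= e%:E)%E.
Proof. by move=> ma ia; apply: seq_delta => c; exact: tr_continuous. Qed.

(** Near [z = 0] the translation error is small and the kernel has fixed mass; away from it the
    error is at most [4 sqn a] and the kernel has mass of order [eps] by [pk_tail]. *)
Lemma defect_vanishing a : measurable_fun setT a -> (sqn a < +oo)%E ->
  vanishing (fun n => defect a n.+1%:R^-1).
Proof.
move=> ma ia e e0; pose P : R := (2 * pi) ^+ 2.
have P0 : 0 < P by rewrite exprn_gt0// mulr_gt0// pi_gt0.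
pose B := 4 * fine (sqn a).
have B0 : 0 <= B by rewrite mulr_ge0// fine_ge0// sqn_ge0.
have BE : (4%:E * sqn a = B%:E)%E by rewrite /B EFinM fineK// ge0_fin_numE ?sqn_ge0.
(* The kernel has mass [P], so this tolerance contributes [e / 2] to the integral. *)
have e1 : 0 < e / 2 / P by rewrite !divr_gt0.
have [d d0 hd] := tr_continuous_delta ma ia e1.
pose c := B * (1 + d ^- 2).
have c0 : 0 <= c by rewrite mulr_ge0// addr_ge0// invr_ge0 sqr_ge0.
have bound (eps : R) : 0 < eps -> (defect a eps <= (e / 2 + 2 * eps * c * P)%:E)%E.
  move=> h0; rewrite defectE//.
  have h1 : 0 < 1 :> R by [].
  have m1 := measurable_pk h1; have me := measurable_pk h0.
  (* One summand for the small square and one for each coordinate that may be at least [d] in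
     absolute value. *)
  pose g (z : R * R) := (e / 2 / P) * pk2 eps z + (eps * c * (pk 1 z.1 * pk eps z.2) + eps * c * (pk eps z.1 * pk 1 z.2)).
  apply: (@le_trans _ _ (\int[leb2]_z (g z)%:E)%E).
    apply: le_int => z; first by rewrite mule_ge0 ?lee_fin ?pk2_ge0 ?sqn_ge0.
    have hz := sqn_tr_bound z ma; rewrite BE in hz.
    have pp1 : 0 <= pk 1 z.1 * pk eps z.2 by rewrite mulr_ge0 ?pk_ge0.
    have pp2 : 0 <= pk eps z.1 * pk 1 z.2 by rewrite mulr_ge0 ?pk_ge0.
    have ec : 0 <= eps * c by rewrite mulr_ge0// ltW.
    have g1 : 0 <= (e / 2 / P) * pk2 eps z by rewrite mulr_ge0 ?pk2_ge0// ltW.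
    have [z1|z1] := ltP `|z.1| d; last first.
      apply: (@le_trans _ _ ((pk2 eps z)%:E * B%:E)%E); first by rewrite lee_wpmul2l ?lee_fin ?pk2_ge0.
      rewrite -EFinM lee_fin /g.
      apply: (@le_trans _ _ (eps * c * (pk 1 z.1 * pk eps z.2))); last by rewrite ler_wpDl// lerDl mulr_ge0.
      have := pk_tail h0 d0 z1; rewrite /pk2 /c => h.
      rewrite (_ : eps * _ * _ = B * ((eps * (1 + d ^- 2) * pk 1 z.1) * pk eps z.2)); last by ring.
      by rewrite mulrC ler_wpM2l// ler_wpM2r// pk_ge0.
    have [z2|z2] := ltP `|z.2| d; last first.
      apply: (@le_trans _ _ ((pk2 eps z)%:E * B%:E)%E); first by rewrite lee_wpmul2l ?lee_fin ?pk2_ge0.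
      rewrite -EFinM lee_fin /g.
      apply: (@le_trans _ _ (eps * c * (pk eps z.1 * pk 1 z.2))); last by rewrite ler_wpDl// lerDr mulr_ge0.
      have := pk_tail h0 d0 z2; rewrite /pk2 /c => h.
      rewrite (_ : eps * _ * _ = B * (pk eps z.1 * (eps * (1 + d ^- 2) * pk 1 z.2))); last by ring.
      by rewrite mulrC ler_wpM2l// ler_wpM2l// pk_ge0.
    apply: (@le_trans _ _ ((pk2 eps z)%:E * (e / 2 / P)%:E)%E); first by rewrite lee_wpmul2l ?lee_fin ?pk2_ge0 ?hd.
    by rewrite -EFinM lee_fin mulrC /g lerDl addr_ge0// mulr_ge0.
  have ec : 0 <= eps * c by rewrite mulr_ge0// ltW.
  have mk := measurable_pk2 h0.
  rewrite /g intRD; last 4 first.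
  - by meas.
  - by meas.
  - by move=> z; rewrite mulr_ge0 ?pk2_ge0 ?ltW.
  - by move=> z; rewrite addr_ge0// mulr_ge0// mulr_ge0 ?pk_ge0.
  rewrite intRZ ?(ltW e1)//; last by move=> z; exact: pk2_ge0.
  rewrite intRD; last 4 first.
  - by meas.
  - by meas.
  - by move=> z; rewrite mulr_ge0// mulr_ge0 ?pk_ge0.
  - by move=> z; rewrite mulr_ge0// mulr_ge0 ?pk_ge0.
  rewrite !intRZ//; last 4 first.
  - by meas.
  - by move=> z; rewrite mulr_ge0 ?pk_ge0.
  - by meas.
  - by move=> z; rewrite mulr_ge0 ?pk_ge0.
  rewrite !int_pkpk// -!EFinM -!EFinD lee_fin -/P le_eqVlt; apply/orP; left; apply/eqP; field.
  by rewrite gt_eqF.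
pose K := 2 * c * P.
have K0 : 0 <= K by rewrite /K; apply: mulr_ge0; [apply: mulr_ge0|exact: ltW].
exists (Num.truncn (K / (e / 2))) => n Nn.
apply: le_trans (bound _ _) _; first by rewrite invr_gt0 ltr0n.
rewrite lee_fin [leRHS](splitr e) lerD2l.
rewrite (_ : _ * _ * _ * _ = K / n.+1%:R); last by rewrite /K; ring.
rewrite ler_pdivrMr ?ltr0n// mulrC -ler_pdivrMr ?divr_gt0//.
by apply: le_trans (ltW (truncnS_gt _)) _; rewrite ler_nat.
Qed.

Lemma wt_cvg (k : R * R) : vanishing (fun n => (1 - wt n.+1%:R^-1 k)%:E).
Proof.
apply: vanishingN => [n|].
  rewrite subr_ge0 /wt -expRD -[leRHS]expR0 ler_expR !mulNr -opprD oppr_le0 addr_ge0//;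
    by rewrite mulr_ge0// invr_ge0.
have -> : (0 = 1 - expR (- 0 * `|k.1|) * expR (- 0 * `|k.2|) :> R) by rewrite oppr0 !mul0r expR0 mulr1 subrr.
apply: cvgB; first exact: cvg_cst.
have inv0 : (n.+1%:R^-1 : R) @[n --> \oo] --> (0 : R) by exact: cvg_harmonic.
by apply: cvgM; (apply: continuous_cvg; [exact: continuous_expR|apply: cvgM; [exact: cvgN|exact: cvg_cst]]).
Qed.

(** The weights tend to 1, so Fatou's lemma bounds the full integral, whose finiteness is not known
    beforehand. *)
Lemma int_wt_limit (h : R * R -> R) (M : \bar R) : measurable_fun setT h -> (forall k, 0 <= h k) ->
  (forall n, \int[leb2]_k (wt n.+1%:R^-1 k * h k)%:E <= M)%E -> (\int[leb2]_k (h k)%:E <= M)%E.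
Proof.
move=> mh h0 hM.
pose g n (k : R * R) := (wt n.+1%:R^-1 k * h k)%:E.
have mg n : measurable_fun setT (g n) by have mw := @measurable_wt R n.+1%:R^-1; rewrite /g; meas.
have g0 n k : (0 <= g n k)%E by rewrite lee_fin mulr_ge0 ?wt_ge0.
have lim k : g n k @[n --> \oo] --> (h k)%:E.
  apply: cvg_EFin; first by near=> n.
  rewrite -[X in _ --> X]mul1r.
  apply: cvgM; last exact: cvg_cst.
  apply/cvgrPdist_le => e e0; have [N hN] := wt_cvg k e0.
  exists N => // n /= Nn; have := hN n Nn; rewrite lee_fin.
  apply: le_trans; rewrite ger0_norm// subr_ge0 /wt -expRD -[leRHS]expR0 ler_expR !mulNr -opprD oppr_le0 addr_ge0//;
    by rewrite mulr_ge0// invr_ge0.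
have := @fatou _ _ _ leb2 setT measurableT g mg (fun n k _ => g0 n k).
rewrite (_ : (\int[leb2]_k limn_einf (g ^~ k) = \int[leb2]_k (h k)%:E)%E); last first.
  by apply: eq_integral => k _; rewrite is_cvg_limn_einfE; [apply/cvg_lim => //; exact: lim|apply/cvg_ex; exists (h k)%:E; exact: lim].
move=> /le_trans; apply; rewrite limn_einf_lim; apply: lime_le; first exact: is_cvg_einfs.
near=> n; apply: ereal_inf_le; exists (\int[leb2]_k g n k)%E; last exact: hM.
by exists n => //=.
Unshelve. all: by end_near. Qed.

Lemma wt_le1 (eps : R) k : 0 < eps -> wt eps k <= 1.
Proof.
move=> e0; rewrite /wt -expRD -[leRHS]expR0 ler_expR !mulNr -opprD oppr_le0.
by apply: addr_ge0; apply: mulr_ge0 => //; exact: ltW.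
Qed.

(** One inequality drops the nonnegative defect and removes the weight by Fatou; the other uses
    [wt <= 1] and the vanishing of the defect. *)
Lemma plancherel_real a : L1 a -> (sqn a < +oo)%E ->
  (sqn (cosT a) + sqn (sinT a) = ((2 * pi) ^+ 2)%:E * sqn a)%E.
Proof.
move=> La ia; have [ma _] := La.
have mC := measurable_cosT ma; have mS := measurable_sinT ma.
pose h k := (cosT a k) ^+ 2 + (sinT a k) ^+ 2.
have h0 k : 0 <= h k by rewrite /h addr_ge0 ?sqr_ge0.
have mh : measurable_fun setT h by rewrite /h; meas.
have -> : (sqn (cosT a) + sqn (sinT a) = \int[leb2]_k (h k)%:E)%E.
  by rewrite /h intRD//; [meas|meas|move=> k; exact: sqr_ge0|move=> k; exact: sqr_ge0].
set P : R := (2 * pi) ^+ 2; have P0 : 0 <= P by exact: sqr_ge0.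
have n0 n : 0 < n.+1%:R^-1 :> R by rewrite invr_gt0 ltr0n.
have dg n : (0 <= defect a n.+1%:R^-1)%E.
  by apply: intR_ge0 => p; rewrite mulr_ge0 ?pk2_ge0 ?sqr_ge0.
have ig n : (0 <= \int[leb2]_k (wt n.+1%:R^-1 k * h k)%:E)%E.
  by apply: intR_ge0 => k; rewrite mulr_ge0 ?wt_ge0.
have E n := plancherel_defect (n0 n) La ia.
apply/eqP; rewrite eq_le; apply/andP; split.
  apply: int_wt_limit => // n.
  rewrite -(@lee_pmul2l _ 2%:E)//.
  by rewrite -(E n) leeDl.
rewrite -(@lee_pmul2l _ 2%:E)//.
apply/lee_addgt0Pr => e e0; have [N hN] := defect_vanishing ma ia e0.
rewrite -(E N); apply: leeD; last exact: hN.
rewrite lee_wpmul2l//; apply: le_intR => k; first by apply: mulr_ge0; [exact: wt_ge0|exact: h0].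
by apply: ler_piMl; [exact: h0|exact: wt_le1].
Qed.

End plancherel_limit.

(** * The Fourier transform on L^2 *)

Section complex_L2.
Context {R : realType}.
Local Notation leb2 := (@leb2 R).
Local Notation Re := (@complex.Re R).
Local Notation Im := (@complex.Im R).
Implicit Types f g : R * R -> R[i].

Definition csqn f : \bar R := (sqn (Re \o f) + sqn (Im \o f))%E.

Lemma csqn_ge0 f : (0 <= csqn f)%E.
Proof. by rewrite adde_ge0 ?sqn_ge0. Qed.

Lemma normc_sqr (z : R[i]) : Normc.normc z ^+ 2 = Re z ^+ 2 + Im z ^+ 2.
Proof. by case: z => a b /=; rewrite sqr_sqrtr// addr_ge0 ?sqr_ge0. Qed.

Lemma int_normc2 f : cmeasurable setT f ->
  (\int[leb2]_x (Normc.normc (f x) ^+ 2)%:E = csqn f)%E.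
Proof.
move=> [mr mi]; under eq_integral do rewrite normc_sqr.
rewrite intRD//.
- exact: (mfX 2 mr).
- exact: (mfX 2 mi).
- by move=> x; exact: sqr_ge0.
- by move=> x; exact: sqr_ge0.
Qed.

Lemma in_L2E f : in_L2 setT f <-> cmeasurable setT f /\ (csqn f < +oo)%E.
Proof. by split=> -[mf h]; split => //; move: h; rewrite -/leb2 int_normc2. Qed.

Lemma L2normE f : cmeasurable setT f -> L2norm f = (csqn f `^ 2^-1)%E.
Proof.
move=> mf; rewrite /L2norm unlock /=; congr (_ `^ _)%E.
rewrite -int_normc2//; apply: eq_integral => x _.
rewrite ger0_norm; last by case: (f x) => a b /=; exact: sqrtr_ge0.
by rewrite powR_mulrn//; case: (f x) => a b /=; exact: sqrtr_ge0.
Qed.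

Lemma L2norm_sqr f : cmeasurable setT f -> (L2norm f `^ 2 = csqn f)%E.
Proof.
move=> mf; rewrite L2normE// -poweRrM ?mulVf ?poweRe1 ?csqn_ge0//.
Qed.

Lemma L2norm_ge0 f : (0 <= L2norm f)%E.
Proof. exact: Lnorm_ge0. Qed.

Lemma L2norm_le f (c : R) : 0 <= c -> cmeasurable setT f ->
  (L2norm f <= c%:E)%E = (csqn f <= (c ^+ 2)%:E)%E.
Proof.
move=> c0 mf; apply/idP/idP => h.
  rewrite -L2norm_sqr// -powR_mulrn// -poweR_EFin.
  by apply: gt0_ler_poweR => //; rewrite ?in_itv/= ?leey ?andbT ?L2norm_ge0 ?lee_fin.
have -> : c%:E = (((c ^+ 2)%:E) `^ 2^-1)%E.
  by rewrite -powR_mulrn// -poweR_EFin -poweRrM mulfV// poweRe1 ?lee_fin.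
rewrite L2normE//; apply: gt0_ler_poweR => //; rewrite ?in_itv/= ?leey ?andbT ?csqn_ge0 ?lee_fin ?sqr_ge0//.
Qed.

Lemma L2norm_cvg0 (u : nat -> R * R -> R[i]) : (forall n, cmeasurable setT (u n)) ->
  (L2norm (u n) @[n --> \oo] --> 0%E) <-> vanishing (fun n => csqn (u n)).
Proof.
move=> mu; split => [h|h].
  move=> e e0; have s0 : 0 < Num.sqrt e by rewrite sqrtr_gt0.
  have [N hN] := cvg0_vanishing h s0; exists N => n Nn.
  by rewrite -(sqr_sqrtr (ltW e0)) -L2norm_le ?sqrtr_ge0// hN.
apply: vanishing_cvg0; first by move=> n; exact: L2norm_ge0.
move=> e e0; have e2 : 0 < e ^+ 2 by rewrite exprn_gt0.
have [N hN] := h _ e2; exists N => n Nn.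
by rewrite L2norm_le ?hN// ltW.
Qed.

(** Pointwise, the right side minus the left is [d^-1 (a - (1 + d) b)^2]. Small [d] keeps the factor
    of [sqn b] close to 1, as an exact identity in the limit demands. *)
Lemma sqn_young (a b : R * R -> R) (d : R) : 0 < d -> measurable_fun setT a -> measurable_fun setT b ->
  (sqn a <= (1 + d)%:E * sqn b + (1 + d^-1)%:E * sqn (fun x => a x - b x)%R)%E.
Proof.
move=> d0 ma mb.
have di : 0 < d^-1 by rewrite invr_gt0.
have d1 : 0 <= 1 + d by rewrite addr_ge0// ltW.
have d2 : 0 <= 1 + d^-1 by rewrite addr_ge0// ltW.
rewrite /sqn -!intRZ//; [|by meas|by move=> x; exact: sqr_ge0|by meas|by move=> x; exact: sqr_ge0].
rewrite -intRD; [|by meas|by meas|by move=> x; rewrite mulr_ge0 ?sqr_ge0|by move=> x; rewrite mulr_ge0 ?sqr_ge0].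
apply: le_intR => x; first exact: sqr_ge0.
rewrite -subr_ge0 (_ : _ - _ = d^-1 * (a x - (1 + d) * b x) ^+ 2).
  by rewrite mulr_ge0 ?sqr_ge0// ltW.
by field; rewrite gt_eqF.
Qed.

Lemma csqn_young f g (d : R) : 0 < d -> cmeasurable setT f -> cmeasurable setT g ->
  (csqn f <= (1 + d)%:E * csqn g + (1 + d^-1)%:E * csqn (fun x => f x - g x)%R)%E.
Proof.
move=> d0 [mfr mfi] [mgr mgi].
have di : 0 < d^-1 by rewrite invr_gt0.
have d1 : 0 <= 1 + d by rewrite addr_ge0// ltW.
have d2 : 0 <= 1 + d^-1 by rewrite addr_ge0// ltW.
rewrite /csqn.
have -> : Re \o (fun x => f x - g x) = (fun x => (Re \o f) x - (Re \o g) x).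
  by apply/funext => x /=; case: (f x); case: (g x).
have -> : Im \o (fun x => f x - g x) = (fun x => (Im \o f) x - (Im \o g) x).
  by apply/funext => x /=; case: (f x); case: (g x).
rewrite (ge0_muleDr (1 + d)%:E (sqn_ge0 _) (sqn_ge0 _)) (ge0_muleDr (1 + d^-1)%:E (sqn_ge0 _) (sqn_ge0 _)).
by rewrite [leRHS]addeACA; apply: leeD; exact: sqn_young.
Qed.

Lemma cmeasurableB f g : cmeasurable setT f -> cmeasurable setT g -> cmeasurable setT (fun x => f x - g x).
Proof.
move=> [mfr mfi] [mgr mgi]; split.
  rewrite (_ : _ \o _ = (fun x => (Re \o f) x - (Re \o g) x)); first by meas.
  by apply/funext => x /=; case: (f x); case: (g x).
rewrite (_ : _ \o _ = (fun x => (Im \o f) x - (Im \o g) x)); first by meas.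
by apply/funext => x /=; case: (f x); case: (g x).
Qed.

Lemma csqnC f g : csqn (fun x => f x - g x) = csqn (fun x => g x - f x).
Proof.
rewrite /csqn /sqn; congr (_ + _)%E; apply: eq_integral => x _ /=; congr (_%:E);
 by case: (f x) => p q; case: (g x) => r t /=; rewrite -sqrrN opprB.
Qed.

(* [csqn_young] stands in for the triangle inequality of the L^2 norm. *)
Lemma csqn_limit_le (u_ v_ : nat -> R * R -> R[i]) u v : (forall n, cmeasurable setT (u_ n)) ->
  (forall n, cmeasurable setT (v_ n)) -> cmeasurable setT u -> cmeasurable setT v ->
  (csqn v < +oo)%E -> (forall n, csqn (u_ n) = csqn (v_ n)) ->
  vanishing (fun n => csqn (fun x => u_ n x - u x)) -> vanishing (fun n => csqn (fun x => v_ n x - v x)) ->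
  (csqn u <= csqn v)%E.
Proof.
move=> mu_ mv_ mu mv iv uv hu hv.
have [V VE] : exists V, csqn v = V%:E.
  by exists (fine (csqn v)); rewrite fineK// ge0_fin_numE ?csqn_ge0.
have V0 : 0 <= V by have := csqn_ge0 v; rewrite VE lee_fin.
(* Two applications of [csqn_young] pass from [u] to [u_ n] and from [v_ n] to [v]. Approximation
   within [d^2] beats the factor [1 + d^-1], leaving [d^2 + d]. *)
have H (d : R) : 0 < d -> (csqn u <= ((1 + d) * ((1 + d) * V + (1 + d^-1) * d ^+ 2) + (1 + d^-1) * d ^+ 2)%:E)%E.
  move=> d0.
  have di : 0 < d^-1 by rewrite invr_gt0.
  have d1 : 0 <= 1 + d by rewrite addr_ge0// ltW.
  have d2 : 0 <= 1 + d^-1 by rewrite addr_ge0// ltW.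
  have dd : 0 < d ^+ 2 by rewrite exprn_gt0.
  have [N hN] := hu _ dd; have [M hM] := hv _ dd.
  pose n := maxn N M.
  have h1 : (csqn (fun x => u x - u_ n x)%R <= (d ^+ 2)%:E)%E by rewrite csqnC hN// leq_maxl.
  have h2 : (csqn (fun x => v_ n x - v x)%R <= (d ^+ 2)%:E)%E by rewrite hM// leq_maxr.
  apply: le_trans (csqn_young d0 mu (mu_ n)) _.
  apply: (@le_trans _ _ ((1 + d)%:E * ((1 + d) * V + (1 + d^-1) * d ^+ 2)%:E + (1 + d^-1)%:E * (d ^+ 2)%:E)%E); last by rewrite -!EFinM -EFinD.
  apply: leeD; last by rewrite lee_wpmul2l ?lee_fin.
  rewrite lee_wpmul2l ?lee_fin// uv.
  apply: le_trans (csqn_young d0 (mv_ n) mv) _.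
  apply: (@le_trans _ _ ((1 + d)%:E * V%:E + (1 + d^-1)%:E * (d ^+ 2)%:E)%E); last by rewrite -!EFinM -EFinD.
  by rewrite VE leeD// lee_wpmul2l ?lee_fin.
rewrite VE; apply/lee_addgt0Pr => e e0; rewrite -EFinD.
(* With [d <= 1] all powers of [d] are bounded by [d], and the excess over [V] is at most
   [d (3 V + 6)]. *)
pose d := Num.min 1 (e / (3 * V + 6)).
have q0 : 0 < 3 * V + 6 by lra.
have d0 : 0 < d by rewrite lt_min ltr01 divr_gt0.
have d1 : d <= 1 by rewrite ge_min lexx.
have d2 : d * (3 * V + 6) <= e by rewrite -ler_pdivlMr// ge_min lexx orbT.
apply: le_trans (H d d0) _; rewrite lee_fin.
rewrite (_ : (1 + d^-1) * d ^+ 2 = d ^+ 2 + d); last by field; rewrite gt_eqF.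
have dd : d ^+ 2 <= d by rewrite expr2 ler_piMl// ltW.
have h3 : 0 <= d ^+ 2 by exact: sqr_ge0.
have h4 : d ^+ 2 * V <= d * V by rewrite ler_wpM2r.
have h5 : d * d ^+ 2 <= d by rewrite ler_piMr ?(le_trans dd)// ltW.
rewrite (_ : (1 + d) * _ + _ = V + 2 * (d * V) + d ^+ 2 * V + 2 * d + 3 * d ^+ 2 + d * d ^+ 2); last by ring.
have : d * (3 * V + 6) = 3 * (d * V) + 6 * d by ring.
lra.
Qed.

Lemma csqn_limit (u_ v_ : nat -> R * R -> R[i]) u v : (forall n, cmeasurable setT (u_ n)) ->
  (forall n, cmeasurable setT (v_ n)) -> cmeasurable setT u -> cmeasurable setT v ->
  (csqn u < +oo)%E -> (csqn v < +oo)%E -> (forall n, csqn (u_ n) = csqn (v_ n)) ->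
  vanishing (fun n => csqn (fun x => u_ n x - u x)) -> vanishing (fun n => csqn (fun x => v_ n x - v x)) ->
  csqn u = csqn v.
Proof.
move=> mu_ mv_ mu mv iu iv uv hu hv; apply/eqP; rewrite eq_le; apply/andP; split.
  exact: csqn_limit_le mu_ mv_ mu mv iv uv hu hv.
by apply: csqn_limit_le mv_ mu_ mv mu iu _ hv hu => n; rewrite uv.
Qed.

End complex_L2.

(** * Plancherel's identity for complex functions in [L^1] and [L^2] *)

Section fourier_L1.
Context {R : realType}.
Local Notation leb2 := (@leb2 R).
Local Notation Re := (@complex.Re R).
Local Notation Im := (@complex.Im R).
Implicit Types f g phi : R * R -> R[i].
Implicit Types a b : R * R -> R.

Lemma in_L1_parts f : in_L1 f -> L1 (Re \o f) /\ L1 (Im \o f).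
Proof.
move=> [[mr mi] i1].
have h (z : R[i]) : `|Re z| <= Normc.normc z /\ `|Im z| <= Normc.normc z.
  case: z => p q /=; split; rewrite -sqrtr_sqr ler_sqrt ?lerDl ?lerDr ?addr_ge0 ?sqr_ge0//.
split; split => //; apply: le_lt_trans i1; apply: le_intR => x //=; by case: (h (f x)).
Qed.

Lemma L1_add a b : L1 a -> L1 b -> L1 (fun x => a x + b x).
Proof.
move=> [ma ia] [mb ib]; split; first by meas.
apply: (@le_lt_trans _ _ (\int[leb2]_x (`|a x| + `|b x|)%:E)%E).
  by apply: le_intR => x //; exact: ler_normD.
rewrite intRD//; [|by meas|by meas].
exact: lte_add_pinfty.
Qed.

Lemma parts_in_L1 f : L1 (Re \o f) -> L1 (Im \o f) -> in_L1 f.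
Proof.
move=> [mr ir] [mi ii]; split; first by split.
apply: (@le_lt_trans _ _ (\int[leb2]_x (`|Re (f x)| + `|Im (f x)|)%:E)%E).
  apply: le_intR => x; first by case: (f x) => p q /=; exact: sqrtr_ge0.
  case: (f x) => p q /=; rewrite -[leRHS]ger0_norm ?addr_ge0// -sqrtr_sqr ler_sqrt ?sqr_ge0//.
  rewrite sqrrD !real_normK ?num_real// lerD2r lerDl mulrn_wge0// mulr_ge0//.
rewrite intRD//; [exact: lte_add_pinfty|exact: (mf_norm mr)|exact: (mf_norm mi)].
Qed.

Lemma fourier_integralE phi k : in_L1 phi ->
  fourier_integral phi k =
   ((2 * pi)^-1 * (cosT (Re \o phi) k + sinT (Im \o phi) k)) +i*
   ((2 * pi)^-1 * (cosT (Im \o phi) k - sinT (Re \o phi) k)).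
Proof.
move=> /in_L1_parts[La Lb]; rewrite /fourier_integral /cintegral.
have LCa := L1_integrable (L1_cos k La); have LSa := L1_integrable (L1_sin k La).
have LCb := L1_integrable (L1_cos k Lb); have LSb := L1_integrable (L1_sin k Lb).
rewrite -/leb2.
have -> : Rintegral leb2 setT (Re \o (fun x => cis (- (k.1 * x.1 + k.2 * x.2)) * phi x)) =
    cosT (Re \o phi) k + sinT (Im \o phi) k.
  rewrite /cosT /sinT -RintegralD//; apply: eq_Rintegral => x _ /=.
  by rewrite /cis cosN sinN /pdot; case: (phi x) => p q /=; ring.
have -> : Rintegral leb2 setT (Im \o (fun x => cis (- (k.1 * x.1 + k.2 * x.2)) * phi x)) =
    cosT (Im \o phi) k - sinT (Re \o phi) k.
  rewrite /cosT /sinT -RintegralB//; apply: eq_Rintegral => x _ /=.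
  by rewrite /cis cosN sinN /pdot; case: (phi x) => p q /=; ring.
by apply/eqP; rewrite eq_complex /=; apply/andP; split; apply/eqP; ring.
Qed.

Lemma two_pi_cancel : 2 * (2 * pi)^-1 ^+ 2 * (2 * pi) ^+ 2 = 2 :> R.
Proof.
by rewrite -mulrA -exprMn mulVf ?expr1n ?mulr1// gt_eqF// mulr_gt0// pi_gt0.
Qed.

Lemma mul2e_inj (x y : \bar R) : (2%:E * x = 2%:E * y)%E -> x = y.
Proof.
move=> E; apply/eqP; rewrite eq_le -(@lee_pmul2l _ 2%:E)// -[X in _ && X](@lee_pmul2l _ 2%:E)//.
by rewrite E lexx.
Qed.

Lemma cosTN a k : cosT a (- k.1, - k.2) = cosT a k.
Proof.
apply: eq_Rintegral => x _; congr (_ * _); rewrite -cosN; congr cos; rewrite /pdot/=; ring.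
Qed.

Lemma sinTN a k : L1 a -> sinT a (- k.1, - k.2) = - sinT a k.
Proof.
move=> La; rewrite -[RHS]mulN1r /sinT -RintegralZl//; last exact: L1_integrable (L1_sin k La).
apply: eq_Rintegral => x _; rewrite (_ : pdot (- k.1, - k.2) x = - pdot k x); last by rewrite /pdot/=; ring.
by rewrite sinN; ring.
Qed.

Lemma measurable_fourier_integral phi : in_L1 phi -> cmeasurable setT (fourier_integral phi).
Proof.
move=> L; have [[ma ia] [mb ib]] := in_L1_parts L.
have m1 := measurable_cosT ma; have m2 := measurable_cosT mb.
have m3 := measurable_sinT ma; have m4 := measurable_sinT mb.
split.
  rewrite (_ : _ \o _ = (fun k => (2 * pi)^-1 * (cosT (Re \o phi) k + sinT (Im \o phi) k))); first by meas.
  by apply/funext => k; rewrite /comp fourier_integralE.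
rewrite (_ : _ \o _ = (fun k => (2 * pi)^-1 * (cosT (Im \o phi) k - sinT (Re \o phi) k))); first by meas.
by apply/funext => k; rewrite /comp fourier_integralE.
Qed.

(** The squared modulus at [k] contains products of transforms of the real and imaginary parts. They
    change sign under [k -> -k], because [sinT] is odd and [cosT] even; adding the reflected
    integral cancels them and leaves the real case for both parts. *)
Lemma plancherel_L1 phi : in_L1 phi -> in_L2 setT phi -> csqn (fourier_integral phi) = csqn phi.
Proof.
move=> L /in_L2E[_ i2]; have [La Lb] := in_L1_parts L.
have [ma _] := La; have [mb _] := Lb.
have m1 := measurable_cosT ma; have m2 := measurable_cosT mb.
have m3 := measurable_sinT ma; have m4 := measurable_sinT mb.
have ia : (sqn (Re \o phi) < +oo)%E by apply: le_lt_trans i2; rewrite leeDl ?sqn_ge0.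
have ib : (sqn (Im \o phi) < +oo)%E by apply: le_lt_trans i2; rewrite leeDr ?sqn_ge0.
set a := Re \o phi in ma ia La m1 m3 *; set b := Im \o phi in mb ib Lb m2 m4 *.
pose c : R := (2 * pi)^-1.
have c0 : 0 < c by rewrite invr_gt0 mulr_gt0// pi_gt0.
pose h (k : R * R) := (c * (cosT a k + sinT b k)) ^+ 2 + (c * (cosT b k - sinT a k)) ^+ 2.
have h0 k : 0 <= h k by rewrite addr_ge0 ?sqr_ge0.
have mh : measurable_fun setT h by rewrite /h; meas.
have -> : csqn (fourier_integral phi) = (\int[leb2]_k (h k)%:E)%E.
  rewrite -int_normc2; last exact: measurable_fourier_integral.
  by apply: eq_integral => k _; rewrite normc_sqr fourier_integralE.
have E1 : (\int[leb2]_k (h (- k.1, - k.2)%R)%:E = \int[leb2]_k (h k)%:E)%E.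
  apply: (int_opp2 (f := fun k => (h k)%:E)); first by meas.
  by move=> k; rewrite lee_fin.
have E2 : (\int[leb2]_k (h k)%:E + \int[leb2]_k (h (- k.1, - k.2)%R)%:E = 2%:E * csqn phi)%E.
  rewrite -intRD; [|exact: mh|by apply: (mf_comp mh); meas|exact: h0|by move=> k; exact: h0].
  pose s (k : R * R) := (cosT a k) ^+ 2 + (sinT a k) ^+ 2 + ((cosT b k) ^+ 2 + (sinT b k) ^+ 2).
  transitivity (\int[leb2]_k (2 * c ^+ 2 * s k)%:E)%E.
    apply: eq_integral => k _; congr (_%:E); rewrite /h /s !cosTN (sinTN _ La) (sinTN _ Lb); ring.
  rewrite intRZ; [|by rewrite /s; meas|by rewrite mulr_ge0 ?sqr_ge0|by move=> k; rewrite /s !addr_ge0 ?sqr_ge0].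
  rewrite /s intRD; [|by meas|by meas|by move=> k; rewrite !addr_ge0 ?sqr_ge0|by move=> k; rewrite !addr_ge0 ?sqr_ge0].
  rewrite intRD; [|by meas|by meas|by move=> k; exact: sqr_ge0|by move=> k; exact: sqr_ge0].
  rewrite intRD; [|by meas|by meas|by move=> k; exact: sqr_ge0|by move=> k; exact: sqr_ge0].
  rewrite -/(sqn (cosT a)) -/(sqn (cosT b)) -/(sqn (sinT a)) -/(sqn (sinT b)).
  rewrite (plancherel_real La ia) (plancherel_real Lb ib).
  rewrite -(ge0_muleDr _ (sqn_ge0 _) (sqn_ge0 _)) -/(csqn phi) muleA -EFinM.
  by congr (_%:E * _)%E; exact: two_pi_cancel.
move: E2; rewrite E1 => E2.
have : (2%:E * \int[leb2]_k (h k)%:E = 2%:E * csqn phi)%E.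
  rewrite -E2 -[X in (_ = X + _)%E]mul1e -[X in (_ = _ + X)%E]mul1e -ge0_muleDl//.
exact: mul2e_inj.
Qed.

End fourier_L1.

(** * Differences and their Fourier multipliers *)

Section fourier_translation.
Context {R : realType}.
Local Notation leb2 := (@leb2 R).
Local Notation Re := (@complex.Re R).
Local Notation Im := (@complex.Im R).
Implicit Types f g phi : R * R -> R[i].
Implicit Types a b : R * R -> R.

Lemma Rint_shift (c : R * R) a : measurable_fun setT a ->
  Rintegral leb2 setT (tr c a) = Rintegral leb2 setT a.
Proof.
move=> ma; rewrite /Rintegral; congr fine.
have mE : measurable_fun setT (EFin \o a) by exact/measurable_EFinP.
rewrite [LHS]integralE [RHS]integralE.
rewrite -(int_shift2 c (f := (EFin \o a)^\+%E)); last 2 first.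
- exact: measurable_funepos.
- by move=> x; exact: funepos_ge0.
rewrite -(int_shift2 c (f := (EFin \o a)^\-%E)); last 2 first.
- exact: measurable_funeneg.
- by move=> x; exact: funeneg_ge0.
by congr (_ - _)%E; apply: eq_integral => x _; rewrite ?funeposE ?funenegE.
Qed.

Lemma L1_tr c a : L1 a -> L1 (tr c a).
Proof.
move=> [ma ia]; split; first exact: measurable_tr.
rewrite /tr (int_shift2 c (f := fun x => (`|a x|)%:E))//.
by meas.
Qed.

Lemma L1Z (r : R) a : L1 a -> L1 (fun x => r * a x).
Proof.
move=> [ma ia]; split; first by meas.
under eq_integral do rewrite normrM.
by rewrite intRZ//; [rewrite lte_mul_pinfty|meas].
Qed.

Lemma cosT_tr c a k : L1 a ->
  cosT (tr c a) k = cos (pdot k c) * cosT a k + sin (pdot k c) * sinT a k.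
Proof.
move=> La; have [ma _] := La.
have LC := L1_integrable (L1_cos k La); have LS := L1_integrable (L1_sin k La).
rewrite /cosT /sinT -!RintegralZl// -RintegralD//; last 2 first.
- exact: L1_integrable (L1Z _ (L1_cos k La)).
- exact: L1_integrable (L1Z _ (L1_sin k La)).
rewrite -[RHS](Rint_shift c); last by rewrite /pdot; meas.
apply: eq_Rintegral => x _; rewrite /tr.
rewrite (_ : pdot k x = pdot k (x.1 + c.1, x.2 + c.2) - pdot k c); last by rewrite /pdot/=; ring.
rewrite cosB; ring.
Qed.

Lemma sinT_tr c a k : L1 a ->
  sinT (tr c a) k = cos (pdot k c) * sinT a k - sin (pdot k c) * cosT a k.
Proof.
move=> La; have [ma _] := La.
have LC := L1_integrable (L1_cos k La); have LS := L1_integrable (L1_sin k La).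
rewrite /cosT /sinT -!RintegralZl// -RintegralB//; last 2 first.
- exact: L1_integrable (L1Z _ (L1_sin k La)).
- exact: L1_integrable (L1Z _ (L1_cos k La)).
rewrite -[RHS](Rint_shift c); last by rewrite /pdot; meas.
apply: eq_Rintegral => x _; rewrite /tr.
rewrite (_ : pdot k x = pdot k (x.1 + c.1, x.2 + c.2) - pdot k c); last by rewrite /pdot/=; ring.
rewrite sinB; ring.
Qed.

Lemma cosTB a b k : L1 a -> L1 b -> cosT (fun x => a x - b x) k = cosT a k - cosT b k.
Proof.
move=> La Lb; rewrite /cosT -RintegralB//; last 2 first.
- exact: L1_integrable (L1_cos k La).
- exact: L1_integrable (L1_cos k Lb).
by apply: eq_Rintegral => x _; rewrite mulrBr.
Qed.

Lemma sinTB a b k : L1 a -> L1 b -> sinT (fun x => a x - b x) k = sinT a k - sinT b k.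
Proof.
move=> La Lb; rewrite /sinT -RintegralB//; last 2 first.
- exact: L1_integrable (L1_sin k La).
- exact: L1_integrable (L1_sin k Lb).
by apply: eq_Rintegral => x _; rewrite mulrBr.
Qed.

Lemma L1B a b : L1 a -> L1 b -> L1 (fun x => a x - b x).
Proof.
move=> La [mb ib]; apply: (L1_add La); split; first by meas.
by under eq_integral do rewrite normrN.
Qed.

Definition cdiff (c : R * R) f : R * R -> R[i] := fun x => f (x.1 + c.1, x.2 + c.2) - f x.

Lemma Re_cdiff c f : Re \o cdiff c f = fun x => tr c (Re \o f) x - (Re \o f) x.
Proof. by apply/funext => x; rewrite /cdiff /tr /=; case: (f x); case: (f (_, _)). Qed.
Lemma Im_cdiff c f : Im \o cdiff c f = fun x => tr c (Im \o f) x - (Im \o f) x.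
Proof. by apply/funext => x; rewrite /cdiff /tr /=; case: (f x); case: (f (_, _)). Qed.

Lemma cmeasurable_cdiff c f : cmeasurable setT f -> cmeasurable setT (cdiff c f).
Proof.
move=> [mr mi]; split; rewrite ?Re_cdiff ?Im_cdiff.
  by have m1 := measurable_tr c mr; apply: (mfB m1 mr).
by have m1 := measurable_tr c mi; apply: (mfB m1 mi).
Qed.

Lemma csqn_cdiff_le c f : cmeasurable setT f -> (csqn (cdiff c f) <= 4%:E * csqn f)%E.
Proof.
move=> [mr mi]; rewrite /csqn Re_cdiff Im_cdiff ge0_muleDr ?sqn_ge0//.
by apply: leeD; exact: sqn_tr_bound.
Qed.

Lemma in_L1_cdiff c f : in_L1 f -> in_L1 (cdiff c f).
Proof.
move=> /in_L1_parts[Lr Li]; apply: parts_in_L1; rewrite ?Re_cdiff ?Im_cdiff.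
  by apply: L1B => //; exact: L1_tr.
by apply: L1B => //; exact: L1_tr.
Qed.

Lemma in_L2_cdiff c f : in_L2 setT f -> in_L2 setT (cdiff c f).
Proof.
move=> /in_L2E[mf i2]; apply/in_L2E; split; first exact: cmeasurable_cdiff.
by apply: le_lt_trans (csqn_cdiff_le c mf) _; rewrite lte_mul_pinfty.
Qed.

Lemma fourier_integral_cdiff c phi k : in_L1 phi ->
  fourier_integral (cdiff c phi) k = (cis (pdot k c) - 1) * fourier_integral phi k.
Proof.
move=> L; have [Lr Li] := in_L1_parts L.
rewrite fourier_integralE; last exact: in_L1_cdiff.
have Lrt := L1_tr c Lr; have Lit := L1_tr c Li.
rewrite (fourier_integralE k L) Re_cdiff Im_cdiff !cosTB// !sinTB// !cosT_tr// !sinT_tr//.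
by apply/eqP; rewrite eq_complex /=; apply/andP; split; apply/eqP; ring.
Qed.

(** The multiplier [exp (i k.c) - 1] by which the difference operator [cdiff c] acts on
    transforms. *)
Definition symbol (c : R * R) g : R * R -> R[i] := fun k => (cis (pdot k c) - 1) * g k.

Lemma normc_symbol c g k : Normc.normc (symbol c g k) ^+ 2 =
  (2 - 2 * cos (pdot k c)) * Normc.normc (g k) ^+ 2.
Proof.
rewrite !normc_sqr /symbol; case: (g k) => p q /=.
have := cos2Dsin2 (pdot k c); set C := cos _; set S := sin _ => h.
transitivity ((C ^+ 2 + S ^+ 2 + 1 - 2 * C) * (p ^+ 2 + q ^+ 2)); first by ring.
by rewrite h; ring.
Qed.

Lemma cmeasurable_symbol c g : cmeasurable setT g -> cmeasurable setT (symbol c g).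
Proof.
move=> [mr mi]; split.
  rewrite (_ : _ \o _ = (fun k => (cos (pdot k c) - 1) * (Re \o g) k - sin (pdot k c) * (Im \o g) k)).
    by rewrite /pdot; meas.
  by apply/funext => k; rewrite /symbol/=; case: (g k) => p q /=; ring.
rewrite (_ : _ \o _ = (fun k => (cos (pdot k c) - 1) * (Im \o g) k + sin (pdot k c) * (Re \o g) k)).
  by rewrite /pdot; meas.
by apply/funext => k; rewrite /symbol/=; case: (g k) => p q /=; ring.
Qed.

Lemma csqn_symbol c g : cmeasurable setT g ->
  csqn (symbol c g) = (\int[leb2]_k ((2 - 2 * cos (pdot k c)) * Normc.normc (g k) ^+ 2)%:E)%E.
Proof.
move=> mg; rewrite -int_normc2; last exact: cmeasurable_symbol.
by apply: eq_integral => k _; rewrite normc_symbol.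
Qed.

Lemma measurable_normc2 g : cmeasurable setT g -> measurable_fun setT (fun k => Normc.normc (g k) ^+ 2).
Proof.
move=> [mr mi]; under eq_fun do rewrite normc_sqr.
exact: (mfD (mfX 2 mr) (mfX 2 mi)).
Qed.

Lemma csqn_symbol_le c g : cmeasurable setT g -> (csqn (symbol c g) <= 4%:E * csqn g)%E.
Proof.
move=> mg; rewrite csqn_symbol// -int_normc2// -intRZ//; last 2 first.
- exact: measurable_normc2.
- by move=> k; exact: sqr_ge0.
have h k : 0 <= 2 - 2 * cos (pdot k c) <= 4.
  by have := cos_geN1 (pdot k c); have := cos_le1 (pdot k c) => h1 h2; apply/andP; split; lra.
apply: le_intR => k; have /andP[h1 h2] := h k; first by rewrite mulr_ge0 ?sqr_ge0.
by rewrite ler_wpM2r ?sqr_ge0.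
Qed.

(** Plancherel's identity passes to the limit along the approximating sequence contained in
    [is_fourier]. *)
Lemma fourier_isometry phi g : is_fourier phi g -> csqn g = csqn phi.
Proof.
move=> [/in_L2E[mp ip] [/in_L2E[mg ig] [phi_ [h /L2norm_cvg0 h1 /L2norm_cvg0 h2]]]].
have m1 n : cmeasurable setT (phi_ n) by have [_ /in_L2E[]] := h n.
have m2 n : cmeasurable setT (fourier_integral (phi_ n)) by apply: measurable_fourier_integral; case: (h n).
apply: (@csqn_limit _ (fun n => fourier_integral (phi_ n)) phi_) => //.
- by move=> n; apply: plancherel_L1; case: (h n).
- by apply: h2 => n; exact: cmeasurableB.
- by apply: h1 => n; exact: cmeasurableB.
Qed.

(** Differences and multiplication by the symbol both increase squared [L^2] norms at most fourfold,
    so they carry an approximating sequence for [phi] and [g] to one for the new pair. *)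
Lemma is_fourier_cdiff c phi g : is_fourier phi g -> is_fourier (cdiff c phi) (symbol c g).
Proof.
move=> [lp [lg [phi_ [h /L2norm_cvg0 h1 /L2norm_cvg0 h2]]]].
have /in_L2E[mp ip] := lp; have /in_L2E[mg ig] := lg.
have m1 n : cmeasurable setT (phi_ n) by have [_ /in_L2E[]] := h n.
have m2 n : cmeasurable setT (fourier_integral (phi_ n)) by apply: measurable_fourier_integral; case: (h n).
split; first exact: in_L2_cdiff.
split.
  apply/in_L2E; split; first exact: cmeasurable_symbol.
  by apply: le_lt_trans (csqn_symbol_le c mg) _; rewrite lte_mul_pinfty.
have md n : cmeasurable setT (fun x => phi_ n x - phi x) by exact: cmeasurableB.
have mf n : cmeasurable setT (fun k => fourier_integral (phi_ n) k - g k) by exact: cmeasurableB.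
exists (fun n => cdiff c (phi_ n)); split.
- by move=> n; have [H1 H2] := h n; split; [exact: in_L1_cdiff|exact: in_L2_cdiff].
- have E n : (fun x => cdiff c (phi_ n) x - cdiff c phi x) = cdiff c (fun x => phi_ n x - phi x).
    by apply/funext => x; rewrite /cdiff; ring.
  apply/L2norm_cvg0 => [n|]; first by rewrite E; exact: cmeasurable_cdiff.
  have := vanishingZ (ler0n R 4) (h1 md); apply: vanishing_le => n.
  by rewrite E; exact: csqn_cdiff_le.
have E n : (fun k => fourier_integral (cdiff c (phi_ n)) k - symbol c g k) = symbol c (fun k => fourier_integral (phi_ n) k - g k).
  apply/funext => k; rewrite fourier_integral_cdiff /symbol; last by case: (h n).
  by ring.
apply/L2norm_cvg0 => [n|]; first by rewrite E; exact: cmeasurable_symbol.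
have := vanishingZ (ler0n R 4) (h2 mf); apply: vanishing_le => n.
by rewrite E; exact: csqn_symbol_le.
Qed.

Lemma fourier_difference c phi g : is_fourier phi g ->
  csqn (cdiff c phi) = (\int[leb2]_k ((2 - 2 * cos (pdot k c)) * Normc.normc (g k) ^+ 2)%:E)%E.
Proof.
move=> F; rewrite -(fourier_isometry (is_fourier_cdiff c F)).
by case: F => _ [/in_L2E[mg _] _]; exact: csqn_symbol.
Qed.

End fourier_translation.

(** * Completeness of [L^2] *)

Section riesz_fischer.
Context {R : realType}.
Local Notation leb2 := (@leb2 R).

(** The sequences [f n - 2 c 2^-n] and [f n + 2 c 2^-n] are monotone in opposite directions and
    enclose the limit, which gives the rate as well. *)
Lemma geometric_limit (f : nat -> R) (c : R) : 0 <= c ->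
  (forall n, `|f n.+1 - f n| <= c * 2^-1 ^+ n) ->
  exists l : R, f n @[n --> \oo] --> l /\ forall n, `|f n - l| <= 2 * c * 2^-1 ^+ n.
Proof.
move=> c0 hf; pose w n := f n - 2 * c * 2^-1 ^+ n; pose u n := f n + 2 * c * 2^-1 ^+ n.
have half n : 2 * c * 2^-1 ^+ n.+1 = c * 2^-1 ^+ n by rewrite exprS; field.
have ndw : nondecreasing_seq w.
  apply/nondecreasing_seqP => n; rewrite /w half.
  have := hf n; rewrite ler_norml => /andP[h _]; have := half n; rewrite exprS => _.
  rewrite (_ : 2 * c * 2^-1 ^+ n = c * 2^-1 ^+ n + c * 2^-1 ^+ n); last by ring.
  lra.
have niu : nonincreasing_seq u.
  apply/nonincreasing_seqP => n; rewrite /u half.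
  have := hf n; rewrite ler_norml => /andP[_ h].
  rewrite (_ : 2 * c * 2^-1 ^+ n = c * 2^-1 ^+ n + c * 2^-1 ^+ n); last by ring.
  lra.
have p0 n : 0 <= 2 * c * 2^-1 ^+ n by rewrite !mulr_ge0// exprn_ge0// invr_ge0.
have wu n m : w n <= u m.
  apply: (@le_trans _ _ (w (maxn n m))); first exact/ndw/leq_maxl.
  apply: (@le_trans _ _ (u (maxn n m))); last exact/niu/leq_maxr.
  by rewrite /w /u; have := p0 (maxn n m); lra.
have cw : cvgn w.
  apply: nondecreasing_is_cvgn => //; exists (u 0%N) => _ [n _ <-]; exact: wu.
exists (limn w).
have b n : `|f n - limn w| <= 2 * c * 2^-1 ^+ n.
  have h1 : w n <= limn w by exact: nondecreasing_cvgn_le.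
  have h2 : limn w <= u n by apply: limr_le => //; near=> m; exact: wu.
  by rewrite ler_norml; move: h1 h2; rewrite /w /u => h1 h2; apply/andP; split; lra.
split => //.
have g0 : 2 * c * 2^-1 ^+ n @[n --> \oo] --> (0 : R).
  rewrite -[X in _ --> X](mulr0 (2 * c)); apply: cvgM; first exact: cvg_cst.
  by apply: cvg_expr; rewrite ger0_norm ?invr_ge0// invf_lt1// ltr1n.
apply/cvgrPdist_le => e e0; near=> n.
rewrite distrC; apply: le_trans (b n) _.
rewrite -[leLHS]ger0_norm// -normrN -sub0r.
by near: n; move/cvgrPdist_le : g0 => /(_ e e0).
Unshelve. all: by end_near. Qed.

(** The weights [4^n] against the errors [8^-n] make [S], the sum of [4^n (f (n+1) - f n)^2],
    integrable. Where [S] is finite the increments are at most [sqrt S 2^-n], so the sequence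
    converges geometrically with squared error [4 4^-n S], which is then integrated. *)
Lemma L2_complete (f : nat -> R * R -> R) : (forall n, measurable_fun setT (f n)) ->
  (forall n, sqn (fun x => f n.+1 x - f n x)%R <= (8^-1 ^+ n)%:E)%E ->
  exists g : R * R -> R, measurable_fun setT g /\ vanishing (fun n => sqn (fun x => f n x - g x)%R).
Proof.
move=> mf hf.
pose d n (x : R * R) := (4 ^+ n * (f n.+1 x - f n x) ^+ 2)%:E.
have d0 n x : (0 <= d n x)%E by rewrite lee_fin mulr_ge0 ?sqr_ge0 ?exprn_ge0.
have md n : measurable_fun setT (d n) by have m1 := mf n; have m2 := mf n.+1; rewrite /d; meas.
pose S (x : R * R) := (\sum_(0 <= n <oo) d n x)%E.
have S0 x : (0 <= S x)%E by apply: nneseries_ge0.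
have mS : measurable_fun setT S by apply: ge0_emeasurable_sum.
have iS : (\int[leb2]_x S x <= 2%:E)%E.
  rewrite /S integral_nneseries//.
  apply: (@le_trans _ _ (\sum_(0 <= n <oo) (2^-1 ^+ n)%:E)%E).
    apply: lee_nneseries; [by move=> n *; apply: integral_ge0|move=> n *].
    have m1 := mf n; have m2 := mf n.+1.
    rewrite /d intRZ ?exprn_ge0//; [|by meas|by move=> x; exact: sqr_ge0].
    apply: (@le_trans _ _ ((4 ^+ n)%:E * (8^-1 ^+ n)%:E)%E).
      by rewrite lee_wpmul2l ?lee_fin ?exprn_ge0// hf.
    by rewrite -EFinM lee_fin -exprMn (_ : 4 / 8 = 2^-1 :> R)//; field.
  apply: lime_le; first by apply: is_cvg_nneseries => n _ _; rewrite lee_fin exprn_ge0// invr_ge0.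
  near=> n; rewrite sumEFin lee_fin.
  have -> N : \sum_(0 <= i < N) 2^-1 ^+ i = 2 - 2 * 2^-1 ^+ N :> R.
    elim: N => [|N IH]; first by rewrite big_geq// expr0; lra.
    by rewrite big_nat_recr//= IH exprS; lra.
  by rewrite gerBl mulr_ge0// exprn_ge0// invr_ge0.
have dS n x : (d n x <= S x)%E.
  rewrite /S; apply: le_trans (nneseries_lim_ge n.+1 _) => //.
  by rewrite big_nat_recr//= leeDr// sume_ge0.
(* Where [S] is infinite the sequence is replaced by 0: the limit is then defined and measurable
   everywhere, and the error bound is trivial at those points. *)
pose h n x := if (S x < +oo)%E then f n x else 0.
have mh n : measurable_fun setT (h n).
  apply: measurable_fun_ifT; [|exact: mf|exact: measurable_cst].
  by apply: measurable_fun_lte => //; exact: measurable_cst.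
have lim x : (S x < +oo)%E -> exists l : R, f n x @[n --> \oo] --> l /\
    forall n, (((f n x - l) ^+ 2)%:E <= (4 * 4^-1 ^+ n)%:E * S x)%E.
  move=> Sx; pose s := fine (S x).
  have SE : S x = s%:E by rewrite fineK// ge0_fin_numE.
  have s0 : 0 <= s by rewrite fine_ge0.
  have [|l [fl hl]] := @geometric_limit (f ^~ x) (Num.sqrt s) (sqrtr_ge0 _).
    move=> n; have := dS n x; rewrite SE /d lee_fin => h1.
    rewrite -sqrtr_sqr -[2^-1 ^+ n]ger0_norm ?exprn_ge0 ?invr_ge0// -sqrtr_sqr -sqrtrM// ler_sqrt ?mulr_ge0 ?sqr_ge0//.
    rewrite -exprM mulnC exprM (_ : 2^-1 ^+ 2 = 4^-1 :> R); last by field.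
    by rewrite exprVn ler_pdivlMr ?exprn_gt0// mulrC.
  exists l; split => // n; rewrite SE -EFinM lee_fin.
  rewrite -real_normK ?num_real//; apply: le_trans (_ : (2 * Num.sqrt s * 2^-1 ^+ n) ^+ 2 <= _).
    by rewrite lerXn2r ?nnegrE// ?mulr_ge0 ?sqrtr_ge0 ?exprn_ge0 ?invr_ge0.
  rewrite !exprMn sqr_sqrtr// -[(_ ^+ n) ^+ 2]exprM mulnC exprM (_ : 2^-1 ^+ 2 = 4^-1 :> R); last by field.
  by rewrite le_eqVlt; apply/orP; left; apply/eqP; ring.
have limh x : exists l : R, h n x @[n --> \oo] --> l /\
    forall n, (((f n x - l) ^+ 2)%:E <= (4 * 4^-1 ^+ n)%:E * S x)%E.
  have [Sx|] := boolP (S x < +oo)%E.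
    have [l hl] := lim x Sx; exists l; rewrite (_ : h ^~ x = f ^~ x)//.
    by apply/funext => n; rewrite /h Sx.
  rewrite -leNgt leye_eq => /eqP Sx; exists 0; split.
    rewrite (_ : h ^~ x = fun=> 0); first exact: cvg_cst.
    by apply/funext => n; rewrite /h Sx ltxx.
  by move=> n; rewrite Sx gt0_muley ?leey// lte_fin mulr_gt0// exprn_gt0// invr_gt0.
have [g hg] := choice limh.
have mg : measurable_fun setT g by apply: (measurable_fun_cvg mh) => x _; case: (hg x).
exists g; split => // e e0.
have b n : (sqn (fun x => f n x - g x)%R <= (8 * 4^-1 ^+ n)%:E)%E.
  apply: (@le_trans _ _ (\int[leb2]_x ((4 * 4^-1 ^+ n)%:E * S x))%E).
    apply: le_int => x; first by rewrite lee_fin sqr_ge0.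
    by case: (hg x).
  rewrite ge0_integralZl_EFin//.
  apply: (@le_trans _ _ ((4 * 4^-1 ^+ n)%:E * 2%:E)%E).
    by rewrite lee_wpmul2l// lee_fin mulr_ge0// exprn_ge0// invr_ge0.
  by rewrite -EFinM lee_fin mulrAC (_ : 4 * 2 = 8)//; ring.
have : vanishing (fun n => (8 * 4^-1 ^+ n : R)%:E).
  apply: vanishingN => [n|]; first by rewrite mulr_ge0// exprn_ge0// invr_ge0.
  rewrite -[X in _ --> X](mulr0 8); apply: cvgM; first exact: cvg_cst.
  by apply: cvg_expr; rewrite ger0_norm ?invr_ge0// invf_lt1// ltr1n.
move=> /(_ e e0)[N hN]; exists N => n Nn; exact: le_trans (b n) (hN n Nn).
Unshelve. all: by end_near. Qed.

End riesz_fischer.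

(** * Existence of the Fourier transform on [L^2] *)

Section fourier_exists.
Context {R : realType}.
Local Notation mu := (@lebesgue_measure R).
Local Notation leb2 := (@leb2 R).
Local Notation Re := (@complex.Re R).
Local Notation Im := (@complex.Im R).
Implicit Types f g phi : R * R -> R[i].

Definition in_box (n : nat) (x : R * R) : bool := (`|x.1| <= n%:R) && (`|x.2| <= n%:R).
Definition trunc (n : nat) phi : R * R -> R[i] := fun x => if in_box n x then phi x else 0.

Lemma Re_trunc n f : Re \o trunc n f = fun x => if in_box n x then (Re \o f) x else 0.
Proof. by apply/funext => x /=; rewrite /trunc; case: ifP. Qed.
Lemma Im_trunc n f : Im \o trunc n f = fun x => if in_box n x then (Im \o f) x else 0.
Proof. by apply/funext => x /=; rewrite /trunc; case: ifP. Qed.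

Lemma measurable_in_box n : measurable_fun setT (in_box n).
Proof. by rewrite /in_box; meas. Qed.

Lemma box_integral n : (\int[leb2]_x (if in_box n x then 1 else 0)%:E < +oo)%E.
Proof.
pose I (t : R) : R := if `|t| <= n%:R then 1 else 0.
have mI : measurable_fun setT I by rewrite /I; meas.
have I0 t : 0 <= I t by rewrite /I; case: ifP.
have iI : (\int[mu]_t (I t)%:E < +oo)%E.
  have -> : (\int[mu]_t (I t)%:E = \int[mu]_t (\1_(`[- n%:R, n%:R]%classic : set R) t)%:E)%E.
    apply: eq_integral => t _; rewrite /I indicE ler_norml; case: ifPn => h.
      by rewrite mem_set//= in_itv.
    by rewrite memNset//= in_itv/=; exact/negP.
  have -> : (\int[mu]_x (\1_(`[- n%:R, n%:R]%classic%R : set R) x)%:E = mu `[- n%:R, n%:R]%classic%R)%E.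
    by rewrite integral_indic ?setIT//; exact: measurable_itv.
  by rewrite lebesgue_measure_itv/=; case: ifPn => _; rewrite -?EFinB ltry.
have -> : (\int[leb2]_x (if in_box n x then 1 else 0)%:E = \int[leb2]_x (I x.1 * I x.2)%:E)%E.
  by apply: eq_integral => x _; rewrite /in_box /I; case: ifP => //= h; [case/andP: h => -> ->; rewrite mulr1|case: ifP h => //=; rewrite ?mul0r// => _ ->; rewrite mulr0].
rewrite tonelli2F; [|by meas|by move=> x; rewrite lee_fin mulr_ge0].
have iE : (\int[mu]_t (I t)%:E = (fine (\int[mu]_t (I t)%:E))%:E)%E.
  by rewrite fineK// ge0_fin_numE// intR_ge0.
have -> : (\int[mu]_x \int[mu]_y (I (x, y).1 * I (x, y).2)%:E = \int[mu]_x (fine (\int[mu]_t (I t)%:E) * I x)%:E)%E.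
  by apply: eq_integral => x _ /=; rewrite intRZ// iE -EFinM mulrC.
by rewrite intRZ ?fine_ge0 ?intR_ge0// -iE lte_mul_pinfty ?intR_ge0// iE.
Qed.

Lemma in_L2_trunc n phi : in_L2 setT phi -> in_L2 setT (trunc n phi).
Proof.
move=> /in_L2E[[mr mi] i2]; have mb := measurable_in_box n.
have m : cmeasurable setT (trunc n phi) by split; rewrite ?Re_trunc ?Im_trunc; meas.
apply/in_L2E; split => //; apply: le_lt_trans i2.
by apply: leeD; apply: le_intR => x; rewrite ?sqr_ge0 ?Re_trunc ?Im_trunc//; case: ifP => //; rewrite expr0n ?sqr_ge0.
Qed.

(** On a box, which has finite measure, [|a| <= 1 + a^2]. *)
Lemma in_L1_trunc n phi : in_L2 setT phi -> in_L1 (trunc n phi).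
Proof.
move=> /in_L2E[[mr mi] i2]; have mb := measurable_in_box n.
have H a : measurable_fun setT a -> (sqn a < +oo)%E -> L1 (fun x => if in_box n x then a x else 0).
  move=> ma ia; split; first by meas.
  apply: (@le_lt_trans _ _ (\int[leb2]_x ((if in_box n x then 1 else 0) + (a x) ^+ 2)%:E)%E).
    apply: le_intR => x //; case: ifP => _; last by rewrite normr0 add0r sqr_ge0.
    rewrite -real_normK ?num_real//; have := normr_ge0 (a x); nra.
  rewrite intRD; [|by meas|by meas|by move=> x; case: ifP|by move=> x; exact: sqr_ge0].
  by apply: lte_add_pinfty => //; exact: box_integral.
apply: parts_in_L1; rewrite ?Re_trunc ?Im_trunc; apply: H => //; apply: le_lt_trans i2.
  by rewrite leeDl ?sqn_ge0.
by rewrite leeDr ?sqn_ge0.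
Qed.

Lemma trunc_vanishing phi : in_L2 setT phi -> vanishing (fun n => csqn (fun x => trunc n phi x - phi x)).
Proof.
move=> /in_L2E[[mr mi] i2].
have H a : measurable_fun setT a -> (sqn a < +oo)%E ->
    vanishing (fun n => sqn (fun x => (if in_box n x then a x else 0) - a x)).
  move=> ma ia; apply: (@dominated_vanishing _ _ _ leb2 _ (fun x => ((a x) ^+ 2)%:E)) => //.
  - by move=> n; have mb := measurable_in_box n; meas.
  - by meas.
  - move=> n x; rewrite !lee_fin sqr_ge0/=; case: ifP => _; first by rewrite subrr expr0n sqr_ge0.
    by rewrite sub0r sqrrN.
  move=> x _ e e0; exists (Num.truncn (Num.max `|x.1| `|x.2|)).+1 => k kx.
  have : (Num.max `|x.1| `|x.2| <= k%:R)%R.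
    by apply: le_trans (ltW (truncnS_gt _)) _; rewrite ler_nat.
  by rewrite ge_max /in_box => ->; rewrite subrr expr0n/= lee_fin ltW.
have h1 : (sqn (Re \o phi) < +oo)%E by apply: le_lt_trans i2; rewrite leeDl ?sqn_ge0.
have h2 : (sqn (Im \o phi) < +oo)%E by apply: le_lt_trans i2; rewrite leeDr ?sqn_ge0.
have := vanishingD (H _ mr h1) (H _ mi h2); apply: vanishing_le => n; rewrite /csqn.
rewrite le_eqVlt; apply/orP; left; apply/eqP; congr (_ + _)%E; apply: eq_integral => x _ /=; rewrite /trunc.
  by case: ifP => _; case: (phi x).
by case: ifP => _; case: (phi x).
Qed.

Lemma fourier_integralB phi g k : in_L1 phi -> in_L1 g ->
  fourier_integral (fun x => phi x - g x) k = fourier_integral phi k - fourier_integral g k.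
Proof.
move=> L M; have [Lr Li] := in_L1_parts L; have [Mr Mi] := in_L1_parts M.
have E1 : Re \o (fun x => phi x - g x) = (fun x => (Re \o phi) x - (Re \o g) x).
  by apply/funext => x /=; case: (phi x); case: (g x).
have E2 : Im \o (fun x => phi x - g x) = (fun x => (Im \o phi) x - (Im \o g) x).
  by apply/funext => x /=; case: (phi x); case: (g x).
have LM : in_L1 (fun x => phi x - g x) by apply: parts_in_L1; rewrite ?E1 ?E2; exact: L1B.
rewrite !fourier_integralE// E1 E2 !cosTB// !sinTB//.
by apply/eqP; rewrite eq_complex /=; apply/andP; split; apply/eqP; ring.
Qed.

Lemma csqnD_le f g : cmeasurable setT f -> cmeasurable setT g ->
  (csqn (fun x => f x - g x)%R <= 2%:E * (csqn f + csqn g))%E.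
Proof.
move=> [mfr mfi] [mgr mgi]; rewrite /csqn.
have -> : Re \o (fun x => f x - g x) = (fun x => (Re \o f) x - (Re \o g) x).
  by apply/funext => x /=; case: (f x); case: (g x).
have -> : Im \o (fun x => f x - g x) = (fun x => (Im \o f) x - (Im \o g) x).
  by apply/funext => x /=; case: (f x); case: (g x).
rewrite [X in (_ <= _ * X)%E]addeACA (ge0_muleDr 2%:E (adde_ge0 (sqn_ge0 _) (sqn_ge0 _)) (adde_ge0 (sqn_ge0 _) (sqn_ge0 _))).
by apply: leeD; exact: sqnB_le.
Qed.

(** Truncations of [phi] are in [L^1] and [L^2], and Plancherel's identity makes the increments of
    their transforms as small as those of the truncations. Completeness, applied to real and
    imaginary parts, yields the limit. *)
Lemma is_fourier_exists phi : in_L2 setT phi -> exists g, is_fourier phi g.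
Proof.
move=> L; have /in_L2E[mp ip] := L; have [mr mi] := mp.
(* With this tolerance consecutive truncations differ by at most
   [2 (8^-(j+1) / 4 + 8^-j / 4) <= 8^-j], the rate asked by [L2_complete]. *)
have H (j : nat) : exists n : nat, (csqn (fun x => trunc n phi x - phi x)%R <= (8^-1 ^+ j / 4)%:E)%E.
  have [|N hN] := trunc_vanishing L (e := 8^-1 ^+ j / 4); first by rewrite divr_gt0// exprn_gt0// invr_gt0.
  by exists N; exact: hN.
have [r hr] := choice H.
pose u j := trunc (r j) phi.
have Lu1 j : in_L1 (u j) by exact: in_L1_trunc.
have Lu2 j : in_L2 setT (u j) by exact: in_L2_trunc.
have mu_ j : cmeasurable setT (u j) by case: (Lu1 j).
have mup j : cmeasurable setT (fun x => u j x - phi x) by exact: cmeasurableB.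
have mF j : cmeasurable setT (fourier_integral (u j)) by exact: measurable_fourier_integral.
have hF j : (csqn (fun k => fourier_integral (u j.+1) k - fourier_integral (u j) k)%R <= (8^-1 ^+ j)%:E)%E.
  have -> : (fun k => fourier_integral (u j.+1) k - fourier_integral (u j) k) = fourier_integral (fun x => u j.+1 x - u j x).
    by apply/funext => k; rewrite fourier_integralB.
  have LB : in_L1 (fun x => u j.+1 x - u j x).
    have [a1 a2] := in_L1_parts (Lu1 j.+1); have [b1 b2] := in_L1_parts (Lu1 j).
    apply: parts_in_L1.
      rewrite (_ : _ \o _ = (fun x => (Re \o u j.+1) x - (Re \o u j) x)); first exact: L1B.
      by apply/funext => x /=; case: (u j.+1 x); case: (u j x).
    rewrite (_ : _ \o _ = (fun x => (Im \o u j.+1) x - (Im \o u j) x)); first exact: L1B.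
    by apply/funext => x /=; case: (u j.+1 x); case: (u j x).
  have E : (fun x => u j.+1 x - u j x) = (fun x => (u j.+1 x - phi x) - (u j x - phi x)).
    by apply/funext => x; ring.
  have bound : (csqn (fun x => u j.+1 x - u j x)%R <= (8^-1 ^+ j)%:E)%E.
    rewrite E; apply: le_trans (csqnD_le (mup _) (mup _)) _.
    apply: (@le_trans _ _ (2%:E * ((8^-1 ^+ j.+1 / 4)%:E + (8^-1 ^+ j / 4)%:E))%E).
      by rewrite lee_wpmul2l// leeD// hr.
    rewrite -EFinD -EFinM lee_fin exprS.
    have : 0 <= 8^-1 ^+ j :> R by rewrite exprn_ge0// invr_ge0.
    lra.
  rewrite plancherel_L1//; apply/in_L2E; split; first by case: LB.
  by apply: le_lt_trans bound _; rewrite ltry.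
have part (P : R[i] -> R) : (forall x y, P (x - y) = P x - P y) ->
    (forall j, measurable_fun setT (P \o fourier_integral (u j))) ->
    (forall f, (sqn (P \o f) <= csqn f)%E) ->
    exists g : R * R -> R, measurable_fun setT g /\ vanishing (fun n => sqn (fun x => (P \o fourier_integral (u n)) x - g x)).
  move=> PB mP Ple; apply: L2_complete => // n.
  apply: le_trans (hF n); apply: le_trans (Ple _).
  rewrite le_eqVlt; apply/orP; left; apply/eqP; apply: eq_integral => x _ /=.
  by rewrite PB.
have [gr [mgr vgr]] := part Re (fun x y => raddfB _ x y) (fun j => proj1 (mF j)) (fun f => leeDl _ (sqn_ge0 _)).
have [gi [mgi vgi]] := part Im (fun x y => raddfB _ x y) (fun j => proj2 (mF j)) (fun f => leeDr _ (sqn_ge0 _)).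
pose g x := gr x +i* gi x.
have mg : cmeasurable setT g by split.
have vg : vanishing (fun n => csqn (fun k => fourier_integral (u n) k - g k)).
  have := vanishingD vgr vgi; apply: vanishing_le => n; rewrite /csqn.
  rewrite le_eqVlt; apply/orP; left; apply/eqP; congr (_ + _)%E; apply: eq_integral => x _ /=.
have ig : (csqn g < +oo)%E.
  have [N hN] := vg 1 ltr01.
  apply: le_lt_trans (csqn_young ltr01 mg (mF N)) _.
  rewrite plancherel_L1//; have /in_L2E[_ iu] := Lu2 N.
  apply: lte_add_pinfty; apply: lte_mul_pinfty => //; rewrite ?lee_fin ?addr_ge0 ?invr_ge0//.
  by rewrite csqnC; apply: le_lt_trans (hN N (leqnn N)) _; rewrite ltry.
exists g; split => //; split; first by apply/in_L2E.
exists u; split => //.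
- apply/L2norm_cvg0 => // e e0.
  have : vanishing (fun n => (8^-1 ^+ n / 4 : R)%:E).
    apply: vanishingN => [n|]; first by rewrite divr_ge0// exprn_ge0// invr_ge0.
    rewrite -[X in _ --> X](mul0r 4^-1); apply: cvgM; last exact: cvg_cst.
    by apply: cvg_expr; rewrite ger0_norm ?invr_ge0// invf_lt1// ltr1n.
  by move=> /(_ e e0)[N hN]; exists N => n Nn; exact: le_trans (hr n) (hN n Nn).
- by apply/L2norm_cvg0 => // n; exact: cmeasurableB.
Qed.

Lemma fourierP phi : in_L2 setT phi -> is_fourier phi (fourier phi).
Proof. by move=> /is_fourier_exists[g Fg]; exact: (xgetPex (fun=> 0) (ex_intro _ g Fg)). Qed.

End fourier_exists.

(** * The Gagliardo seminorm and the H^s norm *)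

Section kernel.
Context {R : realType}.
Local Notation mu := (@lebesgue_measure R).

(* At [s = 0] the kernel is 0, so that [nrm 0] is the squared [L^2] norm. *)
Definition kern (s h : R) : R := if (0 < h) && (s != 0) then h `^ (- (1 + 2 * s)) else 0.

Lemma kern_ge0 s h : 0 <= kern s h.
Proof. by rewrite /kern; case: ifP => // _; exact: powR_ge0. Qed.

Lemma measurable_kern s : measurable_fun setT (kern s).
Proof.
rewrite (_ : kern s = fun h : R => if (0 < h) && (s != 0) then h `^ (- (1 + 2 * s)) else 0)//.
case: (s != 0); last by rewrite (_ : (fun h : R => _) = fun=> 0)//; apply/funext => h; rewrite andbF.
rewrite (_ : (fun h : R => _) = fun h : R => if 0 < h then h `^ (- (1 + 2 * s)) else 0); last first.
  by apply/funext => h; rewrite andbT.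
by meas.
Qed.

Lemma kern_gt0 s h : s != 0 -> 0 < h -> kern s h = h `^ (- (1 + 2 * s)).
Proof. by move=> s0 h0; rewrite /kern h0 s0. Qed.

Lemma int_itv_cst (l u c : R) : l <= u -> 0 <= c ->
  (\int[mu]_h (if (l <= h) && (h <= u) then c else 0)%:E = (c * (u - l))%:E)%E.
Proof.
move=> lu c0.
have -> : (\int[mu]_h (if (l <= h) && (h <= u) then c else 0)%:E =
    \int[mu]_h (c * \1_(`[l, u]%classic%R : set R) h)%:E)%E.
  apply: eq_integral => t _; rewrite indicE; case: ifPn => h.
    by rewrite mem_set/= ?mulr1// in_itv.
  by rewrite memNset/= ?mulr0// in_itv/=; exact/negP.
rewrite intRZ//.
have -> : (\int[mu]_x (\1_(`[l, u]%classic%R : set R) x)%:E = mu `[l, u]%classic%R)%E.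
  by rewrite integral_indic ?setIT//; exact: measurable_itv.
rewrite lebesgue_measure_itv/= lte_fin; case: ltP => [_|ul]; first by rewrite -EFinB -EFinM.
have -> : u = l by apply/eqP; rewrite eq_le ul lu.
by rewrite subrr mulr0 mule0.
Qed.

Lemma ler_powRN (p a b : R) : p <= 0 -> 0 < a -> a <= b -> b `^ p <= a `^ p.
Proof.
move=> p0 a0 ab; have b0 : 0 < b by exact: lt_le_trans ab.
have /(_ a b) : {in Num.nneg &, {homo (@powR R)^~ (- p) : x y / x <= y}}.
  by apply: ge0_ler_powR; rewrite oppr_ge0.
rewrite !nnegrE (ltW a0) (ltW b0) => /(_ isT isT ab) /=.
by rewrite !powRN => h; rewrite -lef_pV2 ?posrE ?powR_gt0.
Qed.

(** The antiderivative is a negative power and vanishes at infinity. This integral bounds the large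
    steps in [mass_pos_upper] and produces the weight of [hardyI] in [gag_cut]. *)
Lemma kern_tail (s a : R) : 0 < s -> 0 < a ->
  (\int[mu]_h (if (a <= h)%R then kern s h else 0)%:E = (a `^ (- (2 * s)) / (2 * s))%:E)%E.
Proof.
move=> s0 a0.
have s2 : 0 < 2 * s by rewrite mulr_gt0.
pose F (h : R) := - (2 * s)^-1 * h `^ (- (2 * s)).
pose f (h : R) := h `^ (- (1 + 2 * s)).
have -> : (\int[mu]_h (if (a <= h)%R then kern s h else 0)%:E = \int[mu]_(h in `[a, +oo[) (f h)%:E)%E.
  rewrite [RHS]integral_mkcond; apply: eq_integral => h _; rewrite patchE.
  have [ah|ah] := leP a h.
    by rewrite mem_set/= ?in_itv/= ?ah// kern_gt0 ?gt_eqF// (lt_le_trans a0).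
  by rewrite memNset//= in_itv/= andbT leNgt ah.
have dF (x : R) : 0 < x -> is_derive x 1 F (f x).
  move=> x0; have dp := is_derive1_powR (- (2 * s)) x0.
  rewrite /F; apply: is_derive_eq; rewrite -![_ *: _]/(_ * _) /f.
 rewrite (_ : - (2 * s) - 1 = - (1 + 2 * s)); last by ring.
  by field; rewrite gt_eqF.
have df (x : R) : 0 < x -> derivable f x 1.
  by move=> x0; have dp := is_derive1_powR (- (1 + 2 * s)) x0; exact: ex_derive.
have dF' (x : R) : 0 < x -> derivable F x 1 by move=> x0; have := dF x x0 => ?; exact: ex_derive.
rewrite (@ge0_continuous_FTC2y R f F a 0).
- by rewrite /F sub0e; congr (_%:E); ring.
- by move=> x _; exact: powR_ge0.
- apply: derivable_within_continuous => x; rewrite in_itv/= andbT => ax.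
  by apply: df; exact: lt_le_trans ax.
- rewrite /F -[X in _ --> X](mulr0 (- (2 * s)^-1)); apply: cvgM; first exact: cvg_cst.
  apply/cvgrPdist_le => e e0.
  exists (e `^ (- (2 * s)^-1)); split; first by rewrite num_real.
  move=> x ex; have ep : 0 < e `^ (- (2 * s)^-1) by exact: powR_gt0.
  rewrite sub0r normrN ger0_norm ?powR_ge0//.
  apply: (@le_trans _ _ ((e `^ (- (2 * s)^-1)) `^ (- (2 * s)))).
    by apply: ler_powRN => //; rewrite ?oppr_le0 ltW.
  by rewrite -powRrM mulrNN mulVf ?gt_eqF// powRr1// ltW.
- by move=> x ax; apply: dF'; exact: lt_trans ax.
- apply: cvg_at_right_filter; apply: differentiable_continuous.
  exact/derivable1_diffP/dF'.
- move=> x; rewrite in_itv/= andbT => ax; rewrite derive1E.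
  by have dFx := dF x (lt_trans a0 ax); rewrite derive_val.
Qed.

Lemma sin_le_id (x : R) : (sin x) ^+ 2 <= x ^+ 2.
Proof.
wlog x0 : x / 0 < x.
  move=> H; case: (ltrgtP x 0) => [xn|xp|->]; [|exact: H|by rewrite sin0 lexx].
  by rewrite -(sqrrN x) -(sqrrN (sin x)) -sinN; apply: H; rewrite oppr_gt0.
have [|c _] := @MVT R sin cos 0 x x0.
  by apply: continuous_subspaceT; exact: continuous_sin.
rewrite sin0 !subr0 => ->; by rewrite exprMn ler_piMl ?sqr_ge0// -(cos2Dsin2 c) lerDl sqr_ge0.
Qed.

Lemma two_cos_le (x : R) : 2 - 2 * cos x <= x ^+ 2.
Proof.
have -> : 2 - 2 * cos x = 4 * (sin (x / 2)) ^+ 2.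
  rewrite {1}(_ : x = x / 2 + x / 2); last by field.
  by rewrite cosD -!expr2; have := cos2Dsin2 (x / 2); lra.
have := sin_le_id (x / 2); rewrite expr_div_n; lra.
Qed.

Lemma two_cos_ge0 (x : R) : 0 <= 2 - 2 * cos x.
Proof. by have := cos_le1 x; lra. Qed.

(** The Fourier multiplier of the directional seminorm [gag]. For [0 < s < 1/2], scaling in [h]
    shows it to be a multiple of [|t|^(2s)]; two-sided bounds of that form are proved below. *)
Definition mass (s t : R) : \bar R := (\int[mu]_h (kern s h * (2 - 2 * cos (h * t)))%:E)%E.

Lemma measurable_mass s : measurable_fun setT (mass s).
Proof.
have mk := measurable_kern s.
apply: (measurable_int_mu (f := fun p : R * R => (kern s p.2 * (2 - 2 * cos (p.2 * p.1)))%:E)).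
by meas.
Qed.

Lemma mass_ge0 s t : (0 <= mass s t)%E.
Proof. by apply: intR_ge0 => h; rewrite mulr_ge0 ?kern_ge0 ?two_cos_ge0. Qed.

Lemma mass0 s : mass s 0 = 0%E.
Proof. by rewrite /mass; apply: integral0_eq => h _; rewrite mulr0 cos0 mulr1 subrr mulr0. Qed.

Lemma massN s t : mass s (- t) = mass s t.
Proof. by apply: eq_integral => h _; rewrite mulrN cosN. Qed.

Lemma sqr_powR (s t : R) : 0 <= t -> (t ^+ 2) `^ s = t `^ (2 * s).
Proof. by move=> t0; rewrite -powR_mulrn// -powRrM. Qed.

(** The integral is split at [h = 1 / t]. Below, [2 - 2 cos (h t) <= (h t)^2] leaves
    [t^2 h^(1 - 2s)], increasing in [h], which gives the summand 1. Above, the bound 4 and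
    [kern_tail] give [4 / (2 s)]. *)
Lemma mass_pos_upper (s t : R) : 0 < s -> s < 2^-1 -> 0 < t ->
  (mass s t <= ((1 + 2 / s) * (t ^+ 2) `^ s)%:E)%E.
Proof.
move=> s0 s1 t0; have sn0 : s != 0 by rewrite gt_eqF.
have ti : 0 < t^-1 by rewrite invr_gt0.
have mk := measurable_kern s.
pose c := t ^+ 2 * t^-1 `^ (1 - 2 * s).
have c0 : 0 <= c by rewrite mulr_ge0 ?sqr_ge0 ?powR_ge0.
apply: (@le_trans _ _ (\int[mu]_h ((if (0 <= h) && (h <= t^-1) then c else 0) + 4 * (if (t^-1 <= h)%R then kern s h else 0))%:E)%E).
  apply: le_intR => h; first by rewrite mulr_ge0 ?kern_ge0 ?two_cos_ge0.
  have k4 : kern s h * (2 - 2 * cos (h * t)) <= 4 * kern s h.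
    by have := cos_geN1 (h * t); have := kern_ge0 s h; nra.
  have [h0|h0] := ltP 0 h; last first.
    rewrite {1}/kern ltNge h0/= mul0r addr_ge0//; first by case: ifP.
    by case: ifP => _; rewrite ?mulr0// mulr_ge0 ?kern_ge0.
  have [ht|ht] := leP t^-1 h.
    by apply: le_trans k4 _; rewrite lerDr; case: ifP.
  rewrite (ltW h0) (ltW ht)/= mulr0 addr0 kern_gt0//.
  apply: (@le_trans _ _ (h `^ (- (1 + 2 * s)) * (h * t) ^+ 2)).
    by rewrite ler_wpM2l ?powR_ge0 ?two_cos_le.
  have -> : h `^ (- (1 + 2 * s)) * (h * t) ^+ 2 = t ^+ 2 * h `^ (1 - 2 * s).
    rewrite exprMn mulrA mulrC; congr (_ * _); rewrite -powR_mulrn ?(ltW h0)// -powRD.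
      by congr (_ `^ _); ring.
    by rewrite (gt_eqF h0) implybT.
  rewrite ler_wpM2l ?sqr_ge0//; apply: ge0_ler_powR; rewrite ?nnegrE ?ltW//; lra.
rewrite intRD; last 4 first.
- by meas.
- by meas.
- by move=> h; case: ifP.
- by move=> h; case: ifP => _; rewrite ?mulr0// mulr_ge0 ?kern_ge0.
rewrite intRZ//; last 2 first.
- by meas.
- by move=> h; case: ifP => _ //; exact: kern_ge0.
rewrite kern_tail// int_itv_cst ?(ltW ti)// -EFinM -EFinD lee_fin (sqr_powR _ (ltW t0)).
have t2 : t^-1 `^ (- (2 * s)) = t `^ (2 * s).
  by rewrite -powR_inv1 ?ltW// -powRrM mulN1r opprK.
rewrite t2 subr0 /c.
have -> : t ^+ 2 * t^-1 `^ (1 - 2 * s) / t = t `^ (2 * s).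
  rewrite powRD ?(gt_eqF ti) ?implybT// t2 powRr1 ?(ltW ti)//.
  by field; rewrite gt_eqF.
by rewrite le_eqVlt; apply/orP; left; apply/eqP; field.
Qed.

(** Only [1 / t <= h <= 2 / t] is kept. There [1 <= h t <= 2 <= pi], so [cos (h t) <= cos 1], and
    the kernel is at least its value at [2 / t]; the factor [1/4] comes from [1 + 2 s <= 2]. *)
Lemma mass_pos_lower (s t : R) : 0 < s -> s < 2^-1 -> 0 < t ->
  ((4^-1 * (2 - 2 * cos 1) * (t ^+ 2) `^ s)%:E <= mass s t)%E.
Proof.
move=> s0 s1 t0; have sn0 : s != 0 by rewrite gt_eqF.
have ti : 0 < t^-1 by rewrite invr_gt0.
pose c := (2 / t) `^ (- (1 + 2 * s)) * (2 - 2 * cos 1).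
have c0 : 0 <= c by rewrite mulr_ge0 ?powR_ge0 ?two_cos_ge0.
apply: (@le_trans _ _ (\int[mu]_h (if (t^-1 <= h) && (h <= 2 / t) then c else 0)%:E)%E); last first.
  apply: le_intR => h; first by case: ifP.
  case: ifPn => [/andP[h1 h2]|_]; last by rewrite mulr_ge0 ?kern_ge0 ?two_cos_ge0.
  have h0 : 0 < h by exact: lt_le_trans h1.
  rewrite kern_gt0// ler_pM ?powR_ge0 ?two_cos_ge0//.
    apply: ler_powRN => //; rewrite oppr_le0 addr_ge0// mulr_ge0// ltW//.
  have h3 : 1 <= h * t by rewrite -ler_pdivrMr// div1r.
  have h4 : h * t <= 2 by rewrite -ler_pdivlMr.
  have := pi_ge2 R => pi2.
  have : cos (h * t) <= cos 1.
    have [->//|ne] := eqVneq (h * t) 1.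
    apply: ltW; rewrite ltr_cos ?in_itv/= ?ler01 ?(le_trans _ pi2) ?ler1n//.
      by rewrite lt_neqAle eq_sym ne.
    by rewrite (le_trans ler01 h3).
  lra.
rewrite int_itv_cst//; last by rewrite -[leLHS]mul1r ler_pM2r// ler1n.
rewrite lee_fin (sqr_powR _ (ltW t0)) /c.
have -> : (2 / t) `^ (- (1 + 2 * s)) = 2 `^ (- (1 + 2 * s)) * t `^ (1 + 2 * s).
  rewrite powRM ?ltW//; congr (_ * _).
  by rewrite -powR_inv1 ?ltW// -powRrM mulN1r opprK.
have -> : 2 / t - t^-1 = t^-1 by field; rewrite gt_eqF.
rewrite [t `^ (1 + _)]powRD ?(gt_eqF t0) ?implybT// powRr1 ?(ltW t0)//.
have q : 4^-1 <= 2 `^ (- (1 + 2 * s)) :> R.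
  rewrite powRN lef_pV2 ?posrE ?powR_gt0//.
  apply: (@le_trans _ _ (2 `^ 2)); last by rewrite powR_mulrn// expr2; lra.
  by apply: ler_powR; [rewrite ler1n|lra].
rewrite (_ : _ * (t * t `^ (2 * s)) * _ / t = 2 `^ (- (1 + 2 * s)) * (2 - 2 * cos 1) * t `^ (2 * s)); last by field; rewrite gt_eqF.
by rewrite ler_wpM2r ?powR_ge0// ler_wpM2r ?two_cos_ge0.
Qed.

Lemma mass_bounds (s : R) : 0 < s -> s < 2^-1 -> exists c C : R, [/\ 0 < c, 0 < C &
  forall t, ((c * (t ^+ 2) `^ s)%:E <= mass s t <= (C * (t ^+ 2) `^ s)%:E)%E].
Proof.
move=> s0 s1; exists (4^-1 * (2 - 2 * cos 1)), (1 + 2 / s); split.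
- rewrite mulr_gt0 ?invr_gt0//.
  have : cos 1 < cos 0 :> R by rewrite ltr_cos ?in_itv/= ?ler01 ?lexx ?pi_ge0 ?(le_trans _ (pi_ge2 R)) ?ler1n.
  by rewrite cos0; lra.
- by rewrite addr_gt0// divr_gt0.
move=> t; case: (ltrgtP t 0) => [tn|tp|->].
- by rewrite -massN -sqrrN mass_pos_lower ?mass_pos_upper// oppr_gt0.
- by rewrite mass_pos_lower ?mass_pos_upper.
- by rewrite mass0 expr0n/= powR0 ?gt_eqF// !mulr0 lexx.
Qed.

End kernel.

(** * Gagliardo seminorms and their Fourier representation *)

Section gagliardo.
Context {R : realType}.
Local Notation mu := (@lebesgue_measure R).
Local Notation leb2 := (@leb2 R).
Local Notation leb3 := (@leb3 R).
Local Notation Re := (@complex.Re R).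
Local Notation Im := (@complex.Im R).
Implicit Types (s : R) (e : R * R) (f g h : R * R -> R) (phi : R * R -> R[i]).

(** The squared Gagliardo seminorm along [e]. Only positive steps count because [kern] vanishes on
    [h <= 0]; writing one integral over steps and points lets Tonelli exchange them freely. *)
Definition gag s e f : \bar R :=
  (\int[leb3]_p (kern s p.1 * (f (p.2.1 + p.1 * e.1, p.2.2 + p.1 * e.2) - f p.2) ^+ 2)%:E)%E.

Lemma measurable_gag_integrand s e f : measurable_fun setT f ->
  measurable_fun setT (fun p : R * (R * R) => kern s p.1 * (f (p.2.1 + p.1 * e.1, p.2.2 + p.1 * e.2) - f p.2) ^+ 2).
Proof. by move=> mf; have mk := measurable_kern s; meas. Qed.

Lemma gag_integrand_ge0 s e f (p : R * (R * R)) :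
  0 <= kern s p.1 * (f (p.2.1 + p.1 * e.1, p.2.2 + p.1 * e.2) - f p.2) ^+ 2.
Proof. by rewrite mulr_ge0 ?kern_ge0 ?sqr_ge0. Qed.

Lemma gag_ge0 s e f : (0 <= gag s e f)%E.
Proof. by apply: intR_ge0 => p; exact: gag_integrand_ge0. Qed.

Lemma measurable_sqn_tr e f : measurable_fun setT f ->
  measurable_fun setT (fun h : R => sqn (fun x => tr (h * e.1, h * e.2) f x - f x)).
Proof.
move=> mf; rewrite /sqn /tr.
apply: (measurable_int_leb2 (f := fun p : R * (R * R) => ((f (p.2.1 + p.1 * e.1, p.2.2 + p.1 * e.2) - f p.2) ^+ 2)%:E)).
by meas.
Qed.

Lemma gagE s e f : measurable_fun setT f ->
  gag s e f = (\int[mu]_h ((kern s h)%:E * sqn (fun x => tr (h * e.1, h * e.2) f x - f x)%R))%E.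
Proof.
move=> mf; rewrite /gag tonelli3F; last 2 first.
- by apply: mfE; exact: measurable_gag_integrand.
- by move=> p; rewrite lee_fin gag_integrand_ge0.
apply: eq_integral => h _ /=; rewrite /sqn /tr intRZ//; last 3 first.
- by meas.
- exact: kern_ge0.
- by move=> x; exact: sqr_ge0.
Qed.

Lemma gag_le2 s e f g h : measurable_fun setT f -> measurable_fun setT g ->
  (forall x y, (h x - h y) ^+ 2 <= 2 * ((f x - f y) ^+ 2 + (g x - g y) ^+ 2)) ->
  (gag s e h <= 2%:E * (gag s e f + gag s e g))%E.
Proof.
move=> mf mg le2; have m1 := measurable_gag_integrand s e mf; have m2 := measurable_gag_integrand s e mg.
rewrite /gag -intRD//; last 2 first.
- by move=> p; exact: gag_integrand_ge0.
- by move=> p; exact: gag_integrand_ge0.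
rewrite -intRZ//; last 2 first.
- exact: (mfD m1 m2).
- by move=> p; rewrite addr_ge0 ?gag_integrand_ge0.
apply: le_intR => p; first exact: gag_integrand_ge0.
by rewrite -mulrDr [leRHS]mulrCA; apply: ler_wpM2l; rewrite ?kern_ge0.
Qed.

(** For each step the difference has squared norm at most [4 sqn f]. Hence the seminorm ignores null
    sets although its integrand is defined pointwise. *)
Lemma gag_null s e f : measurable_fun setT f -> sqn f = 0%E -> gag s e f = 0%E.
Proof.
move=> mf f0; rewrite gagE//; apply: integral0_eq => h _.
have : (sqn (fun x => tr (h * e.1, h * e.2) f x - f x)%R <= 0)%E.
  by apply: le_trans (sqn_tr_bound _ mf) _; rewrite f0 mule0.
by move=> h0; rewrite (_ : sqn _ = 0%E) ?mule0//; apply/eqP; rewrite eq_le h0 sqn_ge0.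
Qed.

Lemma mul2e_add3 (a b c a' b' c' : \bar R) : (0 <= a -> 0 <= b -> 0 <= c -> 0 <= a' -> 0 <= b' -> 0 <= c' ->
  2%:E * ((a + (b + c)) + (a' + (b' + c'))) = 2%:E * (a + a') + (2%:E * (b + b') + 2%:E * (c + c')))%E.
Proof.
move=> *; rewrite addeACA [X in (_ * (_ + X))%E]addeACA.
by rewrite [LHS]ge0_muleDr ?adde_ge0// [X in (_ + X)%E]ge0_muleDr ?adde_ge0.
Qed.

Definition nrm s f : \bar R := (sqn f + (gag s (1, 0)%R f + gag s (0, 1)%R f))%E.

Lemma nrm_ge0 s f : (0 <= nrm s f)%E.
Proof. apply: adde_ge0; [exact: sqn_ge0|apply: adde_ge0; exact: gag_ge0]. Qed.

Lemma sqn_le_nrm s f : (sqn f <= nrm s f)%E.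
Proof. by apply: leeDl; apply: adde_ge0; exact: gag_ge0. Qed.

(** The two pointwise hypotheses concern values and increments; sums and differences of functions
    both satisfy them, which gives the substitute for the triangle inequality. *)
Lemma nrm_le2 s f g h : measurable_fun setT f -> measurable_fun setT g ->
  (forall x, (h x) ^+ 2 <= 2 * ((f x) ^+ 2 + (g x) ^+ 2)) ->
  (forall x y, (h x - h y) ^+ 2 <= 2 * ((f x - f y) ^+ 2 + (g x - g y) ^+ 2)) ->
  (nrm s h <= 2%:E * (nrm s f + nrm s g))%E.
Proof.
move=> mf mg h1 h2; rewrite /nrm mul2e_add3; try exact: sqn_ge0; try exact: gag_ge0.
by apply: leeD; [exact: sqn_le2|apply: leeD; exact: gag_le2].
Qed.

Lemma nrmB_le s f g : measurable_fun setT f -> measurable_fun setT g ->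
  (nrm s (fun x => (f x - g x)%R) <= 2%:E * (nrm s f + nrm s g))%E.
Proof.
move=> mf mg; apply: nrm_le2 => // [x|x y].
  by have := sqr_ge0 (f x + g x); nra.
by have := sqr_ge0 ((f x - f y) + (g x - g y)); nra.
Qed.

Lemma nrmD_le s f g : measurable_fun setT f -> measurable_fun setT g ->
  (nrm s (fun x => (f x + g x)%R) <= 2%:E * (nrm s f + nrm s g))%E.
Proof.
move=> mf mg; apply: nrm_le2 => // [x|x y].
  by have := sqr_ge0 (f x - g x); nra.
by have := sqr_ge0 ((f x - f y) - (g x - g y)); nra.
Qed.

Lemma nrm_null s f : measurable_fun setT f -> sqn f = 0%E -> nrm s f = 0%E.
Proof. by move=> mf f0; rewrite /nrm f0 !gag_null// !adde0. Qed.

(** Writing [f = (f - g) + g], the null function contributes nothing; the factor 2 is that of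
    [nrmD_le]. *)
Lemma nrm_le_null s f g : measurable_fun setT f -> measurable_fun setT g ->
  sqn (fun x => (f x - g x)%R) = 0%E -> (nrm s f <= 2%:E * nrm s g)%E.
Proof.
move=> mf mg fg0; have md := mfB mf mg.
have := nrmD_le s md mg; rewrite (nrm_null s md fg0) add0e.
by rewrite (_ : (fun x => f x - g x + g x) = f)//; apply/funext => x; rewrite subrK.
Qed.

Definition cnrm s phi : \bar R := (nrm s (Re \o phi) + nrm s (Im \o phi))%E.

Lemma gag_fourier s e phi (g : R * R -> R[i]) : is_fourier phi g ->
  (gag s e (Re \o phi) + gag s e (Im \o phi) =
   \int[leb2]_k ((Normc.normc (g k) ^+ 2)%:E * mass s (pdot k e)))%E.
Proof.
move=> Fg; have [/in_L2E[[mr mi] _] [/in_L2E[mg _] _]] := Fg.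
have mk := measurable_kern s; have mn := measurable_normc2 mg.
rewrite !gagE//.
have m1 := measurable_sqn_tr e mr; have m2 := measurable_sqn_tr e mi.
rewrite -ge0_integralD//; last 4 first.
- by move=> h _; rewrite mule_ge0 ?lee_fin ?kern_ge0 ?sqn_ge0.
- by apply: emeasurable_funM => //; exact: mfE.
- by move=> h _; rewrite mule_ge0 ?lee_fin ?kern_ge0 ?sqn_ge0.
- by apply: emeasurable_funM => //; exact: mfE.
pose F (p : R * (R * R)) : R := Normc.normc (g p.2) ^+ 2 * (kern s p.1 * (2 - 2 * cos (p.1 * pdot p.2 e))).
have F0 p : 0 <= F p by apply: mulr_ge0; [exact: sqr_ge0|apply: mulr_ge0; [exact: kern_ge0|exact: two_cos_ge0]].
have mF : measurable_fun setT F.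
  apply: mfM; first exact: (mf_comp mn measurable_snd).
  by rewrite /pdot; meas.
transitivity (\int[mu]_h \int[leb2]_k (F (h, k))%:E)%E.
  apply: eq_integral => h _; rewrite -ge0_muleDr ?sqn_ge0//.
  rewrite -Re_cdiff -Im_cdiff -/(csqn _) (fourier_difference _ Fg) -intRZ//; last 3 first.
  - by apply: mfM => //; rewrite /pdot; meas.
  - exact: kern_ge0.
  - by move=> k; rewrite mulr_ge0 ?sqr_ge0 ?two_cos_ge0.
  apply: eq_integral => k _; congr (_%:E); rewrite /F /= (_ : pdot k _ = h * pdot k e); last by rewrite /pdot/=; ring.
  by move: (_ ^+ 2) => n; ring.
rewrite -(tonelli3F (f := fun p => (F p)%:E)); last 2 first.
- exact: mfE.
- by move=> p; rewrite lee_fin.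
rewrite tonelli3G; last 2 first.
- exact: mfE.
- by move=> p; rewrite lee_fin.
apply: eq_integral => k _; rewrite /F/= intRZ//; last 3 first.
- by meas.
- exact: sqr_ge0.
- by move=> h; rewrite mulr_ge0 ?kern_ge0 ?two_cos_ge0.
Qed.

Lemma muleD1D (x y z : \bar R) : (0 <= y -> 0 <= z -> x * (1 + (y + z)) = x + (x * y + x * z))%E.
Proof.
move=> y0 z0; rewrite ge0_muleDr ?lee01 ?adde_ge0//; congr (_ + _)%E; first by rewrite mule1.
by rewrite ge0_muleDr.
Qed.

(** The left-hand side does not involve [g], so every transform of [phi] gives the same value on the
    right. *)
Lemma cnrm_fourier s phi (g : R * R -> R[i]) : is_fourier phi g ->
  (cnrm s phi = \int[leb2]_k ((Normc.normc (g k) ^+ 2)%:E * (1 + (mass s k.1 + mass s k.2))))%E.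
Proof.
move=> Fg; have [_ [/in_L2E[mg _] _]] := Fg.
have mn := measurable_normc2 mg; have mm := measurable_mass s.
have m1 : measurable_fun setT (fun k : R * R => mass s k.1) by exact: (mf_comp mm measurable_fst).
have m2 : measurable_fun setT (fun k : R * R => mass s k.2) by exact: (mf_comp mm measurable_snd).
rewrite /cnrm /nrm addeACA -/(csqn phi) -(fourier_isometry Fg) [X in (_ + X)%E]addeACA.
rewrite !(gag_fourier _ _ Fg) -int_normc2//.
have p1 (k : R * R) : pdot k (1, 0)%R = k.1 by rewrite /pdot/= mulr1 mulr0 addr0.
have p2 (k : R * R) : pdot k (0, 1)%R = k.2 by rewrite /pdot/= mulr1 mulr0 add0r.
under [X in (_ + (X + _))%E]eq_integral do rewrite p1.
under [X in (_ + (_ + X))%E]eq_integral do rewrite p2.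
have me := mfE mn.
rewrite -ge0_integralD//; last 4 first.
- by move=> h _; rewrite mule_ge0 ?lee_fin ?sqr_ge0 ?mass_ge0.
- exact: emeasurable_funM.
- by move=> h _; rewrite mule_ge0 ?lee_fin ?sqr_ge0 ?mass_ge0.
- exact: emeasurable_funM.
rewrite -ge0_integralD//; last 3 first.
- by move=> h _; rewrite lee_fin sqr_ge0.
- by move=> h _; rewrite adde_ge0// mule_ge0 ?lee_fin ?sqr_ge0 ?mass_ge0.
- by apply: emeasurable_funD; exact: emeasurable_funM.
apply: eq_integral => k _.
by rewrite muleD1D ?mass_ge0.
Qed.

Definition weight s (k : R * R) : R := (1 + (k.1 ^+ 2 + k.2 ^+ 2)) `^ s.

Lemma mass1_ge0 s (k : R * R) : (0 <= 1 + (mass s k.1 + mass s k.2))%E.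
Proof. by apply: adde_ge0; [exact: lee01|rewrite adde_ge0 ?mass_ge0]. Qed.

(** Up to constants [mass s t] is [(t^2)^s], so this compares [(1 + p + q)^s] with [1 + p^s + q^s].
    At [s = 0] the masses vanish and both sides are 1. *)
Lemma weight_mass s : 0 <= s -> s < 2^-1 -> exists2 A : R, 0 < A & forall k,
  ((1 + (mass s k.1 + mass s k.2) <= (A * weight s k)%:E) /\
   ((weight s k)%:E <= A%:E * (1 + (mass s k.1 + mass s k.2))))%E.
Proof.
rewrite le_eqVlt => /predU1P[<- _|s0 s1].
  exists 1 => // k; rewrite /weight powRr0.
  have m0 t : mass 0 t = 0%E :> \bar R.
    by apply: integral0_eq => h _; rewrite /kern eqxx andbF mul0r.
  by rewrite !m0 !adde0 mul1e mulr1.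
have [c [C [c0 C0 cC]]] := mass_bounds s0 s1.
(* [1 + 2 C] suffices for the first inequality and [3 + 3 / c] for the second; the sum serves
   both. *)
exists (1 + 2 * C + 3 + 3 / c); first by have := divr_gt0 (ltr0n R 3) c0; lra.
move=> [x y] /=; have := cC x; have := cC y.
set p := x ^+ 2; set q := y ^+ 2 => /andP[y1 y2] /andP[x1 x2].
have p0 : 0 <= p by exact: sqr_ge0.
have q0 : 0 <= q by exact: sqr_ge0.
have mono (a b : R) : 0 <= a -> a <= b -> a `^ s <= b `^ s.
  by move=> a0 ab; apply: ge0_ler_powR; rewrite ?nnegrE ?(ltW s0)// (le_trans a0).
have w1 : 1 <= weight s (x, y).
  apply: (@le_trans _ _ (1 `^ s)); first by rewrite powR1.
  by apply: mono => //=; rewrite lerDl addr_ge0.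
have w2 : p `^ s <= weight s (x, y) by apply: mono => //=; rewrite -/p -/q; lra.
have w3 : q `^ s <= weight s (x, y) by apply: mono => //=; rewrite -/p -/q; lra.
have w4 : weight s (x, y) <= 3 * (1 + (p `^ s + q `^ s)).
  (* Here [m] stands for the largest of 1, [p] and [q]: [1 + p + q <= 3 m], and [3^s <= 3]. *)
  have h (m : R) : 1 <= m -> p <= m -> q <= m -> m `^ s <= 1 + (p `^ s + q `^ s) -> weight s (x, y) <= 3 * (1 + (p `^ s + q `^ s)).
    move=> m1 pm qm mb; have m0 : 0 <= m by exact: le_trans m1.
    apply: (@le_trans _ _ ((3 * m) `^ s)); first by apply: mono; rewrite /= -/p -/q; lra.
    rewrite powRM//; apply: ler_pM => //; rewrite ?powR_ge0//.
    rewrite -[leRHS]powRr1//; apply: ler_powR; first by rewrite ler1n.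
    lra.
  have h0 := powR_ge0 p s; have h1 := powR_ge0 q s.
  have [pq|qp] := leP p q.
    have [q1|q1] := leP q 1; first by apply: (h 1) => //; rewrite ?(le_trans pq)// powR1; lra.
    by apply: (h q) => //; rewrite ?(ltW q1)//; lra.
  have [p1|p1] := leP p 1; first by apply: (h 1) => //; rewrite ?(le_trans (ltW qp))// powR1; lra.
  by apply: (h p) => //; rewrite ?(ltW p1) ?(ltW qp)//; lra.
have h0 := powR_ge0 p s; have h1 := powR_ge0 q s.
have ci : 0 < 3 / c by rewrite divr_gt0.
split.
  apply: (@le_trans _ _ (1 + ((C * p `^ s)%:E + (C * q `^ s)%:E))%E).
    by rewrite leeD2l// leeD.
  by rewrite -!EFinD lee_fin; nra.
apply: (@le_trans _ _ ((1 + 2 * C + 3 + 3 / c)%:E * (1 + ((c * p `^ s)%:E + (c * q `^ s)%:E)))%E).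
  rewrite -!EFinD -EFinM lee_fin; apply: le_trans w4 _.
  have -> : (1 + 2 * C + 3 + 3 / c) * (1 + (c * p `^ s + c * q `^ s)) =
    3 + 3 * (p `^ s + q `^ s) + (1 + 2 * C + 3 / c + (1 + 2 * C + 3) * c * (p `^ s + q `^ s)).
    by field; rewrite gt_eqF.
  have : 0 <= (1 + 2 * C + 3) * c * (p `^ s + q `^ s).
    by apply: mulr_ge0; [apply: mulr_ge0; lra|lra].
  by move: (_ * _ * (_ + _)) => z z0; lra.
by apply: lee_wpmul2l; [rewrite lee_fin; lra|rewrite leeD2l// leeD].
Qed.

(** The function whose [L^2] norm is [Hnorm s phi] by definition; its scalar factor is the square
    root of [weight]. *)
Definition weighted s phi : R * R -> R[i] := fun k =>
  ((1 + (k.1 ^+ 2 + k.2 ^+ 2)) `^ (s / 2))%:C * fourier phi k.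

Lemma normc_weighted s phi k :
  Normc.normc (weighted s phi k) ^+ 2 = weight s k * Normc.normc (fourier phi k) ^+ 2.
Proof.
rewrite /weighted /weight; set b := 1 + _; have b0 : 0 <= b by rewrite addr_ge0// addr_ge0 ?sqr_ge0.
have -> : b `^ s = (b `^ (s / 2)) ^+ 2.
  by rewrite -powR_mulrn ?powR_ge0// -powRrM divfK.
by rewrite !normc_sqr; case: (fourier phi k) => u v /=; ring.
Qed.

Lemma cmeasurable_weighted s phi : in_L2 setT phi -> cmeasurable setT (weighted s phi).
Proof.
move=> /fourierP[_ [/in_L2E[[mr mi] _] _]]; split.
  rewrite (_ : _ \o _ = fun k => (1 + (k.1 ^+ 2 + k.2 ^+ 2)) `^ (s / 2) * (Re \o fourier phi) k); first by meas.
  by apply/funext => k; rewrite /weighted/=; case: (fourier phi k) => u v /=; ring.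
rewrite (_ : _ \o _ = fun k => (1 + (k.1 ^+ 2 + k.2 ^+ 2)) `^ (s / 2) * (Im \o fourier phi) k); first by meas.
by apply/funext => k; rewrite /weighted/=; case: (fourier phi k) => u v /=; ring.
Qed.

Lemma weighted_cnrm s : 0 <= s -> s < 2^-1 -> exists2 A : R, 0 < A & forall phi, in_L2 setT phi ->
  ((cnrm s phi <= A%:E * csqn (weighted s phi)) /\ (csqn (weighted s phi) <= A%:E * cnrm s phi))%E.
Proof.
move=> s0 s1; have [A A0 HA] := weight_mass s0 s1; exists A => // phi L.
have Fg := fourierP L; have [_ [/in_L2E[mg _] _]] := Fg.
have mn := measurable_normc2 mg; have mm := measurable_mass s.
have m1 : measurable_fun setT (fun k : R * R => mass s k.1) by exact: (mf_comp mm measurable_fst).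
have m2 : measurable_fun setT (fun k : R * R => mass s k.2) by exact: (mf_comp mm measurable_snd).
rewrite (cnrm_fourier s Fg) -int_normc2; last exact: cmeasurable_weighted.
under [X in _ /\ (X <= _)%E]eq_integral do rewrite normc_weighted.
under [X in (_ <= _ * X)%E /\ _]eq_integral do rewrite normc_weighted.
have mw : measurable_fun setT (weight s) by rewrite /weight; meas.
have w0 k : 0 <= weight s k by exact: powR_ge0.
have mme : measurable_fun setT (fun k : R * R => (1 + (mass s k.1 + mass s k.2))%E).
  by apply: emeasurable_funD => //; apply: emeasurable_funD.
split.
  rewrite -intRZ ?(ltW A0)//; last 2 first.
  - by meas.
  - by move=> k; rewrite mulr_ge0 ?sqr_ge0.
  apply: le_int => k; first by rewrite mule_ge0 ?lee_fin ?sqr_ge0// ?mass1_ge0.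
  have [h _] := HA k; have := sqr_ge0 (Normc.normc (fourier phi k)); move: (_ ^+ 2) => n n0.
  by rewrite mulrA mulrC EFinM; apply: lee_wpmul2l.
rewrite -ge0_integralZl//; last 3 first.
- by apply: emeasurable_funM => //; exact: mfE.
- by move=> k _; rewrite mule_ge0 ?lee_fin ?sqr_ge0// ?mass1_ge0.
- by rewrite lee_fin ltW.
apply: le_int => k; first by rewrite lee_fin mulr_ge0 ?sqr_ge0.
have [_ h] := HA k; have := sqr_ge0 (Normc.normc (fourier phi k)); move: (_ ^+ 2) => n n0.
by rewrite muleCA mulrC EFinM; apply: lee_wpmul2l.
Qed.

Lemma Hnorm_lt s phi : 0 <= s -> s < 2^-1 -> in_L2 setT phi ->
  (Hnorm s phi < +oo)%E <-> (cnrm s phi < +oo)%E.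
Proof.
move=> s0 s1 L; have [A A0 HA] := weighted_cnrm s0 s1; have [h1 h2] := HA _ L.
have mw := cmeasurable_weighted s L.
have -> : Hnorm s phi = (csqn (weighted s phi) `^ 2^-1)%E by rewrite -L2normE.
have -> : (csqn (weighted s phi) `^ 2^-1 < +oo)%E <-> (csqn (weighted s phi) < +oo)%E.
  by split; [apply: lty_poweRy; rewrite invr_eq0|exact: poweR_lty].
split=> h; first by apply: le_lt_trans h1 _; rewrite lte_mul_pinfty ?lee_fin ?(ltW A0).
by apply: le_lt_trans h2 _; rewrite lte_mul_pinfty ?lee_fin ?(ltW A0).
Qed.

(** [cnrm] is a squared norm, whence the square root. The witness [A ^+ 2] pays for passing from the
    weighted transform to [cnrm] and back. *)
Lemma Hnorm_le s : 0 <= s -> s < 2^-1 -> exists2 A : R, 0 < A & forall (B : R) phi psi, 0 <= B ->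
  in_L2 setT phi -> in_L2 setT psi ->
  (cnrm s phi <= B%:E * cnrm s psi)%E -> (Hnorm s phi <= (Num.sqrt (A * B))%:E * Hnorm s psi)%E.
Proof.
move=> s0 s1; have [A A0 HA] := weighted_cnrm s0 s1; exists (A ^+ 2); first by rewrite exprn_gt0.
move=> B phi psi B0 L1 L2 h; have [_ h2] := HA _ L1; have [h3 _] := HA _ L2.
have m1 := cmeasurable_weighted s L1; have m2 := cmeasurable_weighted s L2.
have -> : Hnorm s phi = (csqn (weighted s phi) `^ 2^-1)%E by rewrite -L2normE.
have -> : Hnorm s psi = (csqn (weighted s psi) `^ 2^-1)%E by rewrite -L2normE.
have AB : 0 <= A ^+ 2 * B by rewrite mulr_ge0 ?sqr_ge0.
rewrite -powR12_sqrt// -poweR_EFin -poweRM ?lee_fin ?csqn_ge0//.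
apply: gt0_ler_poweR; rewrite ?invr_ge0// ?in_itv/= ?leey ?andbT ?csqn_ge0 ?mule_ge0 ?lee_fin ?csqn_ge0//.
apply: le_trans h2 _; rewrite (_ : A ^+ 2 * B = A * (B * A)); last by ring.
rewrite EFinM -muleA; apply: lee_wpmul2l; first by rewrite lee_fin ltW.
by apply: le_trans h _; rewrite EFinM -muleA; apply: lee_wpmul2l.
Qed.

Lemma Hnorm_small s : 0 <= s -> s < 2^-1 -> exists2 A : R, 0 < A & forall (d : R) phi, 0 <= d ->
  in_L2 setT phi -> (cnrm s phi <= (A * d ^+ 2)%:E)%E -> (Hnorm s phi <= d%:E)%E.
Proof.
move=> s0 s1; have [A A0 HA] := weighted_cnrm s0 s1; exists A^-1; first by rewrite invr_gt0.
move=> d phi d0 L h; have [_ h2] := HA _ L.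
rewrite [X in (X <= _)%E](_ : _ = L2norm (weighted s phi))// L2norm_le//; last exact: cmeasurable_weighted.
apply: le_trans h2 _; apply: le_trans (lee_wpmul2l _ h) _; first by rewrite lee_fin ltW.
by rewrite -EFinM lee_fin mulVKf ?gt_eqF.
Qed.

End gagliardo.

(** * Hardy's inequality and half-plane multipliers *)

Section hardy.
Context {R : realType}.
Local Notation mu := (@lebesgue_measure R).
Local Notation leb2 := (@leb2 R).
Local Notation leb3 := (@leb3 R).
Implicit Types (s a : R) (e : R * R) (f g h : R * R -> R).

Lemma powR_shift (p u : R) : 0 < u -> u `^ (- (1 + p)) * u = u `^ (- p).
Proof.
move=> u0; rewrite -[X in _ * X]powRr1 ?(ltW u0)// -powRD ?(gt_eqF u0) ?implybT//.
by congr (_ `^ _); ring.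
Qed.

(* The absorption condition of Hardy's inequality; it can be met because [2 * s < 1]. *)
Lemma hardy_const s : 0 < s -> s < 2^-1 -> exists2 al : R, 1 < al & 4 * (2 * al) `^ (2 * s) <= al.
Proof.
move=> s0 s1; have q0 : 0 < 1 - 2 * s by lra.
(* This [al] solves [al = 8 al^(2s)]; then [4 (2 al)^(2s) <= 8 al^(2s) = al], because
   [2^(2s) <= 2]. *)
pose al : R := 8 `^ ((1 - 2 * s)^-1); exists al.
  apply: (@lt_le_trans _ _ (8 `^ 1)); first by rewrite powRr1// ltr1n.
  by apply: ler_powR; rewrite ?ler1n// invf_ge1//; lra.
have al0 : 0 < al by exact: powR_gt0.
have alE : al = 8 * al `^ (2 * s).
  rewrite -[LHS]powRr1 ?(ltW al0)// {1}(_ : 1 = (1 - 2 * s) + 2 * s); last by ring.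
  rewrite powRD ?(gt_eqF al0) ?implybT//; congr (_ * _).
  by rewrite /al -powRrM mulVf ?gt_eqF// powRr1.
rewrite [leRHS]alE powRM ?(ltW al0)// mulrA ler_wpM2r ?powR_ge0//.
have : 2 `^ (2 * s) <= 2 `^ 1 :> R by apply: ler_powR; [rewrite ler1n|lra].
by rewrite powRr1//; lra.
Qed.

(** The Hardy integral restricted to distance more than [eps] from the boundary. For [eps > 0] it is
    finite, so that a multiple of it can be subtracted from an inequality. *)
Definition hardyI s a f (eps : R) : \bar R :=
  (\int[leb2]_x (if eps < x.1 - a then (x.1 - a) `^ (- (2 * s)) * f x ^+ 2 else 0)%:E)%E.

(** Steps being positive, both points of a difference starting in the half-plane lie in it: only the
    behaviour of [f] there enters. *)
Definition half_gag s a f : \bar R :=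
  (\int[leb3]_p (if a < p.2.1 then
     kern s p.1 * (f (p.2.1 + p.1 * 1, p.2.2 + p.1 * 0) - f p.2) ^+ 2 else 0)%:E)%E.

Lemma hardyI_ge0 s a f eps : (0 <= hardyI s a f eps)%E.
Proof. by apply: intR_ge0 => x; case: ifP => // _; rewrite mulr_ge0 ?powR_ge0 ?sqr_ge0. Qed.

Lemma half_gag_integrand_ge0 s a f (p : R * (R * R)) : 0 <= (if a < p.2.1 then
     kern s p.1 * (f (p.2.1 + p.1 * 1, p.2.2 + p.1 * 0) - f p.2) ^+ 2 else 0).
Proof. by case: ifP => // _; rewrite mulr_ge0 ?kern_ge0 ?sqr_ge0. Qed.

Lemma measurable_half_gag s a f : measurable_fun setT f ->
  measurable_fun setT (fun p : R * (R * R) => if a < p.2.1 then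
     kern s p.1 * (f (p.2.1 + p.1 * 1, p.2.2 + p.1 * 0) - f p.2) ^+ 2 else 0).
Proof. by move=> mf; have mk := measurable_kern s; meas. Qed.

Lemma half_gag_ge0 s a f : (0 <= half_gag s a f)%E.
Proof. by apply: intR_ge0 => p; exact: half_gag_integrand_ge0. Qed.

Lemma half_gag_le s a f : (half_gag s a f <= gag s (1, 0)%R f)%E.
Proof.
apply: le_intR => p /=; first exact: half_gag_integrand_ge0.
by case: ifP => // _; rewrite mulr_ge0 ?kern_ge0 ?sqr_ge0.
Qed.

Lemma hardyI_fin s a f eps : 0 < s -> 0 < eps -> measurable_fun setT f -> (sqn f < +oo)%E ->
  (hardyI s a f eps < +oo)%E.
Proof.
move=> s0 e0 mf f2.
apply: (@le_lt_trans _ _ ((eps `^ (- (2 * s)))%:E * sqn f)%E); last first.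
  by rewrite lte_mul_pinfty// lee_fin powR_ge0.
rewrite /sqn -intRZ ?powR_ge0//; last 2 first.
- by meas.
- by move=> x; exact: sqr_ge0.
apply: le_intR => x; first by case: ifP => // _; rewrite mulr_ge0 ?powR_ge0 ?sqr_ge0.
case: ifP => h; last by rewrite mulr_ge0 ?powR_ge0 ?sqr_ge0.
rewrite ler_wpM2r ?sqr_ge0//; apply: ler_powRN => //; last exact: ltW.
by rewrite oppr_le0 mulr_ge0// ltW.
Qed.

(* Writing [u = x.1 - a], average [f x ^+ 2 <= 2 (f (x + h) - f x) ^+ 2 + 2 f (x + h) ^+ 2]
   over [(al - 1) u <= h <= (2 al - 1) u]: the last term reproduces the left-hand
   side with the factor [2 (2 al)^(2 s)] against [al] and is absorbed. *)
Section window.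
Variables (s a eps al : R) (f : R * R -> R).
Hypotheses (s0 : 0 < s) (e0 : 0 < eps) (al1 : 1 < al) (mf : measurable_fun setT f).

Definition window (p : R * (R * R)) : R :=
  if eps < p.2.1 - a then
    if ((al - 1) * (p.2.1 - a) <= p.1) && (p.1 <= (2 * al - 1) * (p.2.1 - a))
    then (p.2.1 - a) `^ (- (1 + 2 * s)) else 0
  else 0.

Lemma window_ge0 p : 0 <= window p.
Proof. by rewrite /window; case: ifP => // _; case: ifP => // _; exact: powR_ge0. Qed.

Lemma measurable_window : measurable_fun setT window.
Proof. by rewrite /window; meas. Qed.

(** The interval of steps has length [al u], which turns [u^(-1-2s)] into [al u^(-2s)]. *)
Lemma window_diag :
  (\int[leb3]_p (window p * f p.2 ^+ 2)%:E = al%:E * hardyI s a f eps)%E.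
Proof.
have mw := measurable_window.
rewrite tonelli3G; last 2 first.
- by meas.
- by move=> p; rewrite lee_fin mulr_ge0 ?window_ge0 ?sqr_ge0.
rewrite /hardyI -intRZ; last 3 first.
- by meas.
- by rewrite ltW// (lt_trans ltr01).
- by move=> x; case: ifP => // _; rewrite mulr_ge0 ?powR_ge0 ?sqr_ge0.
apply: eq_integral => x _; rewrite /window/=; case: ifP => h; last first.
  by rewrite mulr0; apply: integral0_eq => t _; rewrite mul0r.
have u0 : 0 < x.1 - a by exact: lt_trans h.
transitivity (\int[mu]_t (if ((al - 1) * (x.1 - a) <= t) && (t <= (2 * al - 1) * (x.1 - a))
    then (x.1 - a) `^ (- (1 + 2 * s)) * f x ^+ 2 else 0)%:E)%E.
  by apply: eq_integral => t _; case: ifP; rewrite ?mul0r.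
rewrite int_itv_cst; last 2 first.
- by apply: ler_wpM2r; [exact: ltW|move: al1; lra].
- by rewrite mulr_ge0 ?powR_ge0 ?sqr_ge0.
congr (_%:E); rewrite -(powR_shift (2 * s) u0); move: (f x ^+ 2) (_ `^ _) => b c; ring.
Qed.

(** In the window [h <= 2 al u], so [u^(-1-2s)] is at most [(2 al)^(1+2s) h^(-1-2s)]. *)
Lemma window_gag :
  (\int[leb3]_p (window p * (f (p.2.1 + p.1 * 1, p.2.2 + p.1 * 0)%R - f p.2) ^+ 2)%:E <=
   ((2 * al) `^ (1 + 2 * s))%:E * half_gag s a f)%E.
Proof.
rewrite /half_gag -intRZ ?powR_ge0//; last 2 first.
- exact: measurable_half_gag.
- by move=> p; exact: half_gag_integrand_ge0.
apply: le_intR => p; first by rewrite mulr_ge0 ?window_ge0 ?sqr_ge0.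
have al0 : 0 < al by exact: lt_trans al1.
have nn : 0 <= (2 * al) `^ (1 + 2 * s) * (if a < p.2.1 then
     kern s p.1 * (f (p.2.1 + p.1 * 1, p.2.2 + p.1 * 0) - f p.2) ^+ 2 else 0).
  by apply: mulr_ge0; [exact: powR_ge0|exact: half_gag_integrand_ge0].
rewrite {1}/window; case: ifP => h; last by rewrite mul0r.
case: ifP => [/andP[h1 h2]|_]; last by rewrite mul0r.
have u0 : 0 < p.2.1 - a by exact: lt_trans h.
rewrite -subr_gt0 u0 mulrA; apply: ler_wpM2r; first exact: sqr_ge0.
have t0 : 0 < p.1 by apply: lt_le_trans h1; rewrite mulr_gt0// subr_gt0.
rewrite kern_gt0 ?gt_eqF//.
have -> : (2 * al) `^ (1 + 2 * s) * p.1 `^ (- (1 + 2 * s)) = (p.1 / (2 * al)) `^ (- (1 + 2 * s)).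
  have D0 : 0 <= 2 * al by rewrite mulr_ge0// ltW.
  rewrite [RHS]powRM ?(ltW t0) ?invr_ge0// mulrC; congr (_ * _).
  by rewrite -powR_inv1// -powRrM mulN1r opprK.
apply: ler_powRN; first by rewrite oppr_le0 addr_ge0// mulr_ge0// ltW.
  by rewrite divr_gt0// mulr_gt0.
by rewrite ler_pdivrMr ?mulr_gt0//; apply: le_trans h2 _; rewrite mulrC ler_pM2l//; lra.
Qed.

(** In terms of the endpoint distance [v = u + h], the window reads [v / (2 al) <= u <= v / al]. For
    fixed [v] it is an interval of length [v / (2 al)] on which [u^(-1-2s)] is at most
    [(v / (2 al))^(-1-2s)]; the product is [(2 al)^(2s) v^(-2s)]. *)
Lemma window_shift :
  (\int[leb3]_p (window p * f (p.2.1 + p.1 * 1, p.2.2 + p.1 * 0)%R ^+ 2)%:E <=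
   ((2 * al) `^ (2 * s))%:E * hardyI s a f eps)%E.
Proof.
have mw := measurable_window; have al0 : 0 < al by exact: lt_trans al1.
pose V (p : R * (R * R)) : R := window (p.1, (p.2.1 - p.1, p.2.2)) * f p.2 ^+ 2.
have V0 p : 0 <= V p by rewrite /V mulr_ge0 ?window_ge0 ?sqr_ge0.
have mV : measurable_fun setT V by rewrite /V; meas.
rewrite tonelli3F; last 2 first.
- by meas.
- by move=> p; rewrite lee_fin mulr_ge0 ?window_ge0 ?sqr_ge0.
have -> : (\int[mu]_h \int[leb2]_x (window (h, x) * f (x.1 + h * 1, x.2 + h * 0)%R ^+ 2)%:E =
   \int[mu]_h \int[leb2]_x (V (h, x))%:E)%E.
  apply: eq_integral => h _.
  rewrite -(int_shift2 (h * 1, h * 0) (f := fun x => (V (h, x))%:E)); last 2 first.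
  - by meas.
  - by move=> x; rewrite lee_fin.
  apply: eq_integral => x _; congr (_%:E); rewrite /V /=; congr (window (_, _) * _).
  by case: x => x y /=; rewrite mulr1 mulr0 addr0 addrK.
rewrite -(tonelli3F (f := fun p => (V p)%:E)); last 2 first.
- exact: mfE.
- by move=> p; rewrite lee_fin.
rewrite tonelli3G; last 2 first.
- exact: mfE.
- by move=> p; rewrite lee_fin.
rewrite /hardyI -intRZ ?powR_ge0//; last 2 first.
- by meas.
- by move=> x; case: ifP => // _; rewrite mulr_ge0 ?powR_ge0 ?sqr_ge0.
apply: le_int => x; first by apply: intR_ge0 => h; exact: V0.
pose v := x.1 - a; pose c := (v / (2 * al)) `^ (- (1 + 2 * s)) * f x ^+ 2.
have c0 : 0 <= c by rewrite mulr_ge0 ?powR_ge0 ?sqr_ge0.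
rewrite -/v; case: ifP => ev; last first.
  rewrite mulr0 integral0_eq// => h _; rewrite /V /window/=; case: ifP => [eh|_]; last by rewrite mul0r.
  case: ifP => [/andP[h1 h2]|_]; last by rewrite mul0r.
  have u0 : 0 < x.1 - h - a by exact: lt_trans eh.
  move: ev; rewrite (_ : v = x.1 - h - a + h); last by rewrite /v; ring.
  have : 0 <= h by apply: le_trans h1; rewrite mulr_ge0 ?(ltW u0)// subr_ge0 ltW.
  by move: eh => + + /negP []; lra.
have v0 : 0 < v by exact: lt_trans ev.
have D0 : 0 < 2 * al by rewrite mulr_gt0.
apply: (@le_trans _ _ (\int[mu]_h (if (v - v / al <= h) && (h <= v - v / (2 * al)) then c else 0)%:E)%E).
  apply: le_intR => h; first exact: V0.
  have nn : 0 <= if (v - v / al <= h) && (h <= v - v / (2 * al)) then c else 0 by case: ifP.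
  rewrite {1}/V /window/=; case: ifP => [eh|_]; last by rewrite mul0r.
  case: ifP => [/andP[h1 h2]|_]; last by rewrite mul0r.
  set u := x.1 - h - a in eh h1 h2 *.
  have u0 : 0 < u by exact: lt_trans eh.
  have vu : v = u + h by rewrite /v /u; ring.
  have k1 : u <= v / al by rewrite ler_pdivlMr// mulrC vu; lra.
  have k2 : v / (2 * al) <= u by rewrite ler_pdivrMr// mulrC vu; lra.
  have -> : (v - v / al <= h) && (h <= v - v / (2 * al)) by apply/andP; split; lra.
  rewrite /c; apply: ler_wpM2r; first exact: sqr_ge0.
  apply: ler_powRN => //; last by rewrite divr_gt0.
  by rewrite oppr_le0 addr_ge0// mulr_ge0// ltW.
have vd : v / al - v / (2 * al) = v / (2 * al) by field; rewrite gt_eqF.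
have vd0 : 0 < v / (2 * al) by rewrite divr_gt0.
rewrite int_itv_cst//; last by lra.
rewrite (_ : v - v / (2 * al) - (v - v / al) = v / al - v / (2 * al)); last by ring.
rewrite lee_fin vd /c mulrAC powR_shift// powRM ?invr_ge0 ?(ltW v0) ?(ltW D0)//.
rewrite (_ : (2 * al)^-1 `^ (- (2 * s)) = (2 * al) `^ (2 * s)); first by rewrite [leRHS]mulrCA mulrA.
by rewrite -powR_inv1 ?(ltW D0)// -powRrM mulN1r opprK.
Qed.

End window.

(** By [hardy_const] the reproduced term is at most half of the left-hand side. The resulting
    constant [4 q / al] depends neither on [eps] nor on [a], so the truncation can be removed
    afterwards. *)
Lemma hardy_eps s : 0 < s -> s < 2^-1 -> exists2 C : R, 0 <= C & forall a f eps, 0 < eps ->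
  measurable_fun setT f -> (sqn f < +oo)%E -> (hardyI s a f eps <= C%:E * half_gag s a f)%E.
Proof.
move=> s0 s1; have [al al1 hal] := hardy_const s0 s1.
have al0 : 0 < al by exact: lt_trans al1.
pose q := (2 * al) `^ (1 + 2 * s); have q0 : 0 < q by rewrite powR_gt0// mulr_gt0.
exists (4 * q / al); first by rewrite divr_ge0 ?mulr_ge0 ?(ltW q0) ?(ltW al0).
move=> a f eps e0 mf f2.
have mw := measurable_window s a eps al.
have w0 := window_ge0 s a eps al.
have I1 := window_diag s a e0 al1 mf.
have I2 := window_gag a (eps := eps) s0 e0 al1 mf.
have I3 := window_shift a (eps := eps) s0 e0 al1 mf.
have A0 := hardyI_ge0 s a f eps; have Af := hardyI_fin a s0 e0 mf f2.
have G0 := half_gag_ge0 s a f.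
have key : (al%:E * hardyI s a f eps <= 2%:E * (q%:E * half_gag s a f) +
    2%:E * (((2 * al) `^ (2 * s))%:E * hardyI s a f eps))%E.
  rewrite -I1.
  apply: (@le_trans _ _ (2%:E * \int[leb3]_p (window s a eps al p * (f (p.2.1 + p.1 * 1, p.2.2 + p.1 * 0)%R - f p.2) ^+ 2)%:E +
    2%:E * \int[leb3]_p (window s a eps al p * f (p.2.1 + p.1 * 1, p.2.2 + p.1 * 0)%R ^+ 2)%:E)%E); last first.
    by apply: leeD; apply: lee_wpmul2l.
  rewrite -!intRZ//; last 4 first.
  - by meas.
  - by move=> p; rewrite mulr_ge0 ?sqr_ge0.
  - by meas.
  - by move=> p; rewrite mulr_ge0 ?sqr_ge0.
  rewrite -intRD; last 4 first.
  - by meas.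
  - by meas.
  - by move=> p; rewrite mulr_ge0// mulr_ge0 ?sqr_ge0.
  - by move=> p; rewrite mulr_ge0// mulr_ge0 ?sqr_ge0.
  apply: le_intR => p; first by rewrite mulr_ge0 ?sqr_ge0.
  move: (w0 p) (f _) (f _) => wp x y; have := sqr_ge0 (2 * x - y); nra.
(* Finiteness of the truncated integral reduces the inequality to real numbers, where the absorption
   is a subtraction; an infinite seminorm makes the claim trivial. *)
move: A0 Af G0 key; case: (hardyI _ _ _ _) => [A| |]//= A0 _.
case: (half_gag _ _ _) => [G| |]//= G0; last first.
  by move=> _; rewrite gt0_muley ?leey// lte_fin divr_gt0// mulr_gt0.
rewrite -!EFinM -EFinD !lee_fin in A0 G0 * => key.
have k2 : 2 * ((2 * al) `^ (2 * s) * A) <= al / 2 * A.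
  by rewrite mulrA ler_wpM2r//; lra.
have k3 : al * A <= 4 * (q * G) by lra.
by rewrite mulrAC ler_pdivlMr// mulrC -mulrA.
Qed.

(** Monotone convergence along the thresholds [1 / (n + 1)], whose regions increase to [0 < u x]. *)
Lemma int_cond_limit (F u : R * R -> R) (B : \bar R) : measurable_fun setT F -> measurable_fun setT u ->
  (forall x, 0 <= F x) ->
  (forall n : nat, (\int[leb2]_x (if (n.+1%:R^-1 < u x)%R then F x else 0)%:E <= B)%E) ->
  (\int[leb2]_x (if (0 < u x)%R then F x else 0)%:E <= B)%E.
Proof.
move=> mF mu F0 FB.
pose g (n : nat) (x : R * R) := (if n.+1%:R^-1 < u x then F x else 0)%:E.
have g0 n x : (0 <= g n x)%E by rewrite lee_fin; case: ifP.
have mg n : measurable_fun setT (g n) by rewrite /g; meas.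
have nd x : {homo g ^~ x : m n / (m <= n)%N >-> (m <= n)%E}.
  move=> m n mn; rewrite lee_fin; case: ifP => [h|_]; last by case: ifP.
  by rewrite (le_lt_trans _ h)// lef_pV2 ?posrE ?ltr0Sn// ler_nat ltnS.
have lim x : limn (g ^~ x) = (if 0 < u x then F x else 0)%:E.
  apply/cvg_lim => //; apply: cvg_near_cst; case: ifP => h; last first.
    apply: nearW => n; rewrite /g; case: ifP => // h'.
    by move: h; rewrite (lt_trans _ h')// invr_gt0 ltr0Sn.
  near=> n; rewrite /g ifT//; near: n; exact: near_infty_natSinv_lt (PosNum h).
have := @cvg_monotone_convergence _ _ _ leb2 setT measurableT g.
move=> /(_ (fun n => mg n) (fun n x _ => g0 n x) (fun x _ => nd x)).
under [X in _ --> X -> _]eq_integral do rewrite lim.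
move=> h; rewrite -(cvg_lim _ h)//; apply: lime_le; first by apply/cvg_ex; eexists; exact: h.
by apply: nearW => n; exact: FB.
Unshelve. all: by end_near.
Qed.

Lemma hardy s : 0 < s -> s < 2^-1 -> exists2 C : R, 0 <= C & forall a f,
  measurable_fun setT f -> (sqn f < +oo)%E -> (hardyI s a f 0 <= C%:E * half_gag s a f)%E.
Proof.
move=> s0 s1; have [C C0 H] := hardy_eps s0 s1; exists C => // a f mf f2.
apply: (int_cond_limit (F := fun x => (x.1 - a) `^ (- (2 * s)) * f x ^+ 2) (u := fun x => x.1 - a)).
- by meas.
- by meas.
- by move=> x; rewrite mulr_ge0 ?powR_ge0 ?sqr_ge0.
- by move=> n; apply: H => //; rewrite invr_gt0 ltr0Sn.
Qed.

Definition cut a f : R * R -> R := fun x => if a < x.1 then f x else 0.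

Lemma measurable_cut a f : measurable_fun setT f -> measurable_fun setT (cut a f).
Proof. by move=> mf; rewrite /cut; meas. Qed.

(** A difference of the cut function is an old one inside the half-plane, or straddles the boundary
    and equals the value at its right endpoint [y]. The latter are the steps [h >= y.1 - a], over
    which the kernel integrates to [(y.1 - a)^(-2s) / (2 s)]. *)
Lemma gag_cut s a f : 0 < s -> measurable_fun setT f ->
  (gag s (1, 0)%R (cut a f) <= half_gag s a f + ((2 * s)^-1)%:E * hardyI s a f 0)%E.
Proof.
move=> s0 mf; have mk := measurable_kern s.
(* [W] records a straddling difference by its right endpoint, [V] by its left one; a translation
   identifies their integrals. *)
pose W (p : R * (R * R)) : R := if (0 < p.2.1 - a) && (p.2.1 - a <= p.1) then kern s p.1 * f p.2 ^+ 2 else 0.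
have W0 p : 0 <= W p by rewrite /W; case: ifP => // _; rewrite mulr_ge0 ?kern_ge0 ?sqr_ge0.
have mW : measurable_fun setT W by rewrite /W; meas.
pose V (p : R * (R * R)) : R := W (p.1, (p.2.1 + p.1 * 1, p.2.2 + p.1 * 0)).
have mV : measurable_fun setT V by rewrite /V; meas.
have V0 p : 0 <= V p by exact: W0.
apply: (@le_trans _ _ (half_gag s a f + \int[leb3]_p (V p)%:E)%E).
  rewrite /half_gag -intRD//; last 2 first.
  - exact: measurable_half_gag.
  - by move=> p; exact: half_gag_integrand_ge0.
  apply: le_intR => p; first exact: gag_integrand_ge0.
  have hv := half_gag_integrand_ge0 s a f p.
  have [h0|h0] := leP p.1 0.
    by rewrite {1}/kern ltNge h0/= mul0r addr_ge0.
  rewrite /cut /=; have [ha|ha] := ltP a p.2.1.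
    by rewrite ifT ?lerDl// mulr1; move: ha h0; lra.
  rewrite add0r subr0 /V /W /=; case: ifP => hb; last first.
    by rewrite expr0n mulr0; case: ifP => // _; rewrite mulr_ge0 ?kern_ge0 ?sqr_ge0.
  by rewrite ifT//; apply/andP; split; move: ha hb; rewrite !mulr1; lra.
apply: leeD2l.
rewrite tonelli3F; last 2 first.
- exact: mfE.
- by move=> p; rewrite lee_fin.
have -> : (\int[mu]_h \int[leb2]_x (V (h, x))%:E = \int[mu]_h \int[leb2]_x (W (h, x))%:E)%E.
  apply: eq_integral => h _; rewrite -(int_shift2 (h * 1, h * 0) (f := fun x => (W (h, x))%:E))//.
    by meas.
  by move=> x; rewrite lee_fin.
rewrite -(tonelli3F (f := fun p => (W p)%:E)); last 2 first.
- exact: mfE.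
- by move=> p; rewrite lee_fin.
rewrite tonelli3G; last 2 first.
- exact: mfE.
- by move=> p; rewrite lee_fin.
rewrite /hardyI -intRZ; last 3 first.
- by meas.
- by rewrite invr_ge0 mulr_ge0// ltW.
- by move=> x; case: ifP => // _; rewrite mulr_ge0 ?powR_ge0 ?sqr_ge0.
apply: le_int => x; first by apply: intR_ge0 => h; exact: W0.
rewrite /W/=; case: ifP => h /=; last by rewrite mulr0 integral0_eq.
have -> : (\int[mu]_t (if (x.1 - a <= t)%R then kern s t * f x ^+ 2 else 0)%:E =
    \int[mu]_t (f x ^+ 2 * (if (x.1 - a <= t)%R then kern s t else 0))%:E)%E.
  by apply: eq_integral => t _; case: ifP => _; rewrite ?mulr0// mulrC.
rewrite intRZ ?sqr_ge0//; last 2 first.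
- by meas.
- by move=> t; case: ifP => // _; exact: kern_ge0.
rewrite kern_tail// -EFinM lee_fin; move: (f x ^+ 2) (_ `^ _) => b c; rewrite le_eqVlt; apply/orP; left; apply/eqP; ring.
Qed.

(* [half_gag] in the direction parallel to the boundary of the half-plane. *)
Definition tgag s a f : \bar R :=
  (\int[leb3]_p (if a < p.2.1 then
     kern s p.1 * (f (p.2.1 + p.1 * 0, p.2.2 + p.1 * 1) - f p.2) ^+ 2 else 0)%:E)%E.

Lemma gag_cut_transverse s a f : gag s (0, 1)%R (cut a f) = tgag s a f.
Proof.
apply: eq_integral => p _ /=; congr (_%:E); rewrite /cut /= mulr0 addr0; case: ifP => // _.
by rewrite subrr expr0n mulr0.
Qed.

Lemma sqn_cut a f : sqn (cut a f) = (\int[leb2]_x (if a < x.1 then f x ^+ 2 else 0)%:E)%E.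
Proof. by apply: eq_integral => x _; rewrite /cut; case: ifP => // _; rewrite expr0n. Qed.

Lemma gag0 e f : gag 0 e f = 0%E.
Proof. by apply: integral0_eq => p _; rewrite /kern eqxx andbF mul0r. Qed.

(** The bound is kept in terms of integrals over [a < x.1], rather than [nrm s f], because these
    tend to 0 as [a] grows. *)
Lemma nrm_cut s : 0 <= s -> s < 2^-1 -> exists2 C : R, 0 <= C & forall a f,
  measurable_fun setT f -> (sqn f < +oo)%E ->
  (nrm s (cut a f) <= sqn (cut a f) + (C%:E * half_gag s a f + tgag s a f))%E.
Proof.
rewrite le_eqVlt => /predU1P[<- _|s0 s1].
  by exists 0 => // a f mf f2; rewrite /nrm gag_cut_transverse gag0 mul0e.
have [C C0 H] := hardy s0 s1; exists (1 + (2 * s)^-1 * C).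
  by rewrite addr_ge0// mulr_ge0// invr_ge0 mulr_ge0// ltW.
move=> a f mf f2; rewrite /nrm gag_cut_transverse; apply: leeD2l; apply: leeD2r.
apply: le_trans (gag_cut a s0 mf) _.
have i0 : 0 <= (2 * s)^-1 by rewrite invr_ge0 mulr_ge0// ltW.
rewrite EFinD ge0_muleDl ?lee_fin ?mulr_ge0// mul1e; apply: leeD2l.
by rewrite EFinM -muleA; apply: lee_wpmul2l; [rewrite lee_fin|exact: H].
Qed.

Lemma muleD3 (c x y z : \bar R) : (0 <= x -> 0 <= y -> 0 <= z ->
  c * (x + (y + z)) = c * x + (c * y + c * z))%E.
Proof. by move=> x0 y0 z0; rewrite ge0_muleDr ?adde_ge0// [in LHS]ge0_muleDr. Qed.

Lemma nrm_cut_le s : 0 <= s -> s < 2^-1 -> exists2 C : R, 0 <= C & forall a f,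
  measurable_fun setT f -> (sqn f < +oo)%E -> (nrm s (cut a f) <= C%:E * nrm s f)%E.
Proof.
move=> s0 s1; have [C C0 H] := nrm_cut s0 s1; exists (1 + C); first by rewrite addr_ge0.
move=> a f mf f2; apply: le_trans (H a f mf f2) _.
have C1 : (1%:E <= (1 + C)%:E :> \bar R)%E by rewrite lee_fin lerDl.
have C2 : (0 <= (1 + C)%:E :> \bar R)%E by rewrite lee_fin addr_ge0.
have k1 : (sqn (cut a f) <= sqn f)%E.
  by rewrite sqn_cut; apply: le_intR => x; case: ifP => // _; exact: sqr_ge0.
have k2 : (tgag s a f <= gag s (0, 1)%R f)%E.
  apply: le_intR => p /=; first by case: ifP => // _; rewrite mulr_ge0 ?kern_ge0 ?sqr_ge0.
  by case: ifP => // _; rewrite mulr_ge0 ?kern_ge0 ?sqr_ge0.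
have k3 := half_gag_le s a f.
have up x y : (0 <= y -> x <= y -> x <= (1 + C)%:E * y)%E.
  by move=> y0 xy; apply: le_trans xy _; rewrite -[leLHS]mul1e; apply: lee_wpmul2r.
rewrite /nrm muleD3; try exact: sqn_ge0; try exact: gag_ge0.
apply: leeD; first by apply: up => //; exact: sqn_ge0.
apply: leeD; last by apply: up => //; exact: gag_ge0.
apply: (@le_trans _ _ (C%:E * gag s (1, 0)%R f)%E); first exact: lee_wpmul2l.
by apply: lee_wpmul2r; [exact: gag_ge0|rewrite lee_fin lerDr].
Qed.

Lemma natr_gt_eventually (t : R) : exists N : nat, forall n, (N <= n)%N -> (n%:R < t) = false.
Proof.
exists (Num.Def.archi_bound t) => n Nn; apply/negbTE; rewrite -leNgt.
have [t0|t0] := leP 0 t; last by rewrite (le_trans (ltW t0)).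
by rewrite (le_trans (ltW (archi_boundP t0)))// ler_nat.
Qed.

Lemma cut_vanishing d (T : measurableType d) (m : {measure set T -> \bar R}) (F u : T -> R) :
  measurable_fun setT F -> measurable_fun setT u -> (forall x, 0 <= F x) ->
  (\int[m]_x (F x)%:E < +oo)%E ->
  vanishing (fun n : nat => \int[m]_x (if n%:R < u x then F x else 0)%:E)%E.
Proof.
move=> mF mu F0 iF.
apply: (dominated_vanishing (f := fun n x => (if n%:R < u x then F x else 0)%:E) (g := fun x => (F x)%:E)) => //.
- by move=> n; meas.
- exact: mfE.
- by move=> n x; rewrite !lee_fin; case: ifP => _; rewrite ?F0 ?lexx.
move=> x _ e e0; have [N HN] := natr_gt_eventually (u x); exists N => n Nn.
by rewrite HN// lee_fin ltW.
Qed.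

(** Each integrand in the bound of [nrm_cut] is a restriction of one that is integrable when
    [nrm s f] is finite, to a region escaping to infinity. *)
Lemma nrm_cut_vanishing s f : 0 <= s -> s < 2^-1 -> measurable_fun setT f -> (nrm s f < +oo)%E ->
  vanishing (fun n : nat => nrm s (cut n%:R f)).
Proof.
move=> s0 s1 mf nf; have [C C0 H] := nrm_cut s0 s1.
have f2 : (sqn f < +oo)%E by exact: le_lt_trans (sqn_le_nrm s f) nf.
have g1 : (gag s (1, 0)%R f < +oo)%E.
  apply: le_lt_trans nf; rewrite /nrm addeCA; apply: leeDl.
  by apply: adde_ge0; [exact: sqn_ge0|exact: gag_ge0].
have g2 : (gag s (0, 1)%R f < +oo)%E.
  apply: le_lt_trans nf; rewrite /nrm addeA; apply: leeDr.
  by apply: adde_ge0; [exact: sqn_ge0|exact: gag_ge0].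
have mk := measurable_kern s.
apply: vanishing_le (fun n => H n%:R f mf f2) _; apply: vanishingD.
  have -> : (fun n : nat => sqn (cut n%:R f)) = fun n => (\int[leb2]_x (if n%:R < x.1 then f x ^+ 2 else 0)%:E)%E.
    by apply/funext => n; exact: sqn_cut.
  by apply: (cut_vanishing (m := leb2) (F := fun x => f x ^+ 2) (u := fun x : R * R => x.1)) => //; [meas|meas|move=> x; exact: sqr_ge0].
apply: vanishingD.
  apply: vanishingZ => //.
  apply: (cut_vanishing (m := leb3) (F := fun p => kern s p.1 * (f (p.2.1 + p.1 * 1, p.2.2 + p.1 * 0) - f p.2) ^+ 2)
    (u := fun p : R * (R * R) => p.2.1)) g1.
  - by meas.
  - by meas.
  - by move=> p; rewrite mulr_ge0 ?kern_ge0 ?sqr_ge0.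
apply: (cut_vanishing (m := leb3) (F := fun p => kern s p.1 * (f (p.2.1 + p.1 * 0, p.2.2 + p.1 * 1) - f p.2) ^+ 2)
  (u := fun p : R * (R * R) => p.2.1)) g2.
- by meas.
- by meas.
- by move=> p; rewrite mulr_ge0 ?kern_ge0 ?sqr_ge0.
Qed.

End hardy.

(** * Cuts in both coordinates and translations in the Gagliardo norm *)

Section cuts.
Context {R : realType}.
Local Notation mu := (@lebesgue_measure R).
Local Notation leb2 := (@leb2 R).
Implicit Types (s a : R) (e : R * R) (f g w : R * R -> R).

(** Exchanging the coordinates transfers every result on [cut] to the second axis. *)
Definition swap f : R * R -> R := fun x => f (x.2, x.1).

Lemma measurable_swap f : measurable_fun setT f -> measurable_fun setT (swap f).
Proof. by move=> mf; rewrite /swap; meas. Qed.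

Lemma gag_swap s e f : measurable_fun setT f -> gag s e (swap f) = gag s (e.2, e.1) f.
Proof.
move=> mf; rewrite (gagE _ _ mf) (gagE _ _ (measurable_swap mf)).
apply: eq_integral => t _; congr (_ * _)%E.
rewrite -(sqn_swap (f := fun x => tr (t * e.2, t * e.1) f x - f x))//.
by have mt := measurable_tr (t * e.2, t * e.1) mf; exact: (mfB mt mf).
Qed.

Lemma nrm_swap s f : measurable_fun setT f -> nrm s (swap f) = nrm s f.
Proof.
by move=> mf; rewrite /nrm [sqn (swap f)]sqn_swap// !gag_swap//=; congr (_ + _)%E; rewrite addeC.
Qed.

Definition cut2 a f : R * R -> R := fun x => if a < x.2 then f x else 0.

Lemma measurable_cut2 a f : measurable_fun setT f -> measurable_fun setT (cut2 a f).
Proof. by move=> mf; rewrite /cut2; meas. Qed.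

Lemma cut2E a f : cut2 a f = swap (cut a (swap f)).
Proof. by apply/funext => -[x y]. Qed.

Lemma sqn_cut_le a f : (sqn (cut a f) <= sqn f)%E.
Proof. by rewrite sqn_cut; apply: le_intR => x; case: ifP => // _; exact: sqr_ge0. Qed.

Lemma nrm_cuts_le s : 0 <= s -> s < 2^-1 -> exists2 C : R, 0 <= C & forall a f,
  measurable_fun setT f -> (sqn f < +oo)%E ->
  ((nrm s (cut a f) <= C%:E * nrm s f) /\ (nrm s (cut2 a f) <= C%:E * nrm s f))%E.
Proof.
move=> s0 s1; have [C C0 H] := nrm_cut_le s0 s1; exists C => // a f mf f2; split; first exact: H.
have msf := measurable_swap mf.
rewrite cut2E nrm_swap; last exact: measurable_cut.
by rewrite -(nrm_swap s mf); apply: H => //; rewrite [sqn (swap f)]sqn_swap.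
Qed.

Lemma nrm_cut2_vanishing s f : 0 <= s -> s < 2^-1 -> measurable_fun setT f -> (nrm s f < +oo)%E ->
  vanishing (fun n : nat => nrm s (cut2 n%:R f)).
Proof.
move=> s0 s1 mf nf; have msf := measurable_swap mf.
have -> : (fun n : nat => nrm s (cut2 n%:R f)) = fun n => nrm s (cut n%:R (swap f)).
  by apply/funext => n; rewrite cut2E nrm_swap//; exact: measurable_cut.
by apply: nrm_cut_vanishing => //; rewrite nrm_swap.
Qed.

Definition quad f : R * R -> R := cut 0 (cut2 0 f).

Lemma measurable_quad f : measurable_fun setT f -> measurable_fun setT (quad f).
Proof. by move=> mf; apply: measurable_cut; exact: measurable_cut2. Qed.

Lemma nrm_quad_le s : 0 <= s -> s < 2^-1 -> exists2 C : R, 0 <= C & forall f,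
  measurable_fun setT f -> (sqn f < +oo)%E -> (nrm s (quad f) <= C%:E * nrm s f)%E.
Proof.
move=> s0 s1; have [C C0 H] := nrm_cuts_le s0 s1; exists (C * C); first by rewrite mulr_ge0.
move=> f mf f2; have [_ h1] := H 0 f mf f2.
have mc := measurable_cut2 0 mf.
have c2 : (sqn (cut2 0 f) < +oo)%E.
  have ms := measurable_swap mf.
  have E1 : sqn (cut2 0 f) = sqn (cut 0 (swap f)) by rewrite cut2E; exact: (sqn_swap (measurable_cut 0 ms)).
  have E2 : sqn (swap f) = sqn f by exact: (sqn_swap mf).
  by rewrite E1; apply: le_lt_trans (sqn_cut_le _ _) _; rewrite E2.
have [h2 _] := H 0 (cut2 0 f) mc c2.
by apply: le_trans h2 _; rewrite EFinM -muleA; apply: lee_wpmul2l.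
Qed.

(** Only upper bounds are imposed: [smooth_approximation] applies it to functions that vanish off
    the quadrant. *)
Definition box (n : nat) f : R * R -> R := fun x => if (x.1 <= n%:R) && (x.2 <= n%:R) then f x else 0.

Lemma measurable_box n f : measurable_fun setT f -> measurable_fun setT (box n f).
Proof. by move=> mf; rewrite /box; meas. Qed.

(** By inclusion and exclusion the removed part is [cut n w + cut2 n w - cut2 n (cut n w)]. The last
    term is controlled by the first through the uniform multiplier bound. *)
Lemma box_vanishing s w : 0 <= s -> s < 2^-1 -> measurable_fun setT w -> (nrm s w < +oo)%E ->
  vanishing (fun n => nrm s (fun x => w x - box n w x)).
Proof.
move=> s0 s1 mw nw; have [C C0 H] := nrm_cuts_le s0 s1.
have w2 : (sqn w < +oo)%E by exact: le_lt_trans (sqn_le_nrm s w) nw.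
have v1 := nrm_cut_vanishing s0 s1 mw nw; have v2 := nrm_cut2_vanishing s0 s1 mw nw.
apply: (@vanishing_le _ _ (fun n : nat => 2%:E * (nrm s (cut n%:R w) + 2%:E * (nrm s (cut2 n%:R w) + C%:E * nrm s (cut n%:R w))))%E).
  move=> n; have m1 := measurable_cut n%:R mw; have m2 := measurable_cut2 n%:R mw.
  have m3 := measurable_cut2 n%:R m1.
  have -> : (fun x => w x - box n w x) =
      fun x => cut n%:R w x + (cut2 n%:R w x - cut2 n%:R (cut n%:R w) x).
    apply/funext => x; rewrite /box /cut /cut2 !ltNge.
    by case: (x.1 <= _); case: (x.2 <= _) => /=; ring.
  apply: le_trans (nrmD_le s m1 (mfB m2 m3)) _; apply: lee_wpmul2l => //; apply: leeD2l.
  apply: le_trans (nrmB_le s m2 m3) _; apply: lee_wpmul2l => //; apply: leeD2l.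
  by have [] := H n%:R _ m1 (le_lt_trans (sqn_cut_le _ _) w2).
apply: vanishingZ => //; apply: vanishingD => //; apply: vanishingZ => //.
by apply: vanishingD => //; apply: vanishingZ.
Qed.

Lemma tr_diff_comm (z c : R * R) f :
  (fun x => tr c (fun y => tr z f y - f y) x - (tr z f x - f x)) =
  fun x => tr z (fun y => tr c f y - f y) x - (tr c f x - f x).
Proof.
apply/funext => x; rewrite /tr /= (addrAC x.1 c.1 z.1) (addrAC x.2 c.2 z.2).
by move: (f _) (f _) (f _) (f _) => p q r t; ring.
Qed.

(** Translations commute with differences, so for each step the claim is [L^2] continuity of
    translation for the difference of [w]. The squared norms are at most 4 times those of that
    difference, which dominates the integral over steps. *)
Lemma gag_tr_continuous s e (c : nat -> R * R) w : measurable_fun setT w -> (sqn w < +oo)%E -> (gag s e w < +oo)%E ->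
  (c n).1 @[n --> \oo] --> (0 : R) -> (c n).2 @[n --> \oo] --> (0 : R) ->
  vanishing (fun n => gag s e (fun x => tr (c n) w x - w x)).
Proof.
move=> mw w2 wg c1 c2; have mk := measurable_kern s.
have mt z := measurable_tr z mw.
have md z : measurable_fun setT (fun x => tr z w x - w x) by have mz := mt z; exact: (mfB mz mw).
pose D (n : nat) (h : R) (x : R * R) : R := tr (h * e.1, h * e.2) (fun y => tr (c n) w y - w y) x - (tr (c n) w x - w x).
pose F (n : nat) (h : R) : \bar R := ((kern s h)%:E * sqn (D n h))%E.
have DE n h : D n h = fun x => tr (c n) (fun y => tr (h * e.1, h * e.2) w y - w y) x - (tr (h * e.1, h * e.2) w x - w x).
  exact: tr_diff_comm.
have mF n : measurable_fun setT (F n).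
  by apply: emeasurable_funM; [exact: mfE|exact: measurable_sqn_tr].
have FE n : gag s e (fun x => tr (c n) w x - w x) = (\int[mu]_h F n h)%E by rewrite (gagE _ _ (md (c n))).
rewrite (_ : (fun n => _) = fun n => (\int[mu]_h F n h)%E); last by apply/funext => n; exact: FE.
apply: (dominated_vanishing (m := mu) (f := F) (g := fun h : R => (4%:E * ((kern s h)%:E * sqn (fun x => (tr (h * e.1, h * e.2) w x - w x)%R)))%E)).
- exact: mF.
- apply: emeasurable_funM; first exact: measurable_cst.
  by apply: emeasurable_funM; [exact: mfE|exact: measurable_sqn_tr].
- move=> n h; apply/andP; split; first by rewrite mule_ge0 ?lee_fin ?kern_ge0 ?sqn_ge0.
  rewrite /F DE muleCA; apply: lee_wpmul2l; first by rewrite lee_fin kern_ge0.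
  exact: sqn_tr_bound.
- rewrite ge0_integralZl//; last 2 first.
  + by apply: emeasurable_funM; [exact: mfE|exact: measurable_sqn_tr].
  + by move=> h _; rewrite mule_ge0 ?lee_fin ?kern_ge0 ?sqn_ge0.
  by rewrite -(gagE _ _ mw) lte_mul_pinfty.
- move=> h _; rewrite (_ : F^~ h = fun n => ((kern s h)%:E * sqn (D n h))%E)//.
  apply: vanishingZ; first exact: kern_ge0.
  rewrite (_ : (fun n => _) = fun n => sqn (fun x => tr (c n) (fun y => tr (h * e.1, h * e.2) w y - w y) x - (tr (h * e.1, h * e.2) w x - w x))).
    2: by apply/funext => n; rewrite DE.
  apply: tr_continuous => //.
  by apply: le_lt_trans (sqn_tr_bound _ mw) _; rewrite lte_mul_pinfty.
Qed.

Lemma nrm_tr_continuous s w : measurable_fun setT w -> (nrm s w < +oo)%E ->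
  forall e : R, 0 < e -> exists2 d : R, 0 < d & forall z : R * R, `|z.1| < d -> `|z.2| < d ->
    (nrm s (fun x => (tr z w x - w x)%R) <= e%:E)%E.
Proof.
move=> mw nw; have w2 : (sqn w < +oo)%E by exact: le_lt_trans (sqn_le_nrm s w) nw.
have g1 : (gag s (1, 0)%R w < +oo)%E.
  apply: le_lt_trans nw; rewrite /nrm addeCA; apply: leeDl.
  by apply: adde_ge0; [exact: sqn_ge0|exact: gag_ge0].
have g2 : (gag s (0, 1)%R w < +oo)%E.
  apply: le_lt_trans nw; rewrite /nrm addeA; apply: leeDr.
  by apply: adde_ge0; [exact: sqn_ge0|exact: gag_ge0].
apply: seq_delta => c c1 c2; apply: vanishingD; first exact: tr_continuous.
by apply: vanishingD; exact: gag_tr_continuous.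
Qed.

End cuts.

(** * Mollification *)

Section mollify.
Context {R : realType}.
Local Notation mu := (@lebesgue_measure R).
Local Notation leb2 := (@leb2 R).
Local Notation leb4 := (@leb4 R).
Implicit Types (s : R) (e : R * R) (a b f g v : R * R -> R).

Lemma RintB a b : L1 a -> L1 b ->
  Rintegral leb2 setT (fun x => a x - b x) = Rintegral leb2 setT a - Rintegral leb2 setT b.
Proof. by move=> La Lb; rewrite RintegralB//; exact: L1_integrable. Qed.

Lemma RintZ (r : R) a : L1 a -> Rintegral leb2 setT (fun x => r * a x) = r * Rintegral leb2 setT a.
Proof. by move=> La; rewrite RintegralZl//; exact: L1_integrable. Qed.

Lemma le_Rint a b : L1 a -> L1 b -> (forall x, a x <= b x) ->
  Rintegral leb2 setT a <= Rintegral leb2 setT b.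
Proof. by move=> La Lb ab; apply: le_Rintegral => //; exact: L1_integrable. Qed.

Lemma L1_mul_bounded (M : R) a g : measurable_fun setT g -> (forall x, `|g x| <= M) -> L1 a ->
  L1 (fun x => g x * a x).
Proof.
move=> mg gM [ma ia]; split; first by meas.
have M0 : 0 <= M by exact: le_trans (gM (0, 0)).
apply: (@le_lt_trans _ _ (\int[leb2]_x (M * `|a x|)%:E)%E).
  by apply: le_intR => x //; rewrite normrM ler_wpM2r.
by rewrite intRZ//; [rewrite lte_mul_pinfty|meas].
Qed.

Variable rho : R * R -> R.
Hypotheses (rho0 : forall z, 0 <= rho z) (mrho : measurable_fun setT rho)
  (rho1 : (\int[leb2]_z (rho z)%:E = 1)%E).

Lemma L1_rho : L1 rho.
Proof.
split => //; rewrite (_ : (\int[leb2]_z (`|rho z|)%:E)%E = 1%E) ?ltry// -rho1.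
by apply: eq_integral => z _; rewrite ger0_norm.
Qed.

Lemma Rint_rho : Rintegral leb2 setT rho = 1.
Proof. by rewrite /Rintegral rho1. Qed.

(** With [m] the mean, [rho (g - m)^2 >= 0] gives [rho g^2 >= 2 m rho g - m^2 rho], and the
    right-hand side integrates to [m^2]. *)
Lemma jensen g : measurable_fun setT g -> L1 (fun z => rho z * g z) ->
  (((Rintegral leb2 setT (fun z => rho z * g z)) ^+ 2)%:E <= \int[leb2]_z (rho z * g z ^+ 2)%:E)%E.
Proof.
move=> mg Lg; set m := Rintegral _ _ _.
have p0 z : 0 <= rho z * g z ^+ 2 by rewrite mulr_ge0 ?sqr_ge0.
have [fin|] := ltP (\int[leb2]_z (rho z * g z ^+ 2)%:E)%E +oo%E; last first.
  by rewrite leye_eq => /eqP ->; rewrite leey.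
have L2 : L1 (fun z => rho z * g z ^+ 2).
  split; first by meas.
  by rewrite (_ : (\int[leb2]_z _ = \int[leb2]_z (rho z * g z ^+ 2)%:E)%E)//;
    apply: eq_integral => z _; rewrite ger0_norm.
have L3 : L1 (fun z => 2 * m * (rho z * g z) - m ^+ 2 * rho z).
  by apply: L1B; apply: L1Z => //; exact: L1_rho.
rewrite (Rint_EFin L2) lee_fin.
have -> : m ^+ 2 = Rintegral leb2 setT (fun z => 2 * m * (rho z * g z) - m ^+ 2 * rho z).
  rewrite RintB; [|exact: L1Z|by apply: L1Z; exact: L1_rho].
  by rewrite !RintZ//; [rewrite Rint_rho -/m; ring|exact: L1_rho].
apply: le_Rint => // z; have := mulr_ge0 (rho0 z) (sqr_ge0 (g z - m)); nra.
Qed.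

Lemma measurable_slice (G : R * R -> R * R -> R) z :
  measurable_fun setT (fun p : (R * R) * (R * R) => G p.1 p.2) -> measurable_fun setT (G z).
Proof.
pose Gp (p : (R * R) * (R * R)) := G p.1 p.2; move=> mG; have mGp : measurable_fun setT Gp := mG.
by rewrite (_ : G z = fun x => Gp (z, x))//; meas.
Qed.

Lemma measurable_slice2 (G : R * R -> R * R -> R) x :
  measurable_fun setT (fun p : (R * R) * (R * R) => G p.1 p.2) -> measurable_fun setT (G^~ x).
Proof.
pose Gp (p : (R * R) * (R * R)) := G p.1 p.2; move=> mG; have mGp : measurable_fun setT Gp := mG.
by rewrite (_ : G^~ x = fun z => Gp (z, x))//; meas.
Qed.

Lemma sqn_average (G : R * R -> R * R -> R) v :
  measurable_fun setT (fun p : (R * R) * (R * R) => G p.1 p.2) ->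
  (forall x, L1 (fun z => rho z * G z x)) ->
  (forall x, v x = Rintegral leb2 setT (fun z => rho z * G z x)) ->
  (sqn v <= \int[leb2]_z ((rho z)%:E * sqn (G z)))%E.
Proof.
move=> mG LG vE; pose F (p : (R * R) * (R * R)) : R := rho p.2 * G p.2 p.1 ^+ 2.
have mGz z : measurable_fun setT (G z) by exact: measurable_slice.
have mF : measurable_fun setT F.
  apply: mfM; first exact: (mf_comp mrho measurable_snd).
  pose Gp (p : (R * R) * (R * R)) := G p.1 p.2.
  by apply: mfX; rewrite (_ : (fun p => _) = fun p : (R * R) * (R * R) => Gp (p.2, p.1))//; have mGp' : measurable_fun setT Gp := mG; meas.
have F0 p : 0 <= F p by rewrite mulr_ge0 ?sqr_ge0.
apply: (@le_trans _ _ (\int[leb2]_x \int[leb2]_z (F (x, z))%:E)%E).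
  by apply: le_int => x; [rewrite lee_fin sqr_ge0|rewrite vE; apply: (jensen (g := G^~ x)) => //; exact: measurable_slice2].
rewrite -(tonelli4F (f := fun p => (F p)%:E)); [|exact: mfE|by move=> p; rewrite lee_fin].
rewrite tonelli4G; [|exact: mfE|by move=> p; rewrite lee_fin].
apply: le_int => z; first by apply: intR_ge0 => x; exact: F0.
rewrite /F /= /sqn -intRZ//; last by move=> x; exact: sqr_ge0.
by have mz := mGz z; meas.
Qed.

(** Taking differences commutes with averaging, so [sqn_average] applies for each step and Tonelli
    exchanges step and average. *)
Lemma gag_average s e (G : R * R -> R * R -> R) v :
  measurable_fun setT (fun p : (R * R) * (R * R) => G p.1 p.2) -> measurable_fun setT v ->
  (forall x, L1 (fun z => rho z * G z x)) ->
  (forall x, v x = Rintegral leb2 setT (fun z => rho z * G z x)) ->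
  (gag s e v <= \int[leb2]_z ((rho z)%:E * gag s e (G z)))%E.
Proof.
move=> mG mv LG vE; have mk := measurable_kern s.
have mGz z : measurable_fun setT (G z) by exact: measurable_slice.
pose D (h : R) (z x : R * R) : R := tr (h * e.1, h * e.2) (G z) x - G z x.
pose Gp (p : (R * R) * (R * R)) := G p.1 p.2; have mGp : measurable_fun setT Gp := mG.
have mshift (h : R) : measurable_fun setT (fun p : (R * R) * (R * R) => G p.1 (p.2.1 + h * e.1, p.2.2 + h * e.2)).
  by rewrite (_ : (fun p => _) = fun p : (R * R) * (R * R) => Gp (p.1, (p.2.1 + h * e.1, p.2.2 + h * e.2)))//; meas.
have mD h : measurable_fun setT (fun p : (R * R) * (R * R) => D h p.1 p.2).
  by have m1 := mshift h; exact: (mfB m1 mG).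
pose S (q : R * (R * R)) : \bar R := sqn (D q.1 q.2).
have mS : measurable_fun setT S.
  rewrite /S /sqn; apply: (measurable_int_leb2 (f := fun p : (R * (R * R)) * (R * R) => ((D p.1.1 p.1.2 p.2) ^+ 2)%:E)).
  rewrite (_ : (fun p => _) = fun p : (R * (R * R)) * (R * R) =>
    ((Gp (p.1.2, (p.2.1 + p.1.1 * e.1, p.2.2 + p.1.1 * e.2)) - Gp (p.1.2, p.2)) ^+ 2)%:E)//.
  by meas.
pose T (q : R * (R * R)) : \bar R := ((kern s q.1)%:E * ((rho q.2)%:E * S q))%E.
have mT : measurable_fun setT T.
  apply: emeasurable_funM; first by meas.
  by apply: emeasurable_funM => //; meas.
have T0 q : (0 <= T q)%E by rewrite !mule_ge0 ?lee_fin ?kern_ge0 ?sqn_ge0.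
rewrite (gagE _ _ mv).
apply: (@le_trans _ _ (\int[mu]_h \int[leb2]_z T (h, z))%E).
  apply: le_int => h; first by rewrite mule_ge0 ?lee_fin ?kern_ge0 ?sqn_ge0.
  rewrite /T /= ge0_integralZl//; last 3 first.
  - apply: emeasurable_funM; first by meas.
    by meas.
  - by move=> z _; rewrite mule_ge0 ?lee_fin ?sqn_ge0.
  - by rewrite lee_fin kern_ge0.
  apply: lee_wpmul2l; first by rewrite lee_fin kern_ge0.
  apply: (sqn_average (G := D h)) => // x.
    rewrite (_ : (fun z => _) = fun z => rho z * G z (x.1 + h * e.1, x.2 + h * e.2) - rho z * G z x).
      exact: L1B.
    by apply/funext => z; rewrite /D /tr /= mulrBr.
  rewrite (_ : (fun z => _) = fun z => rho z * G z (x.1 + h * e.1, x.2 + h * e.2) - rho z * G z x).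
    by rewrite RintB// /tr !vE.
  by apply/funext => z; rewrite /D /tr /= mulrBr.
rewrite -(tonelli3F mT T0) (tonelli3G mT T0).
apply: le_int => z; first by apply: integral_ge0.
rewrite (gagE _ _ (mGz z)) -ge0_integralZl//; last 3 first.
- by apply: emeasurable_funM; [exact: mfE|exact: measurable_sqn_tr].
- by move=> h _; rewrite mule_ge0 ?lee_fin ?kern_ge0 ?sqn_ge0.
- by rewrite lee_fin.
apply: le_int => h; first exact: T0.
by rewrite /T /= muleCA.
Qed.

(** The average of [w (x + z)] with weight [rho z]. With the plus sign, a [rho] carried by negative
    coordinates moves supports into the quadrant. *)
Definition mollify w : R * R -> R := fun x => Rintegral leb2 setT (fun z => rho z * tr x w z).

Hypothesis rhoM : exists M : R, forall z, `|rho z| <= M.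

Lemma L1_rho_mul w : L1 w -> L1 (fun z => rho z * w z).
Proof. by move=> Lw; have [M HM] := rhoM; exact: (L1_mul_bounded mrho HM). Qed.

Lemma measurable_mollify w : measurable_fun setT w -> measurable_fun setT (mollify w).
Proof.
move=> mw; apply: (measurable_Rint2 (f := fun p => rho p.2 * tr p.1 w p.2)).
by rewrite /tr; meas.
Qed.

(** Since [rho] has mass 1, [mollify w - w] is the average of [tr z w - w]. Each of the three
    summands of [nrm] is bounded by [eps] separately, hence the factor 3. *)
Lemma nrm_mollify s w (d eps : R) : 0 <= eps -> L1 w ->
  (forall z, rho z != 0 -> `|z.1| < d /\ `|z.2| < d) ->
  (forall z : R * R, `|z.1| < d -> `|z.2| < d -> (nrm s (fun x => (tr z w x - w x)%R) <= eps%:E)%E) ->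
  (nrm s (fun x => (mollify w x - w x)%R) <= (3 * eps)%:E)%E.
Proof.
move=> eps0 Lw supp H; have [mw _] := Lw.
pose G (z x : R * R) := tr z w x - w x.
have mG : measurable_fun setT (fun p : (R * R) * (R * R) => G p.1 p.2) by rewrite /G /tr; meas.
have LG x : L1 (fun z => rho z * G z x).
  rewrite (_ : (fun z => _) = fun z => rho z * tr x w z - w x * rho z).
    by apply: L1B; [apply: L1_rho_mul; exact: L1_tr|apply: L1Z; exact: L1_rho].
  by apply/funext => z; rewrite /G /tr (addrC x.1) (addrC x.2); ring.
have vE x : mollify w x - w x = Rintegral leb2 setT (fun z => rho z * G z x).
  rewrite (_ : (fun z => _) = fun z => rho z * tr x w z - w x * rho z).
    rewrite RintB; [|by apply: L1_rho_mul; exact: L1_tr|by apply: L1Z; exact: L1_rho].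
    by rewrite RintZ ?Rint_rho ?mulr1//; exact: L1_rho.
  by apply/funext => z; rewrite /G /tr (addrC x.1) (addrC x.2); ring.
have mm := measurable_mollify mw.
have mv : measurable_fun setT (fun x => mollify w x - w x) by exact: (mfB mm mw).
have avg (Phi : (R * R -> R) -> \bar R) : (forall f, 0 <= Phi f)%E -> (forall f, Phi f <= nrm s f)%E ->
    (\int[leb2]_z ((rho z)%:E * Phi (G z)) <= eps%:E)%E.
  move=> Phi0 Phin; apply: (@le_trans _ _ (\int[leb2]_z (eps * rho z)%:E)%E).
    apply: le_int => z; first by rewrite mule_ge0 ?lee_fin.
    have [->|rz] := eqVneq (rho z) 0; first by rewrite mul0e mulr0.
    have [z1 z2] := supp z rz; rewrite mulrC EFinM; apply: lee_wpmul2l; first by rewrite lee_fin.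
    by apply: le_trans (Phin _) _; exact: H.
  by rewrite intRZ// rho1 mule1.
have g1 : (gag s (1, 0)%R (fun x => (mollify w x - w x)%R) <= eps%:E)%E.
  apply: le_trans (gag_average s (1, 0) mG mv LG vE) _; apply: avg; first by move=> f; exact: gag_ge0.
  by move=> f; rewrite /nrm addeCA; apply: leeDl; apply: adde_ge0; [exact: sqn_ge0|exact: gag_ge0].
have g2 : (gag s (0, 1)%R (fun x => (mollify w x - w x)%R) <= eps%:E)%E.
  apply: le_trans (gag_average s (0, 1) mG mv LG vE) _; apply: avg; first by move=> f; exact: gag_ge0.
  by move=> f; rewrite /nrm addeA; apply: leeDr; apply: adde_ge0; [exact: sqn_ge0|exact: gag_ge0].
have g0 : (sqn (fun x => (mollify w x - w x)%R) <= eps%:E)%E.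
  by apply: le_trans (sqn_average mG LG vE) _; apply: avg => f; [exact: sqn_ge0|exact: sqn_le_nrm].
rewrite /nrm (_ : 3 * eps = eps + (eps + eps)); last by ring.
by rewrite !EFinD; apply: leeD => //; exact: leeD.
Qed.

End mollify.

(** * Smooth bumps and smoothness of convolutions *)

Section bump.
Context {R : realType}.
Local Notation mu := (@lebesgue_measure R).
Local Notation leb2 := (@leb2 R).
Implicit Types (a b : R -> R) (w : R * R -> R) (p : {poly R}).

(** A quadratic remainder forces the difference quotient to converge. The general domain serves both
    [flat] at 0 on the line and convolutions on the plane. *)
Lemma quadratic_is_derive (V : normedModType R) (f : V -> R) (x v : V) (D K : R) :
  (forall t : R, `|f (t *: v + x) - f x - t * D| <= K * t ^+ 2) -> is_derive x v f D.
Proof.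
move=> H; have cv : (fun t : R => t^-1 *: ((f \o shift x) (t *: v) - f x)) @ 0^' --> D.
  apply/cvgrPdist_le => e e0.
  have K1 : 0 < `|K| + 1 by rewrite ltr_wpDl.
  have e1 : 0 < e / (`|K| + 1) by rewrite divr_gt0.
  near=> t.
  have t0 : t != 0 by near: t; exact: nbhs_dnbhs_neq.
  have te : `|t| < e / (`|K| + 1) by near: t; exact: dnbhs0_lt.
  have -> : D - t^-1 *: ((f \o shift x) (t *: v) - f x) = - t^-1 * (f (t *: v + x) - f x - t * D).
    rewrite -[_ *: _]/(_ * _) /=; move: (f _) (f x) => p q.
    by field.
  rewrite mulNr normrN normrM normfV ler_pdivrMl ?normr_gt0//.
  apply: le_trans (H t) _; rewrite -real_normK ?num_real// expr2 mulrA [leRHS]mulrC.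
  apply: ler_wpM2r => //; apply: (@le_trans _ _ ((`|K| + 1) * `|t|)).
    by apply: ler_wpM2r => //; rewrite (le_trans (ler_norm K))// lerDl.
  by rewrite mulrC -ler_pdivlMr// ltW.
apply: DeriveDef; first by apply/cvg_ex; exists D.
exact: cvg_lim.
Unshelve. all: by end_near.
Qed.

Lemma near_is_derive (f g : R -> R) (x D : R) : (\forall y \near x, g y = f y) ->
  is_derive x 1 g D -> is_derive x 1 f D.
Proof.
move=> gf dg; have dx : derivable g x 1 by exact: ex_derive.
apply: DeriveDef; first exact: near_eq_derivable gf dx.
by rewrite -(near_eq_derive (1 : R) gf) derive_val.
Qed.

Lemma mvt_between a a' : (forall x : R, is_derive x 1 a (a' x)) ->
  forall x y, exists2 c : R, `|c - x| <= `|y - x| & a y - a x = a' c * (y - x).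
Proof.
move=> da x y.
have ca : continuous a.
  by apply: derivable1_continuous => z; have dz := da z; exact: ex_derive.
have [xy|yx|<-] := ltgtP x y; last by exists x; rewrite !subrr ?mulr0.
  have [|c] := @MVT R a a' x y xy; first exact: continuous_subspaceT.
  rewrite in_itv/= => /andP[c1 c2] E; exists c => //.
  by rewrite !gtr0_norm ?subr_gt0// lerD2r ltW.
have [|c] := @MVT R a a' y x yx; first exact: continuous_subspaceT.
rewrite in_itv/= => /andP[c1 c2] E; exists c; last by rewrite -opprB E; ring.
by rewrite !ltr0_norm ?subr_lt0// !opprB lerD2l lerN2 ltW.
Qed.

Lemma lipschitz_of_derive a a' (M : R) : (forall x : R, is_derive x 1 a (a' x)) ->
  (forall x, `|a' x| <= M) -> forall x y, `|a y - a x| <= M * `|y - x|.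
Proof.
by move=> da aM x y; have [c _ ->] := mvt_between da x y; rewrite normrM ler_wpM2r.
Qed.

(** Stated for [u - t] because the variable of a convolution enters its kernel with a minus sign. *)
Lemma taylor_bound a a' a'' (M : R) : (forall x : R, is_derive x 1 a (a' x)) ->
  (forall x : R, is_derive x 1 a' (a'' x)) -> (forall x, `|a'' x| <= M) ->
  forall u t, `|a (u - t) - a u - t * - a' u| <= M * t ^+ 2.
Proof.
move=> da da' aM u t; have [c hc E] := mvt_between da u (u - t).
have ut : u - t - u = - t by ring.
rewrite ut normrN in hc; rewrite E ut.
rewrite (_ : a' c * - t - t * - a' u = - t * (a' c - a' u)); last by ring.
rewrite mulNr normrN normrM -real_normK ?num_real// expr2 mulrA mulrC ler_wpM2r//.
apply: le_trans (lipschitz_of_derive da' aM u c) _.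
by rewrite ler_wpM2l// (le_trans _ (aM 0)).
Qed.

(** Each derivative is asserted to exist rather than computed, so that membership follows from
    closure under sums, products and affine substitutions. The bounds feed the Taylor estimates. *)
Fixpoint bounded_derivatives (n : nat) a : Prop :=
  [/\ continuous a, exists M, forall x, `|a x| <= M &
    if n is m.+1 then exists a', (forall x : R, is_derive x 1 a (a' x)) /\ bounded_derivatives m a'
    else True].
Local Notation BS := bounded_derivatives.

Lemma BS_continuous n a : BS n a -> continuous a. Proof. by case: n => [|n] []. Qed.
Lemma BS_bounded n a : BS n a -> exists M, forall x, `|a x| <= M. Proof. by case: n => [|n] []. Qed.

Lemma BS_derive n a : BS n.+1 a -> exists a', (forall x : R, is_derive x 1 a (a' x)) /\ BS n a'.
Proof. by case. Qed.

Lemma BS_succ n a : BS n.+1 a -> BS n a.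
Proof.
elim: n a => [|n IH] a [ca ba [a' [da ha]]]; first by split.
by split => //; exists a'; split => //; exact: IH.
Qed.

Lemma BSD n a b : BS n a -> BS n b -> BS n (fun x => a x + b x).
Proof.
elim: n a b => [|n IH] a b [ca [M aM] ha] [cb [N bN] hb].
  split => //; first by move=> x; apply: cvgD; [exact: ca|exact: cb].
  by exists (M + N) => x; rewrite (le_trans (ler_normD _ _))// lerD.
split; first by move=> x; apply: cvgD; [exact: ca|exact: cb].
  by exists (M + N) => x; rewrite (le_trans (ler_normD _ _))// lerD.
have [a' [da ka]] := ha; have [b' [db kb]] := hb.
exists (fun x => a' x + b' x); split; last exact: IH.
by move=> x; have dax := da x; have dbx := db x; apply: is_deriveD.
Qed.

Lemma BSM n a b : BS n a -> BS n b -> BS n (fun x => a x * b x).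
Proof.
elim: n a b => [|n IH] a b [ca [M aM] ha] [cb [N bN] hb].
  split => //; first by move=> x; apply: cvgM; [exact: ca|exact: cb].
  by exists (M * N) => x; rewrite normrM ler_pM.
have ka0 : BS n a by apply: BS_succ; split => //; exists M.
have kb0 : BS n b by apply: BS_succ; split => //; exists N.
split; first by move=> x; apply: cvgM; [exact: ca|exact: cb].
  by exists (M * N) => x; rewrite normrM ler_pM.
have [a' [da ka]] := ha; have [b' [db kb]] := hb.
exists (fun x => a x * b' x + b x * a' x); split; last by apply: BSD; exact: IH.
by move=> x; have dax := da x; have dbx := db x; apply: is_deriveM.
Qed.

Lemma BS_cst n (c : R) : BS n (fun=> c).
Proof.
elim: n c => [|n IH] c; split => //; try (by move=> x; exact: cvg_cst); try (by exists `|c|).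
by exists (fun=> 0); split => // x; exact: is_derive_cst.
Qed.

Lemma BSZ n (c : R) a : BS n a -> BS n (fun x => c * a x).
Proof. by move=> h; apply: BSM => //; exact: BS_cst. Qed.

Lemma BS_affine n (c k : R) a : BS n a -> BS n (fun x => a (c * x + k)).
Proof.
have cl : continuous (fun x : R => c * x + k).
  by move=> x; apply: cvgD; [apply: cvgM; [exact: cvg_cst|exact: cvg_id]|exact: cvg_cst].
elim: n a => [|n IH] a [ca [M aM] ha].
  by split => //; [move=> x; apply: continuous_comp; [exact: cl|exact: ca]|exists M].
split => //; [by move=> x; apply: continuous_comp; [exact: cl|exact: ca]|by exists M|].
have [a' [da ka]] := ha; exists (fun x => c * a' (c * x + k)); split; last by apply: BSZ; exact: IH.
move=> x; have dl : is_derive x 1 (fun x : R => c * x + k) c.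
  by apply: is_derive_eq; rewrite -![_ *: _]/(_ * _); ring.
have d1 := da (c * x + k).
by rewrite mulrC; exact: (is_derive1_comp (f := a) (g := fun x : R => c * x + k) (x := x) (a := a' (c * x + k)) (b := c)).
Qed.

(** From [s / k <= exp (s / k)], raised to the power [k]; for [k = 0] the constant is [0^0 = 1]. *)
Lemma power_exp_bound (k : nat) : exists C : R, forall s, 0 < s -> s ^+ k * expR (- s) <= C.
Proof.
exists (k%:R ^+ k) => s s0; case: k => [|k]; first by rewrite !expr0 mul1r -expR0 ler_expR oppr_le0 ltW.
have k0 : (0 : R) < k.+1%:R by rewrite ltr0Sn.
have -> : expR (- s) = expR (- (s / k.+1%:R)) ^+ k.+1.
  by rewrite -expRM_natl; congr expR; field; rewrite gt_eqF.
rewrite -exprMn; apply: lerXn2r; rewrite ?nnegrE ?mulr_ge0 ?expR_ge0 ?(ltW s0)// ltW//.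
rewrite expRN ltr_pdivrMr ?expR_gt0//.
rewrite -ltr_pdivrMl// mulrC; apply: lt_le_trans (expR_ge1Dx _).
by rewrite ltrDr.
Qed.

(** The power of [s] is generalised because the induction on [p] multiplies by the variable, which
    raises [k] by one. *)
Lemma poly_exp_bound p (k : nat) : exists C : R, forall s, 0 < s ->
  `|p.[s]| * s ^+ k * expR (- s) <= C.
Proof.
elim/poly_ind: p k => [|p c IH] k; first by exists 0 => s _; rewrite horner0 normr0 !mul0r.
have [C HC] := IH k.+1; have [D HD] := power_exp_bound k.
exists (C + `|c| * D) => s s0; rewrite hornerMXaddC.
have h1 := HC s s0; have h2 := HD s s0.
apply: (@le_trans _ _ ((`|p.[s]| * s + `|c|) * s ^+ k * expR (- s))).
  rewrite ler_wpM2r ?expR_ge0// ler_wpM2r ?exprn_ge0 ?(ltW s0)//.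
  by rewrite (le_trans (ler_normD _ _))// normrM (gtr0_norm s0).
have -> : (`|p.[s]| * s + `|c|) * s ^+ k * expR (- s) =
  `|p.[s]| * s ^+ k.+1 * expR (- s) + `|c| * (s ^+ k * expR (- s)) by rewrite exprS; ring.
by rewrite lerD// ler_wpM2l.
Qed.

(* The functions [p (1/t) exp (-1/t)] are closed under differentiation. *)
Definition flat p (t : R) : R := if 0 < t then p.[t^-1] * expR (- t^-1) else 0.

(** This is [poly_exp_bound] at [s = 1 / t]. Order 0 gives boundedness, order 2 the derivative at
    the origin. *)
Lemma flat_bound p (k : nat) : exists C : R, forall t, `|flat p t| <= C * `|t| ^+ k.
Proof.
have [C HC] := poly_exp_bound p k; exists C => t; rewrite /flat.
have C0 : 0 <= C.
  by apply: le_trans (HC 1 ltr01); rewrite !mulr_ge0 ?expR_ge0// exprn_ge0.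
case: ifP => t0; last by rewrite normr0 mulr_ge0 ?exprn_ge0.
have ti : 0 < t^-1 by rewrite invr_gt0.
have := HC _ ti; rewrite (gtr0_norm t0) normrM (ger0_norm (expR_ge0 _)).
rewrite exprVn mulrAC ler_pdivrMr ?exprn_gt0//.
Qed.

Lemma flat_derive p (t : R) : is_derive t 1 (flat p) (flat ('X^2 * (p - p^`())) t).
Proof.
case: (ltrgtP t 0) => [tn|tp|->].
- rewrite (_ : flat (_ * _) t = 0); last by rewrite /flat ltNge (ltW tn).
  apply: (near_is_derive (g := cst 0)).
  by near=> y; rewrite /flat ltNge ltW//; near: y; exact: lt_nbhsl.
- apply: (near_is_derive (g := fun y => p.[y^-1] * expR (- y^-1))).
    by near=> y; rewrite /flat ifT//; near: y; exact: lt_nbhsr.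
  have t0 : t != 0 by rewrite gt_eqF.
  have dV : is_derive t 1 (fun y : R => y^-1) (- t ^- 2).
    by have := is_deriveV t0 (is_derive_id t (1 : R)); rewrite -[_ *: _]/(_ * _) mulr1.
  have d1 : is_derive t 1 (fun y : R => p.[y^-1]) (- t ^- 2 * p^`().[t^-1]).
    by rewrite mulrC; exact: (is_derive1_comp (f := horner p) (g := fun y : R => y^-1) (x := t) (a := p^`().[t^-1]) (b := - t ^- 2)).
  have d2 : is_derive t 1 (fun y : R => expR (- y^-1)) (t ^- 2 * expR (- t^-1)).
    have dN : is_derive t 1 (fun y : R => - y^-1) (t ^- 2) by have := is_deriveN dV; rewrite opprK.
    by rewrite mulrC; exact: (is_derive1_comp (f := expR) (g := fun y : R => - y^-1) (x := t) (a := expR (- t^-1)) (b := t ^- 2)).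
  apply: is_derive_eq; rewrite /flat tp -![_ *: _]/(_ * _).
  by rewrite hornerM hornerXn hornerD hornerN exprVn; ring.
- rewrite (_ : flat (_ * _) 0 = 0); last by rewrite /flat ltxx.
  have [C HC] := flat_bound p 2; apply: (@quadratic_is_derive _ _ _ _ _ C) => h.
  rewrite -[_ *: _]/(_ * _) mulr1 addr0 mulr0 subr0 (_ : flat p 0 = 0); last by rewrite /flat ltxx.
  by rewrite subr0; apply: le_trans (HC h) _; rewrite real_normK ?num_real.
Unshelve. all: by end_near.
Qed.

Lemma flat_bounded_derivatives n p : BS n (flat p).
Proof.
have c p' : continuous (flat p').
  by apply: derivable1_continuous => t; have dt := flat_derive p' t; exact: ex_derive.
have b p' : exists M, forall x, `|flat p' x| <= M.
  by have [C HC] := flat_bound p' 0; exists C => x; have := HC x; rewrite expr0 mulr1.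
elim: n p => [|n IH] p; split => //; exists (flat ('X^2 * (p - p^`()))); split => //.
by move=> x; exact: flat_derive.
Qed.

Lemma flat1E (t : R) : flat 1 t = if 0 < t then expR (- t^-1) else 0.
Proof. by rewrite /flat hornerC mul1r. Qed.

Lemma flat1_ge0 (t : R) : 0 <= flat 1 t.
Proof. by rewrite flat1E; case: ifP => // _; exact: expR_ge0. Qed.

Lemma flat1_le1 (t : R) : flat 1 t <= 1.
Proof.
rewrite flat1E; case: ifP => // t0.
by rewrite -expR0 ler_expR oppr_le0 invr_ge0 ltW.
Qed.

Lemma flat1_ge (c t : R) : 0 < c -> c <= t -> expR (- c^-1) <= flat 1 t.
Proof.
move=> c0 ct; have t0 : 0 < t by exact: lt_le_trans ct.
by rewrite flat1E t0 ler_expR lerN2 lef_pV2.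
Qed.

(** The product of [flat 1] at [t + 2 d] and at [- d - t] is positive exactly on []-2d, -d[];
    dividing by its integral normalises it. *)
Lemma bump_exists (d : R) : 0 < d -> exists eta : R -> R,
  [/\ forall n, BS n eta, forall t, 0 <= eta t, forall t, eta t != 0 -> - (2 * d) < t /\ t < - d
    & (\int[mu]_t (eta t)%:E = 1)%E].
Proof.
move=> d0; pose f (t : R) := flat 1 (t + 2 * d) * flat 1 (- d - t).
have Bf n : BS n f.
  have B1 := BS_affine 1 (2 * d) (flat_bounded_derivatives n 1).
  have B2 := BS_affine (- 1) (- d) (flat_bounded_derivatives n 1).
  rewrite (_ : f = fun t => flat 1 (1 * t + 2 * d) * flat 1 (- 1 * t + - d)); first exact: BSM.
  by apply/funext => t; rewrite /f mul1r mulN1r (addrC (- t)).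
have f0 t : 0 <= f t by rewrite mulr_ge0 ?flat1_ge0.
have supp t : f t != 0 -> - (2 * d) < t /\ t < - d.
  rewrite /f !flat1E; case: ifP => h1; last by rewrite mul0r eqxx.
  case: ifP => h2; last by rewrite mulr0 eqxx.
  by split; move: h1 h2; lra.
have mf : measurable_fun setT f by apply: continuous_measurable_fun; exact: BS_continuous (Bf 0%N).
(* On [[-7d/4, -5d/4]] both arguments are at least [d / 4], so [c] bounds the product below and the
   integral is positive. *)
pose c := expR (- (d / 4)^-1) ^+ 2.
have c0 : 0 < c by rewrite exprn_gt0// expR_gt0.
have lb : ((c * (d / 2))%:E <= \int[mu]_t (f t)%:E)%E.
  rewrite (_ : d / 2 = - (5 / 4 * d) - - (7 / 4 * d)); last by field.
  rewrite -int_itv_cst ?(ltW c0)//; last by lra.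
  apply: le_intR => t; first by case: ifP => // _; exact: ltW.
  case: ifP => // /andP[t1 t2]; rewrite /c expr2 /f.
  by apply: ler_pM; rewrite ?expR_ge0//; apply: flat1_ge; lra.
have ub : (\int[mu]_t (f t)%:E <= d%:E)%E.
  rewrite (_ : d = 1 * (- d - - (2 * d))); last by ring.
  rewrite -int_itv_cst//; last by lra.
  apply: le_intR => // t; have [->|/supp[t1 t2]] := eqVneq (f t) 0; first by case: ifP.
  by rewrite (ltW t1) (ltW t2)/= /f mulr_ile1 ?flat1_ge0 ?flat1_le1.
have [I IE] : exists I : R, (\int[mu]_t (f t)%:E = I%:E)%E.
  by move: lb ub; case: (integral _ _ _) => [r| |]//; exists r.
have I0 : 0 < I by move: lb; rewrite IE lee_fin; apply: lt_le_trans; rewrite mulr_gt0// divr_gt0.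
exists (fun t => I^-1 * f t); split.
- by move=> n; exact: BSZ.
- by move=> t; rewrite mulr_ge0// invr_ge0 ltW.
- by move=> t h; apply: supp; apply: contra_neq h => ->; rewrite mulr0.
- by rewrite intRZ ?invr_ge0 ?(ltW I0)// IE -EFinM mulVf// gt_eqF.
Qed.

Lemma norm_Rint_le (f g : R * R -> R) : L1 f -> L1 g -> (forall x, `|f x| <= g x) ->
  `|Rintegral leb2 setT f| <= Rintegral leb2 setT g.
Proof.
move=> Lf Lg fg; apply: le_trans (le_normr_Rintegral _ (L1_integrable Lf)) _ => //.
have Ln : L1 (fun x => `|f x|).
  by have [mf jf] := Lf; split; [meas|under eq_integral do rewrite normr_id].
exact: le_Rint.
Qed.

Lemma L1_norm w : L1 w -> L1 (fun x => `|w x|).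
Proof. by move=> [mw jw]; split; [meas|under eq_integral do rewrite normr_id]. Qed.

Implicit Types k : R * R -> R.

(** The same average as [mollify], after [y = x + z]: now [x] occurs only in the kernel, where it
    can be differentiated. *)
Definition conv k w : R * R -> R := fun x =>
  Rintegral leb2 setT (fun y => k (y.1 - x.1, y.2 - x.2) * w y).

Lemma L1_conv k (M : R) w x : measurable_fun setT k -> (forall u, `|k u| <= M) -> L1 w ->
  L1 (fun y => k (y.1 - x.1, y.2 - x.2) * w y).
Proof. by move=> mk kM Lw; apply: (L1_mul_bounded (M := M)) => //; meas. Qed.

(** The uniform quadratic remainder of the kernel, integrated against [|w|], is a quadratic
    remainder of the convolution. Since [x] enters through [y - x], [k'] is the derivative of [k]
    along [-v]. *)
Lemma conv_is_derive k k' (M M' C : R) (v : R * R) w :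
  measurable_fun setT k -> (forall u, `|k u| <= M) ->
  measurable_fun setT k' -> (forall u, `|k' u| <= M') ->
  (forall u t, `|k (u.1 - t * v.1, u.2 - t * v.2) - k u - t * k' u| <= C * t ^+ 2) -> L1 w ->
  forall x, is_derive x v (conv k w) (conv k' w x).
Proof.
move=> mk kM mk' kM' H Lw x; have Ln := L1_norm Lw.
apply: (@quadratic_is_derive _ _ _ _ _ (C * Rintegral leb2 setT (fun y => `|w y|))) => t.
have I1 := L1_conv (t *: v + x) mk kM Lw; have I2 := L1_conv x mk kM Lw; have I3 := L1_conv x mk' kM' Lw.
rewrite /conv -(RintB I1 I2) -(RintZ t I3) -RintB; [|exact: L1B|exact: L1Z].
rewrite mulrAC -(RintZ _ Ln); apply: norm_Rint_le; [by apply: L1B; [exact: L1B|exact: L1Z]|exact: L1Z|].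
move=> y /=; rewrite mulrA -!mulrBl normrM; apply: ler_wpM2r => //.
have := H (y.1 - x.1, y.2 - x.2) t; rewrite /= -![_ *: _]/(_ * _).
rewrite (_ : y.1 - (t * v.1 + x.1) = y.1 - x.1 - t * v.1); last by ring.
by rewrite (_ : y.2 - (t * v.2 + x.2) = y.2 - x.2 - t * v.2)//; ring.
Qed.

Lemma conv_continuous k (M C : R) w : measurable_fun setT k -> (forall u, `|k u| <= M) -> 0 <= C ->
  (forall u u', `|k u - k u'| <= C * (`|u.1 - u'.1| + `|u.2 - u'.2|)) -> L1 w -> continuous (conv k w).
Proof.
move=> mk kM C0 H Lw x; have Ln := L1_norm Lw.
pose K := C * Rintegral leb2 setT (fun y => `|w y|).
have K0 : 0 <= K by rewrite mulr_ge0//; apply: Rintegral_ge0.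
have lip x' : `|conv k w x - conv k w x'| <= K * (`|x.1 - x'.1| + `|x.2 - x'.2|).
  have I1 := L1_conv x mk kM Lw; have I2 := L1_conv x' mk kM Lw.
  rewrite /conv -(RintB I1 I2) /K mulrAC -(RintZ _ Ln); apply: norm_Rint_le; [exact: L1B|exact: L1Z|].
  move=> y; rewrite -mulrBl normrM; apply: ler_wpM2r => //.
  apply: le_trans (H _ _) _ => /=.
  rewrite (_ : y.1 - x.1 - (y.1 - x'.1) = - (x.1 - x'.1)); last by ring.
  by rewrite (_ : y.2 - x.2 - (y.2 - x'.2) = - (x.2 - x'.2)) ?normrN//; ring.
apply/cvgrPdist_le => e e0.
have K1 : 0 < 2 * (K + 1) by rewrite mulr_gt0// ltr_wpDl.
have r0 : 0 < e / (2 * (K + 1)) by rewrite divr_gt0.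
exists (ball x.1 (e / (2 * (K + 1))), ball x.2 (e / (2 * (K + 1)))).
  by split; exact: nbhsx_ballx.
move=> x' [b1 b2] /=.
apply: le_trans (lip x') _.
have {}b1 : `|x.1 - x'.1| < e / (2 * (K + 1)) by exact: b1.
have {}b2 : `|x.2 - x'.2| < e / (2 * (K + 1)) by exact: b2.
apply: (@le_trans _ _ ((K + 1) * (e / (2 * (K + 1)) + e / (2 * (K + 1))))).
  apply: ler_pM => //; first by rewrite lerDl.
  by rewrite lerD// ltW.
by rewrite le_eqVlt; apply/orP; left; apply/eqP; field; rewrite gt_eqF// ltr_wpDl.
Qed.

Definition tensor a b : R * R -> R := fun u => a u.1 * b u.2.

Lemma measurable_BS n a : BS n a -> measurable_fun setT a.
Proof. by move=> /BS_continuous; exact: continuous_measurable_fun. Qed.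

Lemma measurable_tensor n a b : BS n a -> BS n b -> measurable_fun setT (tensor a b).
Proof.
by move=> Ba Bb; have ma := measurable_BS Ba; have mb := measurable_BS Bb; rewrite /tensor; meas.
Qed.

Lemma tensor_bounded n a b : BS n a -> BS n b -> exists M, forall u, `|tensor a b u| <= M.
Proof.
move=> /BS_bounded[M aM] /BS_bounded[N bN]; exists (M * N) => u.
by rewrite /tensor normrM ler_pM.
Qed.

(** Each differentiation of the convolution uses up one derivative of the kernel and needs a bound
    on the next for the Taylor remainder, whence the two extra orders. *)
Lemma Ck_conv n a b w : BS n.+2 a -> BS n.+2 b -> L1 w -> Ck n (conv (tensor a b) w).
Proof.
have bound0 (f : R -> R) M : (forall x, `|f x| <= M) -> 0 <= M by move=> /(_ 0); exact: le_trans.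
have cont m f g : BS m.+2 f -> BS m.+2 g -> L1 w -> continuous (conv (tensor f g) w).
  move=> Bf Bg Lw; have [M HM] := tensor_bounded Bf Bg.
  have [f' [df Bf']] := BS_derive Bf; have [g' [dg Bg']] := BS_derive Bg.
  have [Mf fM] := BS_bounded Bf; have [Mg gM] := BS_bounded Bg.
  have [Mf' fM'] := BS_bounded Bf'; have [Mg' gM'] := BS_bounded Bg'.
  have q1 := bound0 _ _ fM; have q2 := bound0 _ _ gM; have q3 := bound0 _ _ fM'; have q4 := bound0 _ _ gM'.
  apply: (conv_continuous (measurable_tensor Bf Bg) HM (C := Mf' * Mg + Mf * Mg')) => //.
    by rewrite addr_ge0 ?mulr_ge0.
  move=> u u'; rewrite /tensor.
  have l1 := lipschitz_of_derive df fM' u'.1 u.1; have l2 := lipschitz_of_derive dg gM' u'.2 u.2.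
  rewrite (_ : _ - _ = (f u.1 - f u'.1) * g u.2 + f u'.1 * (g u.2 - g u'.2)); last by ring.
  apply: le_trans (ler_normD _ _) _; rewrite !normrM.
  have h1 : `|f u.1 - f u'.1| * `|g u.2| <= Mf' * `|u.1 - u'.1| * Mg by apply: ler_pM.
  have h2 : `|f u'.1| * `|g u.2 - g u'.2| <= Mf * (Mg' * `|u.2 - u'.2|) by apply: ler_pM.
  apply: le_trans (lerD h1 h2) _; rewrite mulrDr !mulrDl.
  have k1 : 0 <= Mf * Mg' * `|u.1 - u'.1| by rewrite !mulr_ge0.
  have k2 : 0 <= Mf' * Mg * `|u.2 - u'.2| by rewrite !mulr_ge0.
  lra.
elim: n a b => [|n IH] a b Ba Bb Lw; first exact: (cont 0%N).
have [M HM] := tensor_bounded Ba Bb; have mt := measurable_tensor Ba Bb.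
have [a' [da Ba']] := BS_derive Ba; have [b' [db Bb']] := BS_derive Bb.
have [a'' [da' Ba'']] := BS_derive Ba'; have [b'' [db' Bb'']] := BS_derive Bb'.
(* The factor [-1] reflects the sign of [x] in the kernel. *)
have Na' : BS n.+2 (fun t => -1 * a' t) by exact: BSZ.
have Nb' : BS n.+2 (fun t => -1 * b' t) by exact: BSZ.
have a2 := BS_succ Ba; have b2 := BS_succ Bb.
have [Ma aM] := BS_bounded Ba; have [Mb bM] := BS_bounded Bb.
have [Ma' aM'] := BS_bounded Ba''; have [Mb' bM'] := BS_bounded Bb''.
have D1 (x : R * R) : is_derive x ((1, 0) : R * R) (conv (tensor a b) w) (conv (tensor (fun t => -1 * a' t) b) w x).
  have [M' HM'] := tensor_bounded Na' b2.
  apply: (conv_is_derive mt HM (measurable_tensor Na' b2) HM' (C := Ma' * Mb)) => // u t /=.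
  rewrite mulr1 mulr0 subr0 /tensor /=.
  have := taylor_bound da da' aM' u.1 t.
  rewrite (_ : a (u.1 - t) * b u.2 - _ - _ = (a (u.1 - t) - a u.1 - t * - a' u.1) * b u.2); last by ring.
  by move=> h; rewrite normrM mulrAC ler_pM.
have D2 (x : R * R) : is_derive x ((0, 1) : R * R) (conv (tensor a b) w) (conv (tensor a (fun t => -1 * b' t)) w x).
  have [M' HM'] := tensor_bounded a2 Nb'.
  apply: (conv_is_derive mt HM (measurable_tensor a2 Nb') HM' (C := Mb' * Ma)) => // u t /=.
  rewrite mulr1 mulr0 subr0 /tensor /=.
  have := taylor_bound db db' bM' u.2 t.
  rewrite (_ : a u.1 * b (u.2 - t) - _ - _ = (b (u.2 - t) - b u.2 - t * - b' u.2) * a u.1); last by ring.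
  by move=> h; rewrite normrM mulrAC ler_pM.
split; first exact: (cont n.+1).
- split; first by move=> x; have dx := D1 x; exact: ex_derive.
  rewrite (_ : (fun x => _) = conv (tensor (fun t => -1 * a' t) b) w); first exact: IH.
  by apply/funext => x; have dx := D1 x; rewrite derive_val.
- split; first by move=> x; have dx := D2 x; exact: ex_derive.
  rewrite (_ : (fun x => _) = conv (tensor a (fun t => -1 * b' t)) w); first exact: IH.
  by apply/funext => x; have dx := D2 x; rewrite derive_val.
Qed.

Lemma mollify_conv k w : measurable_fun setT k -> L1 w -> mollify k w = conv k w.
Proof.
move=> mk [mw _]; apply/funext => x; rewrite /mollify /conv.
rewrite -(Rint_shift x (a := fun y => k (y.1 - x.1, y.2 - x.2) * w y)); last by meas.
by apply: eq_Rintegral => z _; rewrite /tr /= !addrK; case: z.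
Qed.

End bump.

(** * Density and the zero extension *)

Section density.
Context {R : realType}.
Local Notation mu := (@lebesgue_measure R).
Local Notation leb2 := (@leb2 R).
Local Notation Re := (@complex.Re R).
Local Notation Im := (@complex.Im R).
Implicit Types (s : R) (w : R * R -> R) (phi psi u : R * R -> R[i]).

Lemma box_L1 n w : measurable_fun setT w -> (sqn w < +oo)%E ->
  (forall x, w x != 0 -> in_box n x) -> L1 w.
Proof.
move=> mw w2 supp; split => //; have mb := @measurable_in_box R n.
apply: (@le_lt_trans _ _ (\int[leb2]_x ((if in_box n x then 1 else 0) + w x ^+ 2)%:E)%E).
  apply: le_intR => x //; have [->|w0] := eqVneq (w x) 0.
    by rewrite normr0 addr_ge0 ?sqr_ge0//; case: ifP.
  rewrite supp// -[w x ^+ 2]real_normK ?num_real//.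
  by have := sqr_ge0 (`|w x| - 1); have := sqr_ge0 (`|w x|); nra.
rewrite intRD; last 4 first.
- by meas.
- by meas.
- by move=> x; case: ifP.
- by move=> x; exact: sqr_ge0.
by rewrite lte_add_pinfty// box_integral.
Qed.

Lemma smooth_approximation s w (eps : R) : 0 <= s -> s < 2^-1 -> 0 < eps ->
  measurable_fun setT w -> (nrm s w < +oo)%E -> (forall x, w x != 0 -> 0 < x.1 /\ 0 < x.2) ->
  exists g : R * R -> R, exists d N : R, [/\ measurable_fun setT g, forall n, Ck n g, 0 < d,
    forall x, g x != 0 -> (d <= x.1 <= N) && (d <= x.2 <= N)
    & (nrm s (fun x => (w x - g x)%R) <= eps%:E)%E].
Proof.
move=> s0 s1 e0 mw nw supp.
(* The cutoff costs [eps / 4], the mollification [3 (eps / 12) = eps / 4], and [nrmB_le] doubles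
   their sum. *)
have e4 : 0 < eps / 4 by rewrite divr_gt0.
have [n0 Hn] := box_vanishing s0 s1 mw nw e4; have {Hn} Hn := Hn _ (leqnn n0).
pose w' := box n0 w; have mw' : measurable_fun setT w' := measurable_box n0 mw.
have md : measurable_fun setT (fun x => w x - w' x) by exact: (mfB mw mw').
have nw' : (nrm s w' < +oo)%E.
  rewrite (_ : w' = fun x => w x - (w x - w' x)); last by apply/funext => x; ring.
  apply: le_lt_trans (nrmB_le s mw md) _; rewrite lte_mul_pinfty// lte_add_pinfty//.
  by apply: le_lt_trans Hn _; rewrite ltry.
have supp' x : w' x != 0 -> [/\ 0 < x.1, 0 < x.2, x.1 <= n0%:R & x.2 <= n0%:R].
  rewrite /w' /box; case: ifP => [/andP[h1 h2] /supp[]|]; last by rewrite eqxx.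
  by split.
have Lw' : L1 w'.
  apply: (box_L1 (n := n0)) => //; first by exact: le_lt_trans (sqn_le_nrm s w') nw'.
  move=> x /supp'[h1 h2 h3 h4]; rewrite /in_box !gtr0_norm// h3 h4//.
have e12 : 0 < eps / 12 by rewrite divr_gt0.
have [d d0 Hd] := nrm_tr_continuous mw' nw' e12.
have d2 : 0 < d / 2 by rewrite divr_gt0.
(* With parameter [d / 2] the shifts lie strictly between [-d] and [-d/2]: small enough for the
   translation estimate, and far enough to keep the new support at distance [d / 2] from the
   axes. *)
have [eta [Beta eta0 etas eta1]] := bump_exists d2.
pose rho := tensor eta eta.
have mrho : measurable_fun setT rho := measurable_tensor (Beta 0%N) (Beta 0%N).
have meta := measurable_BS (Beta 0%N).
have rho0 z : 0 <= rho z by rewrite /rho /tensor mulr_ge0.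
have rhoM := tensor_bounded (Beta 0%N) (Beta 0%N).
have rho1 : (\int[leb2]_z (rho z)%:E = 1)%E.
  rewrite tonelli2F; [|exact: mfE|by move=> z; rewrite lee_fin].
  rewrite -eta1; apply: eq_integral => x _; rewrite /rho /tensor/= intRZ//.
  by rewrite eta1 mule1.
have rhos z : rho z != 0 -> (- d < z.1 /\ z.1 < - (d / 2)) /\ (- d < z.2 /\ z.2 < - (d / 2)).
  rewrite /rho /tensor mulf_eq0 negb_or => /andP[/etas[h1 h2] /etas[h3 h4]].
  by move: h1 h3; rewrite (_ : 2 * (d / 2) = d)//; field.
exists (mollify rho w'), (d / 2), (n0%:R + d); split => //.
- exact: measurable_mollify.
- move=> n; rewrite mollify_conv//; exact: Ck_conv.
- move=> x; apply: contraR => hx; rewrite /mollify; apply/eqP.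
  rewrite (_ : (fun z => _) = fun=> 0); last first.
    apply/funext => z; apply/eqP; rewrite mulf_eq0 -[_ || _]negbK negb_or.
    apply: contra hx => /andP[/rhos[[z1 z2] [z3 z4]]]; rewrite /tr => /supp'[/= a1 a2 a3 a4].
    by apply/andP; split; apply/andP; split; lra.
  by rewrite /Rintegral integral0.
have h1 : (nrm s (fun x => (mollify rho w' x - w' x)%R) <= (3 * (eps / 12))%:E)%E.
  apply: (nrm_mollify rho0 mrho rho1 rhoM (d := d)) => //; first exact: ltW.
  move=> z /rhos[[z1 z2] [z3 z4]]; split.
    by rewrite ltr0_norm; lra.
  by rewrite ltr0_norm; lra.
have mm := measurable_mollify mrho mw'.
rewrite (_ : (fun x => _) = fun x => (w x - w' x) - (mollify rho w' x - w' x)); last first.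
  by apply/funext => x; ring.
apply: le_trans (nrmB_le s md (mfB mm mw')) _.
apply: (@le_trans _ _ (2%:E * ((eps / 4)%:E + (3 * (eps / 12))%:E))%E).
  by apply: lee_wpmul2l => //; exact: leeD.
by rewrite -EFinD -EFinM lee_fin le_eqVlt; apply/orP; left; apply/eqP; field.
Qed.

Lemma closed_square (d N : R) : closed [set x : R * R | (d <= x.1 <= N) && (d <= x.2 <= N)].
Proof.
rewrite (_ : [set x | _] = (fst @^-1` `[d, N]) `&` (snd @^-1` `[d, N])); last first.
  by apply/seteqP; split => x /=; rewrite !in_itv/= => /andP.
by apply: closedI; apply: closed_comp => [x _|]; [exact: cvg_fst|exact: itv_closed|exact: cvg_snd|exact: itv_closed].
Qed.

Lemma compact_square (d N : R) : compact [set x : R * R | (d <= x.1 <= N) && (d <= x.2 <= N)].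
Proof.
rewrite (_ : [set x | _] = `[d, N] `*` `[d, N]); last first.
  by apply/seteqP; split => x /=; rewrite !in_itv/= => /andP.
by apply: compact_setX; exact: segment_compact.
Qed.

Lemma test_function_of_parts (g h : R * R -> R) (d N : R) : 0 < d ->
  (forall n, Ck n g) -> (forall n, Ck n h) ->
  (forall x, g x != 0 -> (d <= x.1 <= N) && (d <= x.2 <= N)) ->
  (forall x, h x != 0 -> (d <= x.1 <= N) && (d <= x.2 <= N)) ->
  test_functionQ (fun x => g x +i* h x).
Proof.
move=> d0 Cg Ch sg sh.
pose S := [set x : R * R | (d <= x.1 <= N) && (d <= x.2 <= N)].
have sub : closure [set x | g x +i* h x != 0] `<=` S.
  rewrite (closure_id S).1; last exact: closed_square.
  apply: closureS => x /=; rewrite eq_complex /= negb_and => /orP[/sg|/sh]//.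
split.
- by move=> n; split; [exact: Cg|exact: Ch].
- apply: subclosed_compact.
    exact: closed_closure.
    exact: (@compact_square d N).
  exact: sub.
- by move=> x /sub /andP[/andP[h1 _] /andP[h2 _]]; split; exact: lt_le_trans d0 _.
Qed.

Lemma csqn_le_cnrm s phi : (csqn phi <= cnrm s phi)%E.
Proof. by apply: leeD; exact: sqn_le_nrm. Qed.

Lemma Re_sub phi psi : Re \o (fun x => phi x - psi x) = fun x => (Re \o phi) x - (Re \o psi) x.
Proof. by apply/funext => x /=; case: (phi x); case: (psi x). Qed.
Lemma Im_sub phi psi : Im \o (fun x => phi x - psi x) = fun x => (Im \o phi) x - (Im \o psi) x.
Proof. by apply/funext => x /=; case: (phi x); case: (psi x). Qed.

Lemma test_functions_dense s phi (eps : R) : 0 <= s -> s < 2^-1 -> 0 < eps ->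
  cmeasurable setT phi -> (cnrm s phi < +oo)%E -> (forall x, phi x != 0 -> quadrant x) ->
  exists2 psi, test_functionQ psi &
    cmeasurable setT (fun x => phi x - psi x) /\ (cnrm s (fun x => phi x - psi x)%R <= eps%:E)%E.
Proof.
move=> s0 s1 e0 [mr mi] np supp; have e2 : 0 < eps / 2 by rewrite divr_gt0.
have nr : (nrm s (Re \o phi) < +oo)%E by apply: le_lt_trans np; apply: leeDl; exact: nrm_ge0.
have ni : (nrm s (Im \o phi) < +oo)%E by apply: le_lt_trans np; apply: leeDr; exact: nrm_ge0.
have sr x : (Re \o phi) x != 0 -> 0 < x.1 /\ 0 < x.2.
  by move=> h; apply: supp; apply: contra_neq h => /= ->.
have si x : (Im \o phi) x != 0 -> 0 < x.1 /\ 0 < x.2.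
  by move=> h; apply: supp; apply: contra_neq h => /= ->.
have [g [d [N [mg Cg d0 sg ng]]]] := smooth_approximation s0 s1 e2 mr nr sr.
have [h [d' [N' [mh Ch d'0 sh nh]]]] := smooth_approximation s0 s1 e2 mi ni si.
exists (fun x => g x +i* h x).
  apply: (test_function_of_parts (d := Num.min d d') (N := Num.max N N')) => //.
  - by rewrite lt_min d0 d'0.
  - move=> x /sg /andP[/andP[h1 h2] /andP[h3 h4]].
    by rewrite !ge_min !le_max h1 h2 h3 h4.
  - move=> x /sh /andP[/andP[h1 h2] /andP[h3 h4]].
    by rewrite !ge_min !le_max h1 h2 h3 h4 !orbT.
split; first by apply: cmeasurableB; split.
by rewrite /cnrm Re_sub Im_sub [eps]splitr EFinD; apply: leeD.
Qed.

End density.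

(** * The zero extension *)

Section quadrant_extension.
Context {R : realType}.
Local Notation mu := (@lebesgue_measure R).
Local Notation leb2 := (@leb2 R).
Local Notation Re := (@complex.Re R).
Local Notation Im := (@complex.Im R).
Implicit Types (s : R) (phi psi u : R * R -> R[i]).

Lemma measurable_quadrant : measurable (@quadrant R : set (measurableTypeR R * measurableTypeR R)).
Proof.
rewrite (_ : quadrant = `]0%R, +oo[%classic `*` `]0%R, +oo[%classic); first by apply: measurableX; exact: measurable_itv.
by apply/seteqP; split => x /=; rewrite !in_itv/= !andbT.
Qed.

Lemma zero_extE u x : zero_ext u x = if x \in quadrant then u x else 0.
Proof. by []. Qed.

Lemma cmeasurable_zero_ext u : cmeasurable quadrant u -> cmeasurable setT (zero_ext u).
Proof.
have H (f : R * R -> R) : measurable_fun quadrant f ->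
    measurable_fun setT (fun x => if x \in quadrant then f x else 0).
  move=> /(measurable_restrictT f measurable_quadrant) => h.
  by rewrite (_ : (fun x => _) = f \_ quadrant).
move=> [mr mi]; split.
  rewrite (_ : _ \o _ = fun x => if x \in quadrant then (Re \o u) x else 0); first exact: H.
  by apply/funext => x /=; rewrite zero_extE; case: ifP.
rewrite (_ : _ \o _ = fun x => if x \in quadrant then (Im \o u) x else 0); first exact: H.
by apply/funext => x /=; rewrite zero_extE; case: ifP.
Qed.

Lemma ae_imp (P Q : R * R -> Prop) : (forall x, P x -> Q x) ->
  (\forall x \ae leb2, P x) -> \forall x \ae leb2, Q x.
Proof.
move=> PQ [N [mN N0 sub]]; exists N; split => // x /= nQ.
by apply: sub => /= Px; exact/nQ/PQ.
Qed.

Lemma sqn_ae0 (f g : R * R -> R) : measurable_fun setT f -> measurable_fun setT g ->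
  (\forall x \ae leb2, f x = g x) -> sqn (fun x => f x - g x) = 0%E.
Proof.
move=> mf mg fg; rewrite /sqn -[RHS](integral0 leb2 setT).
apply: ge0_ae_eq_integral => //.
- by meas.
- by move=> x _; rewrite lee_fin sqr_ge0.
by apply: ae_imp fg => x -> _; rewrite subrr expr0n.
Qed.

Lemma quad_quadrant (f : R * R -> R) x : quad f x = if x \in quadrant then f x else 0.
Proof.
rewrite /quad /cut /cut2; case: ifPn => [h1|/negP h1]; last first.
  by rewrite memNset// => -[].
case: ifPn => [h2|/negP h2]; first by rewrite mem_set.
by rewrite memNset// => -[].
Qed.

(** [phi] equals [u] only almost everywhere on the quadrant, so the zero extension and the cut of
    [phi] may differ on a null set; the factor 2 of [nrm_le_null] accounts for it. *)
Lemma zero_ext_bound s : 0 <= s -> s < 2^-1 -> exists2 C : R, 0 <= C & forall u phi,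
  cmeasurable quadrant u -> in_L2 setT phi -> (phi = u %[ae leb2 in quadrant]) ->
  (cnrm s phi < +oo)%E ->
  in_L2 setT (zero_ext u) /\ (cnrm s (zero_ext u) <= C%:E * cnrm s phi)%E.
Proof.
move=> s0 s1; have [C C0 H] := nrm_quad_le s0 s1; exists (2 * C); first by rewrite mulr_ge0.
move=> u phi mu' /in_L2E[[mr mi] p2] pu np.
have mz := cmeasurable_zero_ext mu'; have [mzr mzi] := mz.
have K (P : R[i] -> R) : P 0 = 0 -> measurable_fun setT (P \o phi) -> measurable_fun setT (P \o zero_ext u) ->
    (sqn (P \o phi) < +oo)%E -> (nrm s (P \o zero_ext u) <= (2 * C)%:E * nrm s (P \o phi))%E.
  move=> P0 mp mzp sp; have mq := measurable_quad mp.
  apply: (@le_trans _ _ (2%:E * nrm s (quad (P \o phi)))%E).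
    apply: nrm_le_null => //; apply: sqn_ae0 => //.
    apply: ae_imp pu => x hx /=; rewrite quad_quadrant zero_extE /=; case: ifPn => // xq.
    by rewrite hx// -in_setE.
  by rewrite EFinM -muleA; apply: lee_wpmul2l => //; exact: H.
have r2 : (sqn (Re \o phi) < +oo)%E by apply: le_lt_trans p2; apply: leeDl; exact: sqn_ge0.
have i2 : (sqn (Im \o phi) < +oo)%E by apply: le_lt_trans p2; apply: leeDr; exact: sqn_ge0.
have Kr := K Re erefl mr mzr r2; have Ki := K Im erefl mi mzi i2.
have bound : (cnrm s (zero_ext u) <= (2 * C)%:E * cnrm s phi)%E.
  by rewrite /cnrm ge0_muleDr ?nrm_ge0//; exact: leeD.
split => //; apply/in_L2E; split => //.
apply: le_lt_trans (csqn_le_cnrm s _) _; apply: le_lt_trans bound _.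
by rewrite lte_mul_pinfty// lee_fin mulr_ge0.
Qed.

Lemma Espace_zero_ext s u : HspaceQ s u -> 0 <= s -> s < 2^-1 -> Espace s u.
Proof.
move=> [Lu [phi [Lp hp] pu]] s0 s1; split => //.
have [C C0 H] := zero_ext_bound s0 s1.
have np : (cnrm s phi < +oo)%E by apply/(Hnorm_lt s0 s1 Lp).
have [mu' _] := Lu; have [Lz bz] := H u phi mu' Lp pu np.
split => //; apply/(Hnorm_lt s0 s1 Lz); apply: le_lt_trans bz _.
by rewrite lte_mul_pinfty.
Qed.

(** The zero extension is itself an admissible extension, and subtracting a test function [psi] from
    it gives an extension of [u - psi]; its norm bounds the infimum. *)
Lemma Espace_H0 s u : 0 <= s -> s < 2^-1 -> Espace s u -> H0spaceQ s u.
Proof.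
move=> s0 s1 [Lu [Lz hz]]; split.
  split => //; exists (zero_ext u); first by split.
  by apply: aeW => x xq; rewrite zero_extE mem_set.
move=> e e0; have [A A0 HA] := Hnorm_small s0 s1.
have nz : (cnrm s (zero_ext u) < +oo)%E by apply/(Hnorm_lt s0 s1 Lz).
have /in_L2E[mz _] := Lz.
(* Density provides a weak inequality, while the closure asks for a strict one. *)
have e2 : 0 < e / 2 by rewrite divr_gt0.
have [|psi tp [mp np]] := test_functions_dense s0 s1 (mulr_gt0 A0 (exprn_gt0 2 e2)) mz nz.
  move=> x; rewrite zero_extE; case: ifPn => [|_]; last by rewrite eqxx.
  by rewrite in_setE.
exists psi => //.
have Ld : in_L2 setT (fun x => zero_ext u x - psi x).
  apply/in_L2E; split => //; apply: le_lt_trans (csqn_le_cnrm s _) _.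
  by apply: le_lt_trans np _; rewrite ltry.
have hd := HA _ _ (ltW e2) Ld np.
apply: (@le_lt_trans _ _ (e / 2)%:E); last by rewrite lte_fin ltr_pdivrMr// mulr_natr mulr2n ltrDl.
apply: ge_ereal_inf; exists (Hnorm s (fun x => zero_ext u x - psi x)) => //.
exists (fun x => zero_ext u x - psi x) => //; split; first by split => //; apply: le_lt_trans hd _; rewrite ltry.
by apply: aeW => x xq; rewrite zero_extE mem_set.
Qed.

(** The constant of [zero_ext_bound] is the same for all extensions, so after division by [c] the
    norm of the zero extension is a lower bound for all of their norms, hence for the infimum. *)
Lemma zero_ext_norm_bound s : 0 <= s -> s < 2^-1 -> exists c : R, 0 < c /\
  forall u, Espace s u -> (Hnorm s (zero_ext u) <= c%:E * HnormQ s u)%E.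
Proof.
move=> s0 s1; have [C C0 H] := zero_ext_bound s0 s1; have [A A0 HA] := Hnorm_le s0 s1.
(* Adding 1 makes the constant positive even if [C = 0]. *)
pose c := Num.sqrt (A * C) + 1; have c0 : 0 < c by rewrite ltr_wpDl ?sqrtr_ge0.
exists c; split => // u [[mu' _] [Lz hz]].
have hle : (c^-1%:E * Hnorm s (zero_ext u) <= HnormQ s u)%E.
  apply: le_ereal_inf_tmp => _ [phi [[Lp hp] pu] <-].
  have np : (cnrm s phi < +oo)%E by apply/(Hnorm_lt s0 s1 Lp).
  have [_ bz] := H u phi mu' Lp pu np.
  apply: (@le_trans _ _ (c^-1%:E * (c%:E * Hnorm s phi))%E); last first.
    by rewrite muleA -EFinM mulVf ?gt_eqF// mul1e.
  apply: lee_wpmul2l; first by rewrite lee_fin invr_ge0 ltW.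
  apply: le_trans (HA C _ _ C0 Lz Lp bz) _; apply: lee_wpmul2r; first exact: L2norm_ge0.
  by rewrite lee_fin lerDl.
rewrite -[X in (X <= _)%E]mul1e (_ : 1%E = (c%:E * c^-1%:E)%E); last by rewrite -EFinM mulfV// gt_eqF.
by rewrite -muleA; apply: lee_wpmul2l => //; rewrite lee_fin ltW.
Qed.

End quadrant_extension.

Theorem theoremB2 (R : realType) (s : R) (s_ge0 : 0 <= s) (s_lt : s < 2^-1) :
  Espace s = H0spaceQ s /\
  exists c : R, 0 < c /\
    forall u : R * R -> R[i], Espace s u ->
      (Hnorm s (zero_ext u) <= c%:E * HnormQ s u)%E.
Proof.
split; last exact: zero_ext_norm_bound.
apply/seteqP; split => u; first exact: Espace_H0.
by move=> [hu _]; exact: Espace_zero_ext.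
Qed.
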